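(* Let $\mathbb X$ be a virtual equipment and let $j\colon A\to E$ be a dense tight-cell in $\mathbb X$. A tight-cell $r\colon D\to E$ is non-strictly $j$-monadic if and only if $r$ admits a left $j$-adjoint, the induced $j$-monad admits an algebra object, and $r$ non-strictly creates $j$-absolute $r$-extensions.
   Context: **Virtual equipments.** A virtual double category has objects, tight-cells $f\colon A\to B$ (forming a category; both $(f;g)$ and $gf$ denote $f$ followed by $g$), loose-cells, written $p\colon X\nrightarrow Y$, and 2-cells. A 2-cell has as top a chain of loose-cells $p_1\colon A_1\nrightarrow A_0,\dots,p_n\colon A_n\nrightarrow A_{n-1}$ ($n\ge 0$), as bottom a loose-cell $q\colon B_n\nrightarrow B_0$, and as sides tight-cells $f_0\colon A_0\to B_0$, $f_n\colon A_n\to B_n$; 2-cells paste multicategorically, associatively and unitally. $p_1,\dots,p_n\Rightarrow q$ denotes a 2-cell with identity sides. A virtual equipment is a virtual double category in which: every $p\colon X\nrightarrow Y$, $f\colon Z\to Y$, $g\colon W\to X$ admit a restriction $p(f,g)\colon W\nrightarrow Z$ (2-cells with bottom $p(f,g)$ and sides $h_0,h_n$ correspond bijectively, by pasting with a cartesian 2-cell, to 2-cells with bottom $p$ and sides $(h_0;f),(h_n;g)$); and every object $A$ has a loose-identity $A(1,1)\colon A\nrightarrow A$ (with a 2-cell from the empty chain to $A(1,1)$, pasting with which gives a bijection between 2-cells whose top chain contains $A(1,1)$ at a given place and 2-cells with that entry omitted). Write $B(f,g):=B(1,1)(f,g)$. A 2-cell $f\Rightarrow g$ between parallel tight-cells into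 $B$ is a 2-cell from the empty chain to $B(f,g)$; objects, tight-cells and such 2-cells form a 2-category. There are composition 2-cells $B(f,g),B(g,h)\Rightarrow B(f,h)$. A tight-cell $k\colon B\to C$ induces $B(f,g)\Rightarrow C(kf,kg)$, and $(\phi;k)$ denotes the composite of $\phi\colon p_1,\dots,p_n\Rightarrow B(f,g)$ with it. For $\phi\colon E(j,e)\Rightarrow E(t,e)$, $\phi(1,x)\colon E(j,ex)\Rightarrow E(t,ex)$ denotes restriction along $x$. **Relative monads and algebras.** A $j$-monad $T=(t,\dagger,\eta)$, for $j\colon A\to E$, consists of a tight-cell $t\colon A\to E$ and 2-cells $\dagger\colon E(j,t)\Rightarrow E(t,t)$, $\eta\colon j\Rightarrow t$ such that: $\dagger$ followed by the 2-cell $E(t,t)\Rightarrow E(j,t)$ induced by $\eta$ is the identity; $\eta$ followed by $\dagger$ is the identity 2-cell on $t$; and the two 2-cells $E(j,t),E(j,t)\Rightarrow E(t,t)$, given by $(\dagger,\dagger)$ then composition, and by $\dagger$ on the second factor, then composition $E(j,t),E(t,t)\Rightarrow E(j,t)$, then $\dagger$, are equal. A $T$-algebra is a tight-cell $e\colon D\to E$ with a 2-cell $\rtimes\colon E(j,e)\Rightarrow E(t,e)$ such that $\rtimes$ followed by $E(t,e)\Rightarrow E(j,e)$ (induced by $\eta$) is the identity, and the two 2-cells $E(j,t),E(j,e)\Rightarrow E(t,e)$, given by $(\dagger,\rtimes)$ then composition, and by $\rtimes$ on the second factor, then composition $E(j,t),E(t,e)\Rightarrow E(j,e)$, then $\rtimes$,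 are equal. For a chain $p_1,\dots,p_n$ from $D$ (left end) to $D'$ (right end), a $(p_1,\dots,p_n)$-graded morphism $(e\colon D\to E,\rtimes)\to(e'\colon D'\to E,\rtimes')$ is a 2-cell $\epsilon\colon p_1,\dots,p_n\Rightarrow E(e,e')$ such that the two 2-cells $E(j,e),p_1,\dots,p_n\Rightarrow E(t,e')$, given by $\rtimes$ then composing with $\epsilon$, and by composing with $\epsilon$ then $\rtimes'$, are equal. An algebra object for $T$ is a $T$-algebra $(u_T\colon \mathrm{Alg}(T)\to E,\rtimes_T)$ such that (1) for every $T$-algebra $(e\colon D\to E,\rtimes)$ there is a unique tight-cell $\langle e\rangle\colon D\to\mathrm{Alg}(T)$ with $(\langle e\rangle;u_T)=e$ and $\rtimes_T(1,\langle e\rangle)=\rtimes$; (2) every graded $T$-algebra morphism $\epsilon\colon p_1,\dots,p_n\Rightarrow E(e,e')$ is $(\langle\epsilon\rangle;u_T)$ for a unique 2-cell $\langle\epsilon\rangle\colon p_1,\dots,p_n\Rightarrow\mathrm{Alg}(T)(\langle e\rangle,\langle e'\rangle)$. **Relative adjunctions.** A $j$-adjunction $\ell\dashv_j r$ with apex $C$ consists of tight-cells $\ell\colon A\to C$ (left $j$-adjoint), $r\colon C\to E$ (right $j$-adjoint) and an isomorphism $\sharp\colon C(\ell,1)\cong E(j,r)$. It induces a $j$-monad with carrier $(\ell;r)$, unit $j\Rightarrow r\ell$ the image under $\sharp$ of the identity on $\ell$, and extension operator $E(j,r\ell)\cong C(\ell,\ell)\Rightarrow E(r\ell,r\ell)$.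 If $\ell\dashv_j r$ induces $T$, then $r$ is a $T$-algebra via $E(j,r)\cong C(\ell,1)\Rightarrow E(r\ell,r)$; if $T$ admits an algebra object, the induced tight-cell $C\to\mathrm{Alg}(T)$ is the comparison tight-cell. **Non-strict monadicity.** $r\colon D\to E$ is non-strictly $j$-monadic if it admits a left $j$-adjoint, the induced $j$-monad $T$ admits an algebra object, and the comparison tight-cell $D\to\mathrm{Alg}(T)$ is an equivalence. **Colimits.** For $p\colon X\nrightarrow Y$ and $f\colon Y\to Z$, a $p$-cocone for $f$ is a tight-cell $c\colon X\to Z$ with a 2-cell $\lambda\colon p\Rightarrow Z(f,c)$. It is the colimit $p\circledast f$ if, for all chains $q_1,\dots,q_n$ ($n\ge0$) from $X$ to $Z$, pasting with $\lambda$ (and composing $Z(f,c),Z(c,1)\Rightarrow Z(f,1)$) is a bijection from 2-cells $q_1,\dots,q_n\Rightarrow Z(c,1)$ to 2-cells $p,q_1,\dots,q_n\Rightarrow Z(f,1)$. For $c\colon D\to C'$ and $f\colon D\to Z$, the left extension $c\rhd f\colon C'\to Z$ is the $C'(c,1)$-weighted colimit of $f$. $j\colon A\to E$ is dense if $1_E$, with the identity 2-cell on $E(j,1)$, is the left extension $j\rhd j$. A colimit $(p\circledast f,\lambda)$ in $E$ is $j$-absolute if the 2-cell $E(j,f),p\Rightarrow E(j,p\circledast f)$ induced by $\lambda$ is left-opcartesian: every 2-cell with top chain $E(j,f),p,q_1,\dots,q_m$ ($m\ge0$) factors uniquely through it, via a 2-cell with top chain $E(j,p\circledast f),q_1,\dots,q_m$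 (equivalently, the left-composite of $E(j,f)$ and $p$ exists and the canonical 2-cell from it to $E(j,p\circledast f)$ is invertible). **Non-strict creation.** For $p\colon Y\nrightarrow Z$, $f\colon Z\to W$, $g\colon W\to X$ such that the colimit $p\circledast(f;g)$ exists, this colimit is non-strictly created by $g$ if (1) for every $p$-cocone $(w,\lambda')$ for $f$, the $p$-cocone $((w;g),(\lambda';g))$ is the $p$-colimit of $(f;g)$ if and only if $(w,\lambda')$ is the $p$-colimit of $f$; and (2) $W$ admits the colimit $p\circledast f$. **$r$-extensions.** For $r\colon D\to E$, an $r$-extension is a left extension $c\rhd r$ for some tight-cell $c$ with domain $D$, i.e. a colimit $C'(c,1)\circledast(1_D;r)$ with $c\colon D\to C'$. ''$r$ non-strictly creates $j$-absolute $r$-extensions'' means each $r$-extension that exists in $E$ and is $j$-absolute is non-strictly created by $r$ (taking $f=1_D$, $g=r$). *)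

(* Defs.v *)
From Stdlib Require Import ProofIrrelevance Setoid.

Set Implicit Arguments.
Unset Strict Implicit.
Unset Printing Implicit Defensive.

Declare Scope vdc_scope.
Delimit Scope vdc_scope with vdc.
Local Open Scope vdc_scope.

(** * Virtual double categories *)

(* [chain L A0 An] is the type of chains p_1 : A1 -|-> A0, ..., p_n : An -|-> A(n-1):
   its first index is the left end, so that consecutive entries run right to left. *)
Inductive chain (O : Type) (L : O -> O -> Type) : O -> O -> Type :=
| cnil (A : O) : chain L A A
| ccons (A0 A1 An : O) (p : L A1 A0) (ps : chain L A1 An) : chain L A0 An.

Arguments cnil {O L A}.
Arguments ccons {O L A0 A1 An} p ps.

Fixpoint capp (O : Type) (L : O -> O -> Type) (A B C : O) (ps : chain L A B) :
    chain L B C -> chain L A C :=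
  match ps in chain _ A B return chain L B C -> chain L A C with
  | cnil => fun qs => qs
  | ccons p ps' => fun qs => ccons p (capp ps' qs)
  end.

Infix ":::" := ccons (at level 60, right associativity) : vdc_scope.
Infix "+++" := capp (at level 60, right associativity) : vdc_scope.
Notation "[: p ; .. ; q ]" := (ccons p .. (ccons q cnil) ..)
  (at level 0, format "[: p ; .. ; q ]") : vdc_scope.

Lemma cappA (O : Type) (L : O -> O -> Type) (A B C D : O)
    (ps : chain L A B) (qs : chain L B C) (rs : chain L C D) :
  (ps +++ qs) +++ rs = ps +++ (qs +++ rs).
Proof. induction ps; simpl; congruence. Qed.

Lemma capp_nil (O : Type) (L : O -> O -> Type) (A B : O) (ps : chain L A B) :
  ps = ps +++ cnil.
Proof. induction ps; simpl; congruence. Qed.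

(* [tcomp f g] is f followed by g.  A cell in [cell ps q f0 fn] has top chain [ps],
   bottom [q], left side [f0] and right side [fn]. *)
Record vd_graph := VDGraph {
  ob : Type;
  tight : ob -> ob -> Type;
  tid : forall A, tight A A;
  tcomp : forall A B C, tight A B -> tight B C -> tight A C;
  loose : ob -> ob -> Type;
  cell : forall A0 An B0 Bn,
    chain loose A0 An -> loose Bn B0 -> tight A0 B0 -> tight An Bn -> Type
}.

Arguments tight {v} _ _.
Arguments tid {v} A.
Arguments tcomp {v A B C} f g.
Arguments loose {v} _ _.
Arguments cell {v A0 An B0 Bn} ps q f0 fn.

Infix ";;" := tcomp (at level 40, left associativity) : vdc_scope.

Section Cells.

Variable V : vd_graph.
Implicit Types A B C : ob V.

(* Horizontally adjacent cells.  Here and below, boundaries that are only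
   propositionally equal to a concatenation or to a composite are mediated by
   explicit equality arguments, so that all laws are homogeneous equalities. *)
Inductive cells : forall A0 An B0 Bn, chain (@loose V) A0 An -> chain (@loose V) B0 Bn ->
    tight A0 B0 -> tight An Bn -> Type :=
| cells_nil A B (f : tight A B) : cells cnil cnil f f
| cells_cons A0 A1 An B0 B1 Bn
    (top : chain (@loose V) A0 An) (ps : chain (@loose V) A0 A1) (ps' : chain (@loose V) A1 An)
    (q : loose B1 B0) (qs : chain (@loose V) B1 Bn)
    (f0 : tight A0 B0) (f1 : tight A1 B1) (fn : tight An Bn) :
    top = ps +++ ps' -> cell ps q f0 f1 -> cells ps' qs f1 fn -> cells top (q ::: qs) f0 fn.

Definition cells1 A0 An B0 Bn (ps : chain (@loose V) A0 An) (q : loose Bn B0)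
    (f0 : tight A0 B0) (fn : tight An Bn) (phi : cell ps q f0 fn) : cells ps [: q] f0 fn :=
  cells_cons (capp_nil ps) phi (cells_nil fn).

Fixpoint cells_app A0 A1 B0 B1 (ps : chain (@loose V) A0 A1) (qs : chain (@loose V) B0 B1)
    (f0 : tight A0 B0) (f1 : tight A1 B1) (Phi : cells ps qs f0 f1) :
    forall An Bn (ps' : chain (@loose V) A1 An) (qs' : chain (@loose V) B1 Bn)
      (fn : tight An Bn),
    cells ps' qs' f1 fn -> cells (ps +++ ps') (qs +++ qs') f0 fn :=
  match Phi in @cells A0 A1 B0 B1 ps qs f0 f1 return
    forall An Bn (ps' : chain (@loose V) A1 An) (qs' : chain (@loose V) B1 Bn)
      (fn : tight An Bn),
    cells ps' qs' f1 fn -> cells (ps +++ ps') (qs +++ qs') f0 fn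
  with
  | cells_nil f => fun _ _ _ _ _ Psi => Psi
  | cells_cons e phi Phi' => fun _ _ _ _ _ Psi =>
      cells_cons (eq_trans (f_equal (fun c => c +++ _) e) (cappA _ _ _))
        phi (cells_app Phi' Psi)
  end.

End Cells.

Arguments cells {V A0 An B0 Bn} _ _ _ _.
Arguments cells_nil {V A B} f.
Arguments cells_cons {V A0 A1 An B0 B1 Bn top ps ps' q qs f0 f1 fn} _ _ _.
Arguments cells1 {V A0 An B0 Bn ps q f0 fn} phi.
Arguments cells_app {V A0 A1 B0 B1 ps qs f0 f1} Phi {An Bn ps' qs' fn} _.

(* The sides of a pasting are given up to equality: [paste Phi psi e0 en] lives over
   any [h0] and [hn] with [e0 : h0 = f0 ;; g0] and [en : hn = fn ;; gn]. *)
Record vd_ops := VDOps {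
  vd_graph_of :> vd_graph;
  cid : forall (X Y : ob vd_graph_of) (p : loose X Y), cell [: p] p (tid Y) (tid X);
  paste : forall (A0 An B0 Bn C0 Cn : ob vd_graph_of)
    (ps : chain (@loose vd_graph_of) A0 An) (qs : chain (@loose vd_graph_of) B0 Bn)
    (r : loose Cn C0) (f0 : tight A0 B0) (fn : tight An Bn)
    (g0 : tight B0 C0) (gn : tight Bn Cn) (h0 : tight A0 C0) (hn : tight An Cn),
    cells ps qs f0 fn -> cell qs r g0 gn -> h0 = f0 ;; g0 -> hn = fn ;; gn ->
    cell ps r h0 hn
}.

Arguments cid {v X Y} p.
Arguments paste {v A0 An B0 Bn C0 Cn ps qs r f0 fn g0 gn h0 hn} Phi psi e0 en.

Section Ops.

Variable V : vd_ops.
Implicit Types A B C : ob V.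

Fixpoint cids A0 An (ps : chain (@loose V) A0 An) : cells ps ps (tid A0) (tid An) :=
  match ps in chain _ A0 An return cells ps ps (tid A0) (tid An) with
  | cnil => cells_nil (tid _)
  | ccons p ps' => @cells_cons _ _ _ _ _ _ _ (p ::: ps') [: p] ps' _ _ _ _ _
      eq_refl (cid p) (cids ps')
  end.

(* Two vertically composable layers: each cell of the lower layer comes with the
   cells of the upper layer lying above it. *)
Inductive cells2 : forall A0 An B0 Bn C0 Cn,
    chain (@loose V) A0 An -> chain (@loose V) B0 Bn -> chain (@loose V) C0 Cn ->
    tight A0 B0 -> tight An Bn -> tight B0 C0 -> tight Bn Cn ->
    tight A0 C0 -> tight An Cn -> Type :=
| cells2_nil A B C (f : tight A B) (g : tight B C) (h : tight A C) :
    h = f ;; g -> cells2 cnil cnil cnil f f g g h h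
| cells2_cons A0 A1 An B0 B1 Bn C0 C1 Cn
    (top : chain (@loose V) A0 An) (ps : chain (@loose V) A0 A1) (ps' : chain (@loose V) A1 An)
    (mid : chain (@loose V) B0 Bn) (qs : chain (@loose V) B0 B1) (qs' : chain (@loose V) B1 Bn)
    (r : loose C1 C0) (rs : chain (@loose V) C1 Cn)
    (f0 : tight A0 B0) (f1 : tight A1 B1) (fn : tight An Bn)
    (g0 : tight B0 C0) (g1 : tight B1 C1) (gn : tight Bn Cn)
    (h0 : tight A0 C0) (h1 : tight A1 C1) (hn : tight An Cn) :
    top = ps +++ ps' -> mid = qs +++ qs' -> h0 = f0 ;; g0 -> h1 = f1 ;; g1 ->
    cells ps qs f0 f1 -> cell qs r g0 g1 ->
    cells2 ps' qs' rs f1 fn g1 gn h1 hn ->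
    cells2 top mid (r ::: rs) f0 fn g0 gn h0 hn.

Arguments cells2_nil {A B C} f g h _.

Fixpoint cells2_upper A0 An B0 Bn C0 Cn ps qs rs f0 fn g0 gn h0 hn
    (Th : @cells2 A0 An B0 Bn C0 Cn ps qs rs f0 fn g0 gn h0 hn) : cells ps qs f0 fn :=
  match Th in @cells2 A0 An B0 Bn C0 Cn ps qs rs f0 fn g0 gn h0 hn
    return cells ps qs f0 fn with
  | cells2_nil f g h _ => cells_nil f
  | cells2_cons et em _ _ Phi _ Th' =>
      match eq_sym et in _ = t, eq_sym em in _ = m return cells t m _ _ with
      | eq_refl, eq_refl => cells_app Phi (cells2_upper Th')
      end
  end.

Fixpoint cells2_lower A0 An B0 Bn C0 Cn ps qs rs f0 fn g0 gn h0 hn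
    (Th : @cells2 A0 An B0 Bn C0 Cn ps qs rs f0 fn g0 gn h0 hn) : cells qs rs g0 gn :=
  match Th in @cells2 A0 An B0 Bn C0 Cn ps qs rs f0 fn g0 gn h0 hn
    return cells qs rs g0 gn with
  | cells2_nil f g h _ => cells_nil g
  | cells2_cons _ em _ _ _ psi Th' => cells_cons em psi (cells2_lower Th')
  end.

Fixpoint cells2_comp A0 An B0 Bn C0 Cn ps qs rs f0 fn g0 gn h0 hn
    (Th : @cells2 A0 An B0 Bn C0 Cn ps qs rs f0 fn g0 gn h0 hn) : cells ps rs h0 hn :=
  match Th in @cells2 A0 An B0 Bn C0 Cn ps qs rs f0 fn g0 gn h0 hn
    return cells ps rs h0 hn with
  | cells2_nil f g h _ => cells_nil h
  | cells2_cons et _ e0 e1 Phi psi Th' => cells_cons et (paste Phi psi e0 e1) (cells2_comp Th')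
  end.

End Ops.

Arguments cids {V A0 An} ps.
Arguments cells2_nil {V A B C} f g h _.
Arguments cells2_cons {V A0 A1 An B0 B1 Bn C0 C1 Cn top ps ps' mid qs qs' r rs
  f0 f1 fn g0 g1 gn h0 h1 hn} _ _ _ _ _ _ _.

Record vdc := VDC {
  vd_ops_of :> vd_ops;
  tcompA : forall (A B C D : ob vd_ops_of) (f : tight A B) (g : tight B C) (h : tight C D),
    f ;; g ;; h = f ;; (g ;; h);
  tcomp1f : forall (A B : ob vd_ops_of) (f : tight A B), tid A ;; f = f;
  tcompf1 : forall (A B : ob vd_ops_of) (f : tight A B), f ;; tid B = f;
  paste_cids : forall (A0 An B0 Bn : ob vd_ops_of) (ps : chain (@loose vd_ops_of) A0 An)
    (q : loose Bn B0) (f0 : tight A0 B0) (fn : tight An Bn) (phi : cell ps q f0 fn) e0 en,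
    paste (cids ps) phi e0 en = phi;
  paste_cid : forall (A0 An B0 Bn : ob vd_ops_of) (ps : chain (@loose vd_ops_of) A0 An)
    (q : loose Bn B0) (f0 : tight A0 B0) (fn : tight An Bn) (phi : cell ps q f0 fn) e0 en,
    paste (cells1 phi) (cid q) e0 en = phi;
  paste_assoc : forall (A0 An B0 Bn C0 Cn D0 Dn : ob vd_ops_of)
    (ps : chain (@loose vd_ops_of) A0 An) (qs : chain (@loose vd_ops_of) B0 Bn)
    (rs : chain (@loose vd_ops_of) C0 Cn) (s : loose Dn D0)
    (f0 : tight A0 B0) (fn : tight An Bn) (g0 : tight B0 C0) (gn : tight Bn Cn)
    (h0 : tight A0 C0) (hn : tight An Cn) (k0 : tight C0 D0) (kn : tight Cn Dn)
    (gk0 : tight B0 D0) (gkn : tight Bn Dn) (l0 : tight A0 D0) (ln : tight An Dn)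
    (Th : cells2 ps qs rs f0 fn g0 gn h0 hn) (chi : cell rs s k0 kn) e0 en d0 dn c0 cn,
    paste (cells2_comp Th) chi (e0 : l0 = h0 ;; k0) (en : ln = hn ;; kn) =
    paste (cells2_upper Th)
      (paste (cells2_lower Th) chi (d0 : gk0 = g0 ;; k0) (dn : gkn = gn ;; kn)) c0 cn
}.

Definition graft (V : vdc) (A0 B B' An C0 Cn : ob V)
    (ps : chain (@loose V) A0 B) (ts : chain (@loose V) B B') (q : loose B' B)
    (theta : cell ts q (tid B) (tid B')) (qs : chain (@loose V) B' An)
    (r : loose Cn C0) (f : tight A0 C0) (g : tight An Cn)
    (psi : cell (ps +++ q ::: qs) r f g) : cell (ps +++ ts +++ qs) r f g :=
  paste (cells_app (cids ps) (cells_cons eq_refl theta (cids qs))) psi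
    (eq_sym (tcomp1f f)) (eq_sym (tcomp1f g)).

Arguments graft {V A0 B B' An C0 Cn} ps {ts q} theta qs {r f g} psi.

(** * Virtual equipments *)

(* For p : X -|-> Y, f : Z -> Y and g : W -> X, [restr p f g] is p(f,g) : W -|-> Z, with
   cartesian cell [cart p f g]; [rfact] inverts pasting with it.  [lid A] is the
   loose-identity A(1,1), and [lfact] inverts pasting with [lunit A]. *)
Record equipment := Equipment {
  vdc_of :> vdc;
  restr : forall X Y Z W : ob vdc_of, loose X Y -> tight Z Y -> tight W X -> loose W Z;
  cart : forall (X Y Z W : ob vdc_of) (p : loose X Y) (f : tight Z Y) (g : tight W X),
    cell [: restr p f g] p f g;
  rfact : forall (X Y Z W A0 An : ob vdc_of) (p : loose X Y) (f : tight Z Y) (g : tight W X)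
    (ps : chain (@loose vdc_of) A0 An) (h0 : tight A0 Z) (hn : tight An W)
    (k0 : tight A0 Y) (kn : tight An X),
    cell ps p k0 kn -> k0 = h0 ;; f -> kn = hn ;; g -> cell ps (restr p f g) h0 hn;
  rfactK : forall (X Y Z W A0 An : ob vdc_of) (p : loose X Y) (f : tight Z Y) (g : tight W X)
    (ps : chain (@loose vdc_of) A0 An) (h0 : tight A0 Z) (hn : tight An W)
    (k0 : tight A0 Y) (kn : tight An X) (phi : cell ps p k0 kn)
    (e0 : k0 = h0 ;; f) (en : kn = hn ;; g),
    paste (cells1 (rfact phi e0 en)) (cart p f g) e0 en = phi;
  pasteK : forall (X Y Z W A0 An : ob vdc_of) (p : loose X Y) (f : tight Z Y) (g : tight W X)
    (ps : chain (@loose vdc_of) A0 An) (h0 : tight A0 Z) (hn : tight An W)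
    (k0 : tight A0 Y) (kn : tight An X) (psi : cell ps (restr p f g) h0 hn)
    (e0 : k0 = h0 ;; f) (en : kn = hn ;; g),
    rfact (paste (cells1 psi) (cart p f g) e0 en) e0 en = psi;
  lid : forall A : ob vdc_of, loose A A;
  lunit : forall A : ob vdc_of, cell cnil (lid A) (tid A) (tid A);
  lfact : forall (A0 A An C0 Cn : ob vdc_of)
    (ps : chain (@loose vdc_of) A0 A) (qs : chain (@loose vdc_of) A An)
    (r : loose Cn C0) (f : tight A0 C0) (g : tight An Cn),
    cell (ps +++ qs) r f g -> cell (ps +++ lid A ::: qs) r f g;
  lfactK : forall (A0 A An C0 Cn : ob vdc_of)
    (ps : chain (@loose vdc_of) A0 A) (qs : chain (@loose vdc_of) A An)
    (r : loose Cn C0) (f : tight A0 C0) (g : tight An Cn) (phi : cell (ps +++ qs) r f g),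
    graft ps (lunit A) qs (lfact phi) = phi;
  graftK : forall (A0 A An C0 Cn : ob vdc_of)
    (ps : chain (@loose vdc_of) A0 A) (qs : chain (@loose vdc_of) A An)
    (r : loose Cn C0) (f : tight A0 C0) (g : tight An Cn)
    (psi : cell (ps +++ lid A ::: qs) r f g),
    lfact (graft ps (lunit A) qs psi) = psi
}.

Arguments restr {e X Y Z W} p f g.
Arguments cart {e X Y Z W} p f g.
Arguments rfact {e X Y Z W A0 An p f g ps h0 hn k0 kn} phi e0 en.
Arguments lid {e} A.
Arguments lunit {e} A.
Arguments lfact {e A0 A An C0 Cn} ps qs {r f g} phi.
Arguments lfactK {e A0 A An C0 Cn} ps qs {r f g} phi.

Section Pasting.

Variable V : vdc.
Implicit Types A B C : ob V.

Definition t1f A B (f : tight A B) : f = tid A ;; f := eq_sym (tcomp1f f).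
Definition tf1 A B (f : tight A B) : f = f ;; tid B := eq_sym (tcompf1 f).

Definition cells_pair A0 A1 A2 B0 B1 B2
    (ps : chain (@loose V) A0 A1) (ps' : chain (@loose V) A1 A2) (q : loose B1 B0)
    (q' : loose B2 B1) (f0 : tight A0 B0) (f1 : tight A1 B1) (f2 : tight A2 B2)
    (phi : cell ps q f0 f1) (psi : cell ps' q' f1 f2) : cells (ps +++ ps') [: q; q'] f0 f2 :=
  cells_cons eq_refl phi (cells1 psi).

Definition vcomp A An (ps : chain (@loose V) A An) (q r : loose An A)
    (phi : cell ps q (tid A) (tid An)) (psi : cell [: q] r (tid A) (tid An)) :
    cell ps r (tid A) (tid An) :=
  paste (cells1 phi) psi (t1f _) (t1f _).

Definition cells_cast A0 An B0 Bn (ps ps' : chain (@loose V) A0 An)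
    (qs qs' : chain (@loose V) B0 Bn) (f0 : tight A0 B0) (fn : tight An Bn)
    (e : ps = ps') (e' : qs = qs') (Phi : cells ps qs f0 fn) : cells ps' qs' f0 fn :=
  match e in _ = t, e' in _ = m return cells t m f0 fn with
  | eq_refl, eq_refl => Phi
  end.

Lemma cells_cast_id A0 An B0 Bn (ps : chain (@loose V) A0 An)
    (qs : chain (@loose V) B0 Bn) (f0 : tight A0 B0) (fn : tight An Bn) e e'
    (Phi : cells ps qs f0 fn) : cells_cast e e' Phi = Phi.
Proof.
rewrite (proof_irrelevance _ e eq_refl), (proof_irrelevance _ e' eq_refl).
reflexivity.
Qed.

Lemma cells_app_nil A0 An B0 Bn (ps : chain (@loose V) A0 An)
    (qs : chain (@loose V) B0 Bn) (f0 : tight A0 B0) (fn : tight An Bn)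
    (Phi : cells ps qs f0 fn) e e' :
  cells_cast e e' (cells_app Phi (cells_nil fn)) = Phi.
Proof.
induction Phi as [A B f|A0 A1 An B0 B1 Bn top ps ps' q qs f0 f1 fn et phi Phi IH].
- apply cells_cast_id.
- specialize (IH (eq_sym (capp_nil _)) (eq_sym (capp_nil _))).
  revert e e'; simpl.
  generalize (eq_trans (f_equal (fun c => c +++ cnil) et) (cappA ps ps' cnil)).
  revert IH; generalize (eq_sym (capp_nil ps')) (eq_sym (capp_nil qs)).
  generalize (cells_app Phi (cells_nil fn)).
  generalize (top +++ cnil).
  generalize (ps' +++ cnil) (qs +++ cnil).
  intros c c0 c1 Psi e e0; destruct e, e0; simpl; intros IH e e' e''.
  subst Psi; destruct e'; rewrite (proof_irrelevance _ e'' eq_refl); simpl.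
  f_equal; apply proof_irrelevance.
Qed.

Lemma cells_app_single A0 A1 An B0 B1 Bn (ps : chain (@loose V) A0 A1)
    (ps' : chain (@loose V) A1 An) (q : loose B1 B0) (qs : chain (@loose V) B1 Bn)
    (f0 : tight A0 B0) (f1 : tight A1 B1) (fn : tight An Bn)
    (phi : cell ps q f0 f1) (Phi : cells ps' qs f1 fn) :
  cells_app (cells1 phi) Phi = cells_cons eq_refl phi Phi.
Proof. simpl; f_equal; apply proof_irrelevance. Qed.

Lemma paste_paste1 A0 An B0 Bn C0 Cn D0 Dn
    (ps : chain (@loose V) A0 An) (qs : chain (@loose V) B0 Bn)
    (r : loose Cn C0) (s : loose Dn D0)
    (f0 : tight A0 B0) (fn : tight An Bn) (g0 : tight B0 C0) (gn : tight Bn Cn)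
    (h0 : tight A0 C0) (hn : tight An Cn) (k0 : tight C0 D0) (kn : tight Cn Dn)
    (gk0 : tight B0 D0) (gkn : tight Bn Dn) (l0 : tight A0 D0) (ln : tight An Dn)
    (Phi : cells ps qs f0 fn) (psi : cell qs r g0 gn) (chi : cell [: r] s k0 kn)
    (a0 : h0 = f0 ;; g0) (an : hn = fn ;; gn)
    (e0 : l0 = h0 ;; k0) (en : ln = hn ;; kn)
    (d0 : gk0 = g0 ;; k0) (dn : gkn = gn ;; kn) c0 cn :
  paste (cells1 (paste Phi psi a0 an)) chi e0 en =
  paste Phi (paste (cells1 psi) chi d0 dn) c0 cn.
Proof.
pose (Th := cells2_cons (capp_nil ps) (capp_nil qs) a0 an Phi psi (cells2_nil fn gn hn an)).
etransitivity; [exact (paste_assoc Th chi e0 en d0 dn c0 cn)|].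
f_equal; unfold Th; simpl.
change (cells_cast (eq_sym (capp_nil ps)) (eq_sym (capp_nil qs))
  (cells_app Phi (cells_nil fn)) = Phi).
apply cells_app_nil.
Qed.

Lemma paste_paste2 A0 A1 A2 B0 B1 B2 C0 C1 C2 D0 Dn
    (ps : chain (@loose V) A0 A1) (ps' : chain (@loose V) A1 A2)
    (qs : chain (@loose V) B0 B1) (qs' : chain (@loose V) B1 B2)
    (r : loose C1 C0) (r' : loose C2 C1) (s : loose Dn D0)
    (f0 : tight A0 B0) (f1 : tight A1 B1) (f2 : tight A2 B2)
    (g0 : tight B0 C0) (g1 : tight B1 C1) (g2 : tight B2 C2)
    (h0 : tight A0 C0) (h1 : tight A1 C1) (h2 : tight A2 C2)
    (k0 : tight C0 D0) (kn : tight C2 Dn)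
    (gk0 : tight B0 D0) (gkn : tight B2 Dn) (l0 : tight A0 D0) (ln : tight A2 Dn)
    (Phi : cells ps qs f0 f1) (psi : cell qs r g0 g1)
    (Phi' : cells ps' qs' f1 f2) (psi' : cell qs' r' g1 g2) (chi : cell [: r; r'] s k0 kn)
    (a0 : h0 = f0 ;; g0) (a1 a1' : h1 = f1 ;; g1) (a2 : h2 = f2 ;; g2)
    (e0 : l0 = h0 ;; k0) (en : ln = h2 ;; kn)
    (d0 : gk0 = g0 ;; k0) (dn : gkn = g2 ;; kn) c0 cn :
  paste (cells_pair (paste Phi psi a0 a1) (paste Phi' psi' a1' a2)) chi e0 en =
  paste (cells_app Phi Phi') (paste (cells_pair psi psi') chi d0 dn) c0 cn.
Proof.
pose (Th := cells2_cons eq_refl eq_refl a0 a1 Phi psi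
  (cells2_cons (capp_nil ps') (capp_nil qs') a1' a2 Phi' psi' (cells2_nil f2 g2 h2 a2))).
etransitivity; [exact (paste_assoc Th chi e0 en d0 dn c0 cn)|].
f_equal; unfold Th; simpl; f_equal.
change (cells_cast (eq_sym (capp_nil ps')) (eq_sym (capp_nil qs'))
  (cells_app Phi' (cells_nil f2)) = Phi').
apply cells_app_nil.
Qed.

End Pasting.

Ltac bd := repeat rewrite ?tcomp1f, ?tcompf1; solve [reflexivity | assumption | congruence].

Section Equipment.

Variable V : equipment.
Implicit Types A B C D E W Y Z : ob V.

Local Notation chain := (chain (@loose V)).
Local Notation "1" := (tid _) : vdc_scope.

(* [hom f g] is B(f,g). *)
Definition hom B Z W (f : tight Z B) (g : tight W B) : loose W Z := restr (lid B) f g.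

Definition hom_cart B Z W (f : tight Z B) (g : tight W B) : cell [: hom f g] (lid B) f g :=
  cart (lid B) f g.

Definition lmult B : cell [: lid B; lid B] (lid B) 1 1 :=
  lfact cnil [: lid B] (cid (lid B)).

Definition lid_map A B (k : tight A B) : cell [: lid A] (lid B) k k :=
  lfact cnil cnil (paste (cells_nil k) (lunit B) (tf1 k) (tf1 k)).

Definition hom_id A B (f : tight A B) : cell cnil (hom f f) 1 1 :=
  rfact (paste (cells_nil f) (lunit B) (tf1 f) (tf1 f)) (t1f f) (t1f f).

Definition hom_comp B Z W Y (f : tight Z B) (g : tight W B) (h : tight Y B) :
    cell [: hom f g; hom g h] (hom f h) 1 1 :=
  rfact (paste (cells_pair (hom_cart f g) (hom_cart g h)) (lmult B) (tf1 f) (tf1 h))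
    (t1f f) (t1f h).

Definition hcomp B Z W Y (f : tight Z B) (g : tight W B) (h : tight Y B)
    (ps : chain Z W) (qs : chain W Y)
    (phi : cell ps (hom f g) 1 1) (psi : cell qs (hom g h) 1 1) :
    cell (ps +++ qs) (hom f h) 1 1 :=
  paste (cells_pair phi psi) (hom_comp f g h) (t1f _) (t1f _).

(* The cell B(f,g) => C(kf,kg) induced by k : B -> C. *)
Definition hom_map B C Z W (k : tight B C) (f : tight Z B) (g : tight W B)
    (fk : tight Z C) (gk : tight W C) (e : fk = f ;; k) (e' : gk = g ;; k) :
    cell [: hom f g] (hom fk gk) 1 1 :=
  rfact (paste (cells1 (hom_cart f g)) (lid_map k) e e') (t1f fk) (t1f gk).

(* (phi ; k) *)
Definition hom_post B C Z W (k : tight B C) (ps : chain Z W) (f : tight Z B) (g : tight W B)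
    (phi : cell ps (hom f g) 1 1) (fk : tight Z C) (gk : tight W C)
    (e : fk = f ;; k) (e' : gk = g ;; k) : cell ps (hom fk gk) 1 1 :=
  vcomp phi (hom_map e e').

Definition hom_along B Z W Y (f : tight Z B) (g : tight W B) (x : tight Y W)
    (xg : tight Y B) (e : xg = x ;; g) : cell [: hom f xg] (hom f g) 1 x :=
  rfact (hom_cart f xg) (t1f f) e.

(* phi(1,x), for phi : B(f,g) => B'(f',g'); the domain of the result is B(f,xg) itself rather
   than the isomorphic restriction of B(f,g) along x. *)
Definition hom_restr B B' Z W Y (f : tight Z B) (g : tight W B) (f' : tight Z B')
    (g' : tight W B') (phi : cell [: hom f g] (hom f' g') 1 1) (x : tight Y W)
    (xg : tight Y B) (xg' : tight Y B') (e : xg = x ;; g) (e' : xg' = x ;; g') :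
    cell [: hom f xg] (hom f' xg') 1 1 :=
  rfact
    (paste (cells1 (paste (cells1 (hom_along f e)) phi (t1f 1) (tf1 x))) (hom_cart f' g')
       (t1f f') e')
    (t1f f') (t1f xg').

Lemma rfact_ext A0 An X Y Z W (p : loose X Y) (f : tight Z Y) (g : tight W X)
    (ps : chain A0 An) (h0 : tight A0 Z) (hn : tight An W) k0 kn
    (phi psi : cell ps (restr p f g) h0 hn) (e0 : k0 = h0 ;; f) (en : kn = hn ;; g) :
  paste (cells1 phi) (cart p f g) e0 en = paste (cells1 psi) (cart p f g) e0 en -> phi = psi.
Proof. intros H; rewrite <- (pasteK phi e0 en), H; apply pasteK. Qed.

Lemma lid_ext A0 A An C0 Cn (ps : chain A0 A) (qs : chain A An) (r : loose Cn C0) f g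
    (phi psi : cell (ps +++ lid A ::: qs) r f g) :
  graft ps (lunit A) qs phi = graft ps (lunit A) qs psi -> phi = psi.
Proof. intros H; rewrite <- (graftK phi), H; apply graftK. Qed.

Lemma paste_irr A0 An B0 Bn C0 Cn (ps : chain A0 An) (qs : chain B0 Bn)
    (r : loose Cn C0) (f0 : tight A0 B0) (fn : tight An Bn)
    (g0 : tight B0 C0) (gn : tight Bn Cn) (h0 : tight A0 C0) (hn : tight An Cn)
    (Phi : cells ps qs f0 fn) (psi : cell qs r g0 gn) (e0 d0 : h0 = f0 ;; g0) en dn :
  paste Phi psi e0 en = paste (hn:=hn) Phi psi d0 dn.
Proof. f_equal; apply proof_irrelevance. Qed.

Lemma op_vcomp A0 An X Y Z W (p : loose X Y) (f : tight Z Y) (g : tight W X)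
    (ps : chain A0 An) (B0 Bn : ob V) (qs : chain B0 Bn) (a0 : tight A0 B0) (an : tight An Bn)
    (h0 : tight B0 Z) (hn : tight Bn W) (l0 : tight A0 Z) (ln : tight An W)
    k0 kn m0 mn (Phi : cells ps qs a0 an) (psi : cell qs p k0 kn) (e0 : k0 = h0 ;; f)
    (en : kn = hn ;; g) d0 dn (c0 : m0 = l0 ;; f) (cn : mn = ln ;; g) b0 bn :
  paste (cells1 (paste Phi (rfact psi e0 en) d0 dn)) (cart p f g) c0 cn =
  paste Phi psi b0 bn.
Proof.
rewrite (paste_paste1 Phi _ (cart p f g) d0 dn c0 cn e0 en b0 bn), rfactK; reflexivity.
Qed.

Lemma op_hcomp B Z W Y (f : tight Z B) (g : tight W B) (h : tight Y B)
    A0 A1 An (ps : chain A0 A1) (qs : chain A1 An) (a0 : tight A0 Z) (a1 : tight A1 W)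
    (an : tight An Y)
    (phi : cell ps (hom f g) a0 a1) (psi : cell qs (hom g h) a1 an) m0 mn
    d0 dn (c0 : m0 = a0 ;; f) (cn : mn = an ;; h) m1 (e1 : m1 = a1 ;; g) b0 bn :
  paste (cells1 (paste (h0 := a0) (hn := an) (cells_pair phi psi) (hom_comp f g h) d0 dn))
    (hom_cart f h) c0 cn =
  paste (cells_pair (paste (cells1 phi) (hom_cart f g) c0 e1)
                    (paste (cells1 psi) (hom_cart g h) e1 cn)) (lmult B) b0 bn.
Proof.
etransitivity; [exact (op_vcomp _ _ _ _ _ _ c0 cn c0 cn)|].
symmetry; etransitivity; [|reflexivity].
etransitivity; [refine (paste_paste2 (cells1 phi) (cart (lid B) f g) (cells1 psi) (cart (lid B) g h)
  (lmult B) c0 e1 e1 cn b0 bn (tf1 f) (tf1 h) c0 cn)|].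
rewrite cells_app_single; reflexivity.
Qed.

Lemma op_hom_map B C Z W (k : tight B C) (f : tight Z B) (g : tight W B)
    (fk : tight Z C) (gk : tight W C) (e : fk = f ;; k) (e' : gk = g ;; k)
    A0 An (ps : chain A0 An) (a0 : tight A0 Z) (an : tight An W) 
    (phi : cell ps (hom f g) a0 an)
    m0 mn d0 dn (c0 : m0 = a0 ;; fk) (cn : mn = an ;; gk) l0 ln 
    (e0 : l0 = a0 ;; f) (en : ln = an ;; g) b0 bn :
  paste (cells1 (paste (h0 := a0) (hn := an) (cells1 phi) (hom_map e e') d0 dn))
    (hom_cart fk gk) c0 cn =
  paste (cells1 (paste (cells1 phi) (hom_cart f g) e0 en)) (lid_map k) b0 bn.
Proof.
etransitivity; [exact (op_vcomp _ _ _ _ _ _ c0 cn c0 cn)|].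
symmetry; exact (paste_paste1 _ _ (lid_map k) _ _ b0 bn e e' c0 cn).
Qed.

Lemma op_along B Z W Y (f : tight Z B) (g : tight W B) (x : tight Y W)
    (xg : tight Y B) (e : xg = x ;; g) e0 en :
  paste (h0 := f) (hn := xg) (cells1 (hom_along f e)) (hom_cart f g) e0 en = hom_cart f xg.
Proof.
rewrite (paste_irr _ _ e0 (t1f f) en e); apply rfactK.
Qed.

Lemma op_restr B B' Z W Y (f : tight Z B) (g : tight W B) (f' : tight Z B')
    (g' : tight W B') (phi : cell [: hom f g] (hom f' g') 1 1) (x : tight Y W)
    (xg : tight Y B) (xg' : tight Y B') (e : xg = x ;; g) (e' : xg' = x ;; g') c0 cn
    d0 dn b0 bn :
  paste (h0 := f') (hn := xg') (cells1 (hom_restr phi e e')) (hom_cart f' xg') c0 cn =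
  paste (cells1 (hom_along f e)) (paste (h0 := f') (hn := g') (cells1 phi) (hom_cart f' g') d0 dn)
    b0 bn.
Proof.
rewrite (paste_irr _ _ c0 (t1f f') cn (t1f xg')).
etransitivity; [apply rfactK|apply paste_paste1].
Qed.

Lemma lid_map_unit A B (k : tight A B) A0 (a : tight A0 A) (ak : tight A0 B)
    (e e' d d' : ak = a ;; k) c c' b b' :
  paste (cells1 (paste (h0 := a) (hn := a) (cells_nil a) (lunit A) c c')) (lid_map k) e e' =
  paste (cells_nil ak) (lunit B) b b'.
Proof.
unfold lid_map.
rewrite (paste_paste1 (cells_nil a) (lunit A) _ _ _ e e' (t1f k) (t1f k) d d').
assert (H := lfactK cnil cnil (paste (cells_nil k) (lunit B) (tf1 k) (tf1 k))).
unfold graft in H; simpl in H.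
replace (cells1 (lunit A)) with (cells_cons (V := V) (top := cnil) (ps := cnil) (ps' := cnil)
   eq_refl (lunit A) (cells_nil 1)) by (unfold cells1; f_equal; apply proof_irrelevance).
rewrite (paste_irr _ _ _ (eq_sym (tcomp1f k)) _ (eq_sym (tcomp1f k))), H.
pose (Th := @cells2_nil V _ _ _ a k ak d).
etransitivity; [symmetry; exact (paste_assoc Th (lunit B) b b' _ _ _ _)|].
reflexivity.
Qed.

Lemma lmultl A0 An B (ps : chain A0 An) (f0 : tight A0 B) (fn : tight An B)
    (phi : cell ps (lid B) f0 fn) e0 en d0 dn:
  paste (h0 := f0) (hn := fn)
    (cells_pair (paste (h0 := f0) (hn := f0) (cells_nil f0) (lunit B) e0 en) phi)
    (lmult B) d0 dn = phi.
Proof.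
rewrite <- (paste_cid phi (tf1 _) (tf1 _)) at 1.
rewrite (paste_paste2 (cells_nil f0) (lunit B) (cells1 phi) (cid (lid B)) _ e0 en _ _ d0 dn
  (t1f 1) (t1f 1) d0 dn).
assert (H := lfactK cnil [: lid B] (cid (lid B))).
unfold graft in H; simpl in H.
match goal with |- paste _ ?x _ _ = _ => replace x with (cid (lid B)) end.
- apply paste_cid.
- rewrite <- H at 1; unfold lmult, cells_pair.
  transitivity (paste (h0 := 1) (hn := 1) (cells_cons (V := V) eq_refl (lunit B) (cells_cons (V := V) eq_refl
    (cid (lid B)) (cells_nil 1))) (lfact cnil [: lid B] (cid (lid B))) (t1f 1) (t1f 1)).
  + apply paste_irr.
  + f_equal; unfold cells1; f_equal; f_equal; apply proof_irrelevance.
Qed.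
Lemma lmultr_lid B :
  paste (h0 := 1) (hn := 1) (cells_pair (cid (lid B)) (lunit B)) (lmult B) (t1f 1) (t1f 1) =
  cid (lid B).
Proof.
apply (lid_ext (ps := cnil) (qs := cnil)).
assert (H : paste (cells_nil 1) (lunit B) (tf1 1) (tf1 1) = lunit B)
  by exact (paste_cids (lunit B) _ _).
assert (G := paste_paste2 (cells1 (lunit B)) (cid (lid B)) (cells_nil 1) (lunit B) (lmult B)
  (t1f 1) (t1f 1) (tf1 1) (tf1 1) (t1f 1) (t1f 1) (t1f 1) (t1f 1) (t1f 1) (t1f 1)).
rewrite cells_app_single in G.
etransitivity; [exact (eq_sym (eq_trans G (paste_irr _ _ _ _ _ _)))|].
rewrite paste_cid, H.
etransitivity.
- transitivity (paste (h0 := 1) (hn := 1)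
    (cells_pair (paste (cells_nil 1) (lunit B) (tf1 1) (tf1 1)) (lunit B)) (lmult B)
    (t1f 1) (t1f 1)); [rewrite H; reflexivity|apply lmultl].
- symmetry; unfold graft; simpl.
  rewrite <- (paste_cid (lunit B) (t1f 1) (t1f 1)) at 2.
  transitivity (paste (cells1 (lunit B)) (cid (lid B)) (eq_sym (tcomp1f 1)) (eq_sym (tcomp1f 1))).
  + f_equal; unfold cells1; f_equal; apply proof_irrelevance.
  + apply paste_irr.
Qed.

Lemma lmultr A0 An B (p : loose An A0) (f0 : tight A0 B) (fn : tight An B)
    (phi : cell [: p] (lid B) f0 fn) e0 en d0 dn:
  paste (h0 := f0) (hn := fn)
    (cells_pair phi (paste (h0 := fn) (hn := fn) (cells_nil fn) (lunit B) e0 en))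
    (lmult B) d0 dn = phi.
Proof.
rewrite <- (paste_cid phi d0 e0) at 1.
etransitivity; [refine (paste_paste2 (cells1 phi) (cid (lid B)) (cells_nil fn) (lunit B) _ d0 e0
  e0 en d0 dn (t1f 1) (t1f 1) d0 dn)|].
rewrite lmultr_lid, cells_app_single.
etransitivity; [|exact (paste_cid phi d0 dn)].
f_equal; unfold cells1; f_equal; apply proof_irrelevance.
Qed.

Lemma graft_lmult B :
  paste (h0 := 1) (hn := 1) (cells_pair (lunit B) (cid (lid B))) (lmult B) (t1f 1) (t1f 1) =
  cid (lid B).
Proof.
rewrite <- (lmultl (cid (lid B)) (t1f 1) (t1f 1) (t1f 1) (t1f 1)) at 2.
do 2 f_equal.
symmetry; exact (paste_cids (lunit B) _ _).
Qed.

Lemma lmult_map B C (k : tight B C) e0 en d0 dn :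
  paste (h0 := k) (hn := k) (cells1 (lmult B)) (lid_map k) e0 en =
  paste (cells_pair (lid_map k) (lid_map k)) (lmult C) d0 dn.
Proof.
apply (lid_ext (ps := cnil) (qs := [: lid B])).
transitivity (lid_map k).
- unfold graft.
  etransitivity; [symmetry; refine (paste_paste1 _ (lmult B) (lid_map k) (t1f 1) (t1f 1) (t1f k) (t1f k)
    e0 en _ _)|].
  etransitivity; [|exact (paste_cids (lid_map k) (t1f k) (t1f k))].
  f_equal.
  transitivity (cells1 (cid (lid B))).
  + f_equal. rewrite <- graft_lmult. f_equal. unfold cells_pair, cells1. simpl.
    f_equal; f_equal; apply proof_irrelevance.
  + unfold cells1; simpl; f_equal; apply proof_irrelevance.
- assert (G := paste_paste2 (cells1 (lunit B)) (lid_map k) (cells1 (cid (lid B))) (lid_map k)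
    (lmult C) (t1f k) (t1f k) (t1f k) (t1f k) d0 dn d0 dn (t1f k) (t1f k)).
  rewrite cells_app_single in G.
  transitivity (paste (h0 := k) (hn := k) (cells_pair
    (paste (h0 := k) (hn := k) (cells1 (lunit B)) (lid_map k) (t1f k) (t1f k))
    (paste (cells1 (cid (lid B))) (lid_map k) (t1f k) (t1f k))) (lmult C) d0 dn).
  + replace (paste (cells1 (cid (lid B))) (lid_map k) (t1f k) (t1f k)) with (lid_map k).
    * assert (K := lid_map_unit (a := 1) (t1f k) (t1f k) (t1f k) (t1f k) (t1f 1) (t1f 1) (tf1 k) (tf1 k)).
      rewrite <- (lmultl (lid_map k) (tf1 k) (tf1 k) d0 dn) at 1.
      do 2 f_equal. rewrite <- K. do 2 f_equal. exact (paste_cids (lunit B) _ _).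
    * rewrite <- (paste_cids (lid_map k) (t1f k) (t1f k)) at 1.
      f_equal. unfold cells1; simpl; f_equal; apply proof_irrelevance.
  + etransitivity; [exact G|].
    unfold graft; simpl. etransitivity; [apply paste_irr|]. f_equal. unfold cells1; f_equal; f_equal; apply proof_irrelevance.
Qed.
Lemma vcompA A An (ps : chain A An) (q r s : loose An A)
    (phi : cell ps q 1 1) (psi : cell [: q] r 1 1) (chi : cell [: r] s 1 1) :
  vcomp (vcomp phi psi) chi = vcomp phi (vcomp psi chi).
Proof. apply paste_paste1. Qed.

Lemma vcomp_cid A An (ps : chain A An) (q : loose An A) (phi : cell ps q 1 1) :
  vcomp phi (cid q) = phi.
Proof. apply paste_cid. Qed.

Lemma paste_cid1 A0 An B0 Bn (p : loose An A0) (q : loose Bn B0) (f0 : tight A0 B0)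
    (fn : tight An Bn) (phi : cell [: p] q f0 fn) e0 en :
  paste (cells1 (cid p)) phi e0 en = phi.
Proof.
etransitivity; [|exact (paste_cids phi e0 en)].
f_equal; unfold cells1; simpl; f_equal; apply proof_irrelevance.
Qed.

Lemma cid_vcomp A An (q r : loose An A) (phi : cell [: q] r 1 1) :
  vcomp (cid q) phi = phi.
Proof. apply paste_cid1. Qed.

Lemma hom_map_id B Z W (f : tight Z B) (g : tight W B) (fk : tight Z B) (gk : tight W B)
    (e : fk = f ;; 1) (e' : gk = g ;; 1) (ef : f = fk) (eg : g = gk) :
  hom_map e e' = match ef, eg with eq_refl, eq_refl => cid (hom f g) end.
Proof.
destruct ef, eg.
assert (L : lid_map (tid B) = cid (lid B)).
{ apply (lid_ext (ps := cnil) (qs := cnil)).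
  unfold lid_map; rewrite lfactK.
  etransitivity; [exact (paste_cids (lunit B) _ _)|].
  symmetry; unfold graft; simpl.
  etransitivity; [|exact (paste_cid (lunit B) (t1f 1) (t1f 1))].
  etransitivity; [apply paste_irr|].
  f_equal; unfold cells1; f_equal; apply proof_irrelevance. }
apply (rfact_ext (e0 := t1f f) (en := t1f g)).
unfold hom_map; rewrite rfactK, L, paste_cid.
symmetry; apply paste_cid1.
Qed.

Lemma hom_post1 B Z W (ps : chain Z W) (f : tight Z B) (g : tight W B)
    (phi : cell ps (hom f g) 1 1) (e : f = f ;; 1) (e' : g = g ;; 1) :
  hom_post phi e e' = phi.
Proof.
unfold hom_post; rewrite (hom_map_id e e' eq_refl eq_refl); apply vcomp_cid.
Qed.

Lemma hom_post_id A B C (f : tight A B) (k : tight B C) (fk : tight A C) (e e' : fk = f ;; k) :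
  hom_post (hom_id f) e e' = hom_id fk.
Proof.
apply (rfact_ext (e0 := t1f fk) (en := t1f fk)).
etransitivity; [exact (op_hom_map e e' (hom_id f) _ _ (t1f fk) (t1f fk) (t1f f) (t1f f) e e')|].
etransitivity; [|symmetry; apply rfactK].
etransitivity; [|apply (lid_map_unit e e' e e' (tf1 f) (tf1 f))].
do 2 f_equal; apply rfactK.
Qed.

Lemma hcomp_vcomp B Z W Y (f : tight Z B) (g : tight W B) (h : tight Y B)
    (ps : chain Z W) (qs : chain W Y) (p : loose W Z) (q : loose Y W)
    (phi : cell ps p 1 1) (alpha : cell [: p] (hom f g) 1 1)
    (psi : cell qs q 1 1) (beta : cell [: q] (hom g h) 1 1) :
  hcomp (vcomp phi alpha) (vcomp psi beta) =
  paste (cells_pair phi psi) (hcomp alpha beta) (t1f 1) (t1f 1).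
Proof.
etransitivity; [apply (paste_paste2 (cells1 phi) alpha (cells1 psi) beta (hom_comp f g h)
  (t1f 1) (t1f 1) (t1f 1) (t1f 1) (t1f 1) (t1f 1) (t1f 1) (t1f 1) (t1f 1) (t1f 1))|].
rewrite cells_app_single; reflexivity.
Qed.

Lemma vcomp_hcomp B Z Y (f f' : tight Z B) (h : tight Y B) (ps : chain Z Y)
    (alpha : cell cnil (hom f f') 1 1) (phi : cell ps (hom f' h) 1 1) :
  vcomp phi (hcomp alpha (cid (hom f' h))) = hcomp alpha phi.
Proof.
assert (H : hcomp (paste (cells_nil 1) alpha (t1f 1) (t1f 1)) (vcomp phi (cid _)) =
            hcomp alpha phi).
{ rewrite vcomp_cid; f_equal; exact (paste_cids alpha _ _). }
rewrite <- H; symmetry.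
apply (paste_paste2 (cells_nil 1) alpha (cells1 phi) (cid (hom f' h)) (hom_comp f f' h)
  (t1f 1) (t1f 1) (t1f 1) (t1f 1) (t1f 1) (t1f 1) (t1f 1) (t1f 1) (t1f 1) (t1f 1)).
Qed.

Lemma hcomp_idl B Z W (f : tight Z B) (g : tight W B) (ps : chain Z W)
    (phi : cell ps (hom f g) 1 1) :
  hcomp (hom_id f) phi = phi.
Proof.
apply (rfact_ext (e0 := t1f f) (en := t1f g)).
etransitivity; [exact (op_hcomp (hom_id f) phi _ _ (t1f f) (t1f g) (t1f f) (tf1 f) (tf1 g))|].
etransitivity; [|apply (lmultl _ (tf1 f) (tf1 f) (tf1 f) (tf1 g))].
do 2 f_equal; apply rfactK.
Qed.

Lemma hom_post_comp B C Z W Y (k : tight B C) (f : tight Z B) (g : tight W B) (h : tight Y B)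
    (fk : tight Z C) (gk : tight W C) (hk : tight Y C)
    (ps : chain Z W) (qs : chain W Y)
    (phi : cell ps (hom f g) 1 1) (psi : cell qs (hom g h) 1 1)
    (ef : fk = f ;; k) (eg : gk = g ;; k) (eh : hk = h ;; k) :
  hom_post (hcomp phi psi) ef eh = hcomp (hom_post phi ef eg) (hom_post psi eg eh).
Proof.
apply (rfact_ext (e0 := t1f fk) (en := t1f hk)).
etransitivity; [exact (op_hom_map ef eh (hcomp phi psi) _ _ (t1f fk) (t1f hk)
  (t1f f) (t1f h) ef eh)|].
symmetry.
etransitivity; [exact (op_hcomp (hom_post phi ef eg) (hom_post psi eg eh) _ _
  (t1f fk) (t1f hk) (t1f gk) (tf1 fk) (tf1 hk))|].
etransitivity; [refine (f_equal2 (fun a b => paste (cells_pair a b) (lmult C) (tf1 fk) (tf1 hk))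
  (op_hom_map ef eg phi _ _ (t1f fk) (t1f gk) (t1f f) (t1f g) ef eg)
  (op_hom_map eg eh psi _ _ (t1f gk) (t1f hk) (t1f g) (t1f h) eg eh))|].
etransitivity; [refine (paste_paste2 _ (lid_map k) _ (lid_map k) _ ef eg eg eh _ _
  (tf1 k) (tf1 k) ef eh)|].
rewrite cells_app_single, <- (lmult_map (k := k) (t1f k) (t1f k)).
symmetry; etransitivity; [refine (f_equal (fun a => paste (cells1 a) (lid_map k) ef eh)
  (op_hcomp phi psi _ _ (t1f f) (t1f h) (t1f g) (tf1 f) (tf1 h)))|].
apply paste_paste1.
Qed.

Lemma op_right B B' Z D (f : tight Z B) (g : tight D B) (f' : tight Z B') (g' : tight D B')
    (phi : cell [: hom f g] (lid B') f' g') e0 en d0 dn c0 cn :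
  paste (h0 := f') (hn := g') (cells_pair phi (lid_map g')) (lmult B') e0 en =
  paste (cells1 (rfact (X:=B) (p:=lid B) (f:=f) (g:=g) (h0 := tid Z) (hn := tid D)
      (paste (h0 := f) (hn := g) (cells_pair (hom_cart f g) (lid_map g)) (lmult B) d0 dn)
      (t1f f) (t1f g))) phi c0 cn.
Proof.
assert (R : forall B' (f' : tight Z B') (g' : tight D B') (phi : cell [: hom f g] (lid B') f' g')
   e0 en, graft [: hom f g] (lunit D) cnil 
     (paste (h0 := f') (hn := g') (cells_pair phi (lid_map g')) (lmult B') e0 en) = phi).
{ clear; intros B' f' g' phi e0 en.
  etransitivity; [|apply (lmultr phi (tf1 g') (tf1 g') (tf1 f') (tf1 g'))].
  symmetry.
  etransitivity; [refine (f_equal2 (fun a b => paste (h0 := f') (hn := g') (cells_pair a b) (lmult B') _ _)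
    (eq_sym (paste_cid1 phi (t1f _) (t1f _))) (eq_sym (lid_map_unit (a := 1) (t1f _) (t1f _) (t1f _) (t1f _)
      (t1f 1) (t1f 1) _ _)))|].
  etransitivity; [refine (paste_paste2 (cells1 (cid _)) phi (cells1 _) (lid_map g') (lmult B')
    (t1f f') (t1f g') (t1f g') (t1f g') _ _ e0 en (t1f f') (t1f g'))|].
  rewrite cells_app_single. unfold graft. etransitivity; [apply paste_irr|].
  f_equal. simpl. f_equal. apply proof_irrelevance.
  replace (paste (cells_nil 1) (lunit D) (t1f 1) (t1f 1)) with (lunit D)
    by (symmetry; exact (paste_cids (lunit D) _ _)).
  unfold cells1; f_equal; apply proof_irrelevance. }
apply (lid_ext (ps := [: hom f g]) (qs := cnil)).
etransitivity; [apply R|].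
symmetry; unfold graft.
etransitivity; [symmetry; refine (paste_paste1 _ _ phi (t1f 1) (t1f 1) (t1f f') (t1f g') c0 cn _ _)|].
etransitivity; [|exact (paste_cid1 phi (t1f f') (t1f g'))].
do 2 f_equal.
apply (rfact_ext (e0 := t1f f) (en := t1f g)).
etransitivity; [refine (op_vcomp _ _ _ _ _ _ (t1f f) (t1f g) (t1f f) (t1f g))|].
etransitivity; [|symmetry; apply paste_cid1].
etransitivity; [|apply (R _ f g (hom_cart f g) d0 dn)].
apply paste_irr.
Qed.

Lemma hom_restr_nat B B' Z D Y Y' (f : tight Z B) (g : tight D B) (f' : tight Z B')
    (g' : tight D B') (phi : cell [: hom f g] (hom f' g') 1 1)
    (x : tight Y D) (y : tight Y' D) (xg : tight Y B) (yg : tight Y' B)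
    (xg' : tight Y B') (yg' : tight Y' B')
    (ex : xg = x ;; g) (ey : yg = y ;; g) (ex' : xg' = x ;; g') (ey' : yg' = y ;; g') :
  hcomp (hom_restr phi ex ex') (hom_map (k := g') ex' ey') =
  vcomp (hcomp (cid (hom f xg)) (hom_map (k := g) ex ey)) (hom_restr phi ey ey').
Proof.
pose (phi' := paste (cells1 phi) (hom_cart f' g') (t1f f') (t1f g')).
pose (rho := rfact (X:=B) (p:=lid B) (f:=f) (g:=g) (h0 := tid Z) (hn := tid D)
      (paste (h0 := f) (hn := g) (cells_pair (hom_cart f g) (lid_map g)) (lmult B) (tf1 f) (tf1 g))
      (t1f f) (t1f g)).
apply (rfact_ext (e0 := t1f f') (en := t1f yg')).
etransitivity; [exact (op_hcomp (hom_restr phi ex ex') (hom_map ex' ey') _ _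
  (t1f f') (t1f yg') (t1f xg') (tf1 f') (tf1 yg'))|].
etransitivity; [refine (f_equal2 (fun a b => paste (cells_pair a b) (lmult B') (tf1 f') (tf1 yg'))
  (op_restr phi ex ex' (t1f f') (t1f xg') (t1f f') (t1f g') (t1f f') ex')
  (rfactK _ _ _))|].
etransitivity; [refine (paste_paste2 (cells1 (hom_along f ex)) phi' (cells1 (hom_cart x y)) (lid_map g')
  (lmult B') (t1f f') ex' ex' ey' _ _ (tf1 f') (tf1 g') (t1f f') ey')|].
rewrite cells_app_single.
rewrite (op_right phi' _ _ (tf1 f) (tf1 g) (t1f f') (t1f g')).
fold rho.
symmetry.
etransitivity; [refine (paste_paste1 (cells1 (hcomp (cid (hom f xg)) (hom_map ex ey))) (hom_restr phi ey ey')
   (hom_cart f' yg') _ _ _ _ (t1f f') (t1f yg') (t1f f') (t1f yg'))|].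
rewrite (op_restr phi ey ey' (t1f f') (t1f yg') (t1f f') (t1f g') (t1f f') ey').
fold phi'.
etransitivity; [symmetry; refine (paste_paste1 (cells1 (hcomp (cid (hom f xg)) (hom_map ex ey)))
  (hom_along f ey) phi' (t1f 1) (t1f y) (t1f f') ey' _ _ _ _)|].
etransitivity; [|refine (paste_paste1 (cells_cons eq_refl (hom_along f ex) (cells1 (hom_cart x y)))
  rho phi' (t1f 1) (tf1 y) (t1f f') ey' _ _ _ _)].
do 2 f_equal.
apply (rfact_ext (e0 := t1f f) (en := ey)).
symmetry.
etransitivity; [refine (op_vcomp _ _ _ _ _ _ _ _ (t1f f) ey)|].
symmetry.
etransitivity; [refine (paste_paste1 _ (hom_along f ey) (hom_cart f g) _ _ _ _ (t1f f) ey (t1f f) (t1f yg))|].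
rewrite op_along.
etransitivity; [exact (op_hcomp (cid _) (hom_map ex ey) _ _ (t1f f) (t1f yg) (t1f xg) (tf1 f) (tf1 yg))|].
etransitivity; [refine (f_equal2 (fun a b => paste (cells_pair a b) (lmult B) (tf1 f) (tf1 yg))
  (paste_cid1 _ _ _) (rfactK _ _ _))|].
rewrite <- (op_along ex (t1f f) ex).
etransitivity; [refine (paste_paste2 _ (hom_cart f g) (cells1 (hom_cart x y)) (lid_map g)
  (lmult B) (t1f f) ex ex ey _ _ (tf1 f) (tf1 g) (t1f f) ey)|].
rewrite cells_app_single; reflexivity.
Qed.
Lemma hom_restr_vcomp B B' B'' Z D Y (f : tight Z B) (g : tight D B) (f' : tight Z B')
    (g' : tight D B') (f'' : tight Z B'') (g'' : tight D B'')
    (phi : cell [: hom f g] (hom f' g') 1 1) (psi : cell [: hom f' g'] (hom f'' g'') 1 1)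
    (x : tight Y D) (xg : tight Y B) (xg' : tight Y B') (xg'' : tight Y B'')
    (e : xg = x ;; g) (e' : xg' = x ;; g') (e'' : xg'' = x ;; g'') :
  vcomp (hom_restr phi e e') (hom_restr psi e' e'') = hom_restr (vcomp phi psi) e e''.
Proof.
assert (K : paste (cells1 (hom_restr phi e e')) (hom_along f' e') (t1f 1) (t1f x) =
            paste (cells1 (hom_along f e)) phi (t1f 1) (tf1 x)).
{ apply (rfact_ext (e0 := t1f f') (en := e')).
  etransitivity; [refine (paste_paste1 _ (hom_along f' e') (hom_cart f' g') _ _ _ _
    (t1f f') e' (t1f f') (t1f xg'))|].
  rewrite op_along; apply rfactK. }
apply (rfact_ext (e0 := t1f f'') (en := t1f xg'')).
etransitivity; [refine (paste_paste1 _ (hom_restr psi e' e'') (hom_cart f'' xg'') _ _ _ _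
  (t1f f'') (t1f xg'') (t1f f'') (t1f xg''))|].
rewrite (op_restr psi e' e'' (t1f f'') (t1f xg'') (t1f f'') (t1f g'') (t1f f'') e'').
etransitivity; [symmetry; refine (paste_paste1 _ (hom_along f' e')
  (paste (cells1 psi) (hom_cart f'' g'') (t1f f'') (t1f g'')) (t1f 1) (t1f x) (t1f f'') e''
  _ _ _ _)|].
rewrite K.
etransitivity; [refine (paste_paste1 _ phi
  (paste (cells1 psi) (hom_cart f'' g'') (t1f f'') (t1f g'')) _ _ _ _
    (t1f f'') (t1f g'') (t1f f'') e'')|].
symmetry.
etransitivity; [exact (op_restr (vcomp phi psi) e e'' (t1f f'') (t1f xg'') (t1f f'') (t1f g'') (t1f f'') e'')|].
f_equal; apply paste_paste1.
Qed.

Lemma hom_restr_cid B Z D Y (f : tight Z B) (g : tight D B) (x : tight Y D) (xg : tight Y B)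
    (e : xg = x ;; g) :
  hom_restr (cid (hom f g)) e e = cid (hom f xg).
Proof.
apply (rfact_ext (e0 := t1f f) (en := t1f xg)).
etransitivity;
  [exact (op_restr (cid (hom f g)) e e (t1f f) (t1f xg) (t1f f) (t1f g) (t1f f) e)|].
rewrite paste_cid1, op_along; symmetry; apply paste_cid1.
Qed.

(** * Relative monads, algebras and adjunctions *)

Record rel_monad A E (j : tight A E) := RelMonad {
  mon :> tight A E;
  ext : cell [: hom j mon] (hom mon mon) 1 1;
  eta : cell cnil (hom j mon) 1 1;
  mon_unitl : vcomp ext (hcomp eta (cid (hom mon mon))) = cid (hom j mon);
  mon_unitr : vcomp eta ext = hom_id mon;
  mon_assoc : hcomp ext ext = vcomp (hcomp (cid (hom j mon)) ext) ext
}.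

(* A 2-cell f => g between tight-cells into B is a cell in [cell cnil (hom f g) 1 1], so that
   [hcomp (eta T) (cid (hom T e))] is the cell E(t,e) => E(j,e) induced by the unit. *)
Record algebra A E (j : tight A E) (T : rel_monad j) (D : ob V) := Algebra {
  alg :> tight D E;
  act : cell [: hom j alg] (hom T alg) 1 1;
  alg_unit : vcomp act (hcomp (eta T) (cid (hom T alg))) = cid (hom j alg);
  alg_assoc : hcomp (ext T) act = vcomp (hcomp (cid (hom j T)) act) act
}.

Definition graded_morphism A E (j : tight A E) (T : rel_monad j) D D'
    (a : algebra T D) (a' : algebra T D') (ps : chain D D')
    (eps : cell ps (hom a a') 1 1) : Prop :=
  hcomp (act a) eps = vcomp (hcomp (cid (hom j a)) eps) (act a').

Record algebra_object A E (j : tight A E) (T : rel_monad j) := AlgebraObject {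
  Alg : ob V;
  ualg : algebra T Alg;
  med : forall D, algebra T D -> tight D Alg;
  med_alg : forall D (a : algebra T D), alg a = med a ;; ualg;
  med_act : forall D (a : algebra T D),
    hom_restr (act ualg) (med_alg a) (med_alg a) = act a;
  med_uniq : forall D (a : algebra T D) (x : tight D Alg) (e : alg a = x ;; ualg),
    hom_restr (act ualg) e e = act a -> x = med a;
  med_graded : forall D D' (a : algebra T D) (a' : algebra T D') (ps : chain D D')
    (eps : cell ps (hom a a') 1 1), graded_morphism eps ->
    exists! delta : cell ps (hom (med a) (med a')) 1 1,
      hom_post delta (med_alg a) (med_alg a') = eps
}.

(* sharp : C(l,1) => E(j,r) is an isomorphism with inverse flat. *)
Record left_adjoint A E C (j : tight A E) (r : tight C E) := LeftAdjoint {
  ladj :> tight A C;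
  sharp : cell [: hom ladj 1] (hom j r) 1 1;
  flat : cell [: hom j r] (hom ladj 1) 1 1;
  sharpK : vcomp sharp flat = cid (hom ladj 1);
  flatK : vcomp flat sharp = cid (hom j r)
}.

Section InducedMonad.

Variables (A E C : ob V) (j : tight A E) (r : tight C E) (l : left_adjoint j r).

Definition adj_eta : cell cnil (hom j (l ;; r)) 1 1 :=
  vcomp (hom_id l) (hom_restr (sharp l) (tf1 l) eq_refl).

Definition adj_ext : cell [: hom j (l ;; r)] (hom (l ;; r) (l ;; r)) 1 1 :=
  hom_post (hom_restr (flat l) eq_refl (tf1 l)) eq_refl eq_refl.

Definition adj_act : cell [: hom j r] (hom (l ;; r) r) 1 1 :=
  hom_post (flat l) eq_refl (t1f r).

Lemma sharp_restr_nat Y Y' (x : tight Y C) (y : tight Y' C) (xr : tight Y E) (yr : tight Y' E)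
    (ex : xr = x ;; r) (ey : yr = y ;; r) (ps : chain A Y) (qs : chain Y Y')
    (alpha : cell ps (hom l x) 1 1) (beta : cell qs (hom x y) 1 1) :
  hcomp (vcomp alpha (hom_restr (sharp l) (tf1 x) ex)) (hom_post beta ex ey) =
  vcomp (hcomp alpha beta) (hom_restr (sharp l) (tf1 y) ey).
Proof.
unfold hom_post; rewrite hcomp_vcomp, (hom_restr_nat (sharp l) (tf1 x) (tf1 y) ex ey).
rewrite (hom_map_id (tf1 x) (tf1 y) eq_refl eq_refl).
etransitivity; [symmetry; apply paste_paste1 with (d0 := t1f 1) (dn := t1f 1)
  (a0 := t1f 1) (an := t1f 1)|].
apply (f_equal (fun a => vcomp a (hom_restr (sharp l) (tf1 y) ey))).
etransitivity; [symmetry; apply hcomp_vcomp|rewrite !vcomp_cid; reflexivity].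
Qed.

Lemma sharp_restrK Y (x : tight Y C) (xr : tight Y E) (ex : xr = x ;; r) :
  vcomp (hom_restr (sharp l) (tf1 x) ex) (hom_restr (flat l) ex (tf1 x)) = cid (hom l x).
Proof. rewrite hom_restr_vcomp, sharpK; apply hom_restr_cid. Qed.

Lemma flat_restrK Y (x : tight Y C) (xr : tight Y E) (ex : xr = x ;; r) :
  vcomp (hom_restr (flat l) ex (tf1 x)) (hom_restr (sharp l) (tf1 x) ex) = cid (hom j xr).
Proof. rewrite hom_restr_vcomp, flatK; apply hom_restr_cid. Qed.

Lemma adj_precomp_eta Y (x : tight Y C) (xr : tight Y E) (ex : xr = x ;; r)
    (phi : cell [: hom j xr] (hom l x) 1 1) :
  vcomp (hom_post phi eq_refl ex) (hcomp adj_eta (cid (hom (l ;; r) xr))) =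
  vcomp phi (hom_restr (sharp l) (tf1 x) ex).
Proof.
rewrite vcomp_hcomp; etransitivity; [exact (sharp_restr_nat eq_refl ex (hom_id l) phi)|].
rewrite hcomp_idl; reflexivity.
Qed.

Lemma adj_unitl : vcomp adj_ext (hcomp adj_eta (cid (hom (l ;; r) (l ;; r)))) = cid _.
Proof. unfold adj_ext; rewrite adj_precomp_eta; apply flat_restrK. Qed.

Lemma adj_unitr : vcomp adj_eta adj_ext = hom_id (l ;; r).
Proof.
unfold adj_eta, adj_ext, hom_post.
rewrite vcompA, <- (vcompA (hom_restr (sharp l) _ _)), sharp_restrK, cid_vcomp.
apply hom_post_id.
Qed.

Lemma adj_assoc : hcomp adj_ext adj_ext = vcomp (hcomp (cid (hom j (l ;; r))) adj_ext) adj_ext.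
Proof.
unfold adj_ext; rewrite <- hom_post_comp.
assert (H : hcomp (cid (hom j (l ;; r)))
    (hom_post (hom_restr (flat l) eq_refl (tf1 l)) (eq_refl (x := l ;; r)) (eq_refl (x := l ;; r))) =
  vcomp (hcomp (hom_restr (flat l) eq_refl (tf1 l)) (hom_restr (flat l) eq_refl (tf1 l)))
    (hom_restr (sharp l) (tf1 l) eq_refl)).
{ rewrite <- sharp_restr_nat with (ex := eq_refl), flat_restrK; reflexivity. }
rewrite H; unfold hom_post.
rewrite vcompA, <- (vcompA (hom_restr (sharp l) _ _)), sharp_restrK, cid_vcomp; reflexivity.
Qed.

Definition adj_monad : rel_monad j := RelMonad adj_unitl adj_unitr adj_assoc.

Lemma hom_restr1 : hom_restr (sharp l) (tf1 1) (t1f r) = sharp l.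
Proof.
apply (rfact_ext (e0 := t1f j) (en := t1f r)).
etransitivity; [exact (op_restr (sharp l) (tf1 1) (t1f r) (t1f j) (t1f r) (t1f j) (t1f r)
  (t1f j) (t1f r))|].
etransitivity; [|apply paste_cid1].
do 2 f_equal.
apply (rfact_ext (e0 := t1f l) (en := t1f 1)).
etransitivity; [apply op_along|symmetry; apply paste_cid1].
Qed.

Lemma adj_act_unit :
  vcomp adj_act (hcomp (eta adj_monad) (cid (hom adj_monad r))) = cid (hom j r).
Proof.
change (vcomp adj_act (hcomp adj_eta (cid (hom (l ;; r) r))) = cid (hom j r)).
unfold adj_act; rewrite adj_precomp_eta, hom_restr1; apply flatK.
Qed.

Lemma adj_act_assoc :
  hcomp (ext adj_monad) adj_act = vcomp (hcomp (cid (hom j adj_monad)) adj_act) adj_act.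
Proof.
change (hcomp adj_ext adj_act = vcomp (hcomp (cid (hom j (l ;; r))) adj_act) adj_act).
unfold adj_ext, adj_act; rewrite <- hom_post_comp.
assert (H : hcomp (cid (hom j (l ;; r)))
    (hom_post (flat l) (eq_refl (x := l ;; r)) (t1f r)) =
  vcomp (hcomp (hom_restr (flat l) eq_refl (tf1 l)) (flat l)) (sharp l)).
{ rewrite <- hom_restr1, <- sharp_restr_nat with (ex := eq_refl), flat_restrK; reflexivity. }
rewrite H; unfold hom_post.
rewrite vcompA, <- (vcompA (sharp l)), sharpK, cid_vcomp; reflexivity.
Qed.

Definition adj_algebra : algebra adj_monad C :=
  @Algebra _ _ _ adj_monad C r adj_act adj_act_unit adj_act_assoc.

Definition comparison (O : algebra_object adj_monad) : tight C (Alg O) := med O adj_algebra.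

End InducedMonad.

(** * Colimits *)

Definition is_colimit X Y Z (p : loose X Y) (f : tight Y Z) (c : tight X Z)
    (lam : cell [: p] (hom f c) 1 1) : Prop :=
  forall (qs : chain X Z) (psi : cell (p ::: qs) (hom f 1) 1 1),
    exists! phi : cell qs (hom c 1) 1 1, hcomp lam phi = psi.

Definition is_left_extension D C Z (c : tight D C) (f : tight D Z) (e : tight C Z)
    (lam : cell [: hom c 1] (hom f e) 1 1) : Prop :=
  is_colimit lam.

Definition dense A E (j : tight A E) : Prop :=
  @is_left_extension A E E j j 1 (cid (hom j 1)).

Definition left_opcartesian A X (ts : chain A X) (q : loose X A) (theta : cell ts q 1 1) : Prop :=
  forall (An B0 Bn : ob V) (qs : chain X An) (s : loose Bn B0) (g0 : tight A B0)
    (gn : tight An Bn) (phi : cell (ts +++ qs) s g0 gn),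
    exists! psi : cell (q ::: qs) s g0 gn, graft cnil theta qs psi = phi.

Definition absolute A E (j : tight A E) X Y (p : loose X Y) (f : tight Y E) (c : tight X E)
    (lam : cell [: p] (hom f c) 1 1) : Prop :=
  left_opcartesian (hcomp (cid (hom j f)) lam).

(* Only meaningful when the colimit of f ;; g weighted by p exists. *)
Definition non_strictly_created X Y Z W (p : loose Y Z) (f : tight Z W) (g : tight W X) : Prop :=
  (forall (w : tight Y W) (lam : cell [: p] (hom f w) 1 1),
     is_colimit (hom_post lam (eq_refl (f ;; g)) (eq_refl (w ;; g))) <-> is_colimit lam) /\
  (exists (w : tight Y W) (lam : cell [: p] (hom f w) 1 1), is_colimit lam).

Definition creates_absolute_extensions A E D (j : tight A E) (r : tight D E) : Prop :=
  forall (C : ob V) (c : tight D C) (e : tight C E)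
    (lam : cell [: hom c 1] (hom (tid D ;; r) e) 1 1),
    is_left_extension lam -> absolute j lam -> non_strictly_created (hom c 1) (tid D) r.

(** * Monadicity *)

Definition tight_iso A B (f g : tight A B) : Prop :=
  exists (phi : cell cnil (hom f g) 1 1) (psi : cell cnil (hom g f) 1 1),
    hcomp phi psi = hom_id f /\ hcomp psi phi = hom_id g.

Definition equivalence A B (k : tight A B) : Prop :=
  exists k' : tight B A, tight_iso (tid A) (k ;; k') /\ tight_iso (k' ;; k) (tid B).

Definition non_strictly_monadic A E D (j : tight A E) (r : tight D E) : Prop :=
  exists (l : left_adjoint j r) (O : algebra_object (adj_monad l)), equivalence (comparison O).

End Equipment.

(* Main.v *)
(* Writing l for the left j-adjoint of r, the loose-cell E(j,r) is isomorphic to D(l,1), so it is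
   represented by a tight-cell: composing it on the left of C(c,1) always produces C(lc,1).
   Hence an r-extension e of weight C(c,1) is j-absolute exactly when E(j,e) is isomorphic to
   C(lc,1), compatibly with the cocone, and E(j,r), C(c,1) => E(j,e) can then be cancelled with
   arbitrary chains on both sides, although j-absoluteness only mentions chains on the right.

   If r creates such extensions, apply this to the comparison k : D -> Alg(T).  The algebra
   structure of u_T lifts to a cell E(j,u_T) => Alg(T)(lk,1), so u_T is an absolute colimit, and by
   density a left extension, of r along k.  It is therefore created by some w : Alg(T) -> D; then
   kw is isomorphic to 1 because r is conservative (creation for extensions along 1_D), and the
   isomorphism of u_T with wr is one of algebras, hence lifts to an isomorphism of 1 with wk.

   Conversely, if k is an equivalence then D represents algebras up to isomorphism and graded
   morphisms exactly.  A j-absolute r-extension e inherits an algebra structure from r, which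
   gives x : C -> D with xr isomorphic to e, and the universal property of e restricts to graded
   morphisms, so it is reflected by r. *)
From Stdlib Require Import ProofIrrelevance.
Require Import Defs.

Set Implicit Arguments.
Unset Strict Implicit.
Unset Printing Implicit Defensive.
Local Open Scope vdc_scope.
Local Notation "1" := (tid _) : vdc_scope.

(** * Layers of cells *)

Section Layers.

Variable V : vdc.
Local Notation chain := (chain (@loose V)).

(* An existential over [cells2] lets composable layers be described by their three faces, without
   the equality casts in [cells2_upper]. *)
Definition composes A0 An B0 Bn C0 Cn (ps : chain A0 An) (qs : chain B0 Bn) (rs : chain C0 Cn)
    (f0 : tight A0 B0) (fn : tight An Bn) (g0 : tight B0 C0) (gn : tight Bn Cn)
    (h0 : tight A0 C0) (hn : tight An Cn)
    (Phi : cells ps qs f0 fn) (Psi : cells qs rs g0 gn) (Xi : cells ps rs h0 hn) : Prop :=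
  exists Th : cells2 ps qs rs f0 fn g0 gn h0 hn,
    cells2_upper Th = Phi /\ cells2_lower Th = Psi /\ cells2_comp Th = Xi.

(** This is associativity of pasting in the form used from here on: the composite layer [Xi] is
    found by unification while a derivation of [composes] is built cell by cell. *)
Lemma paste_composes A0 An B0 Bn C0 Cn D0 Dn (ps : chain A0 An) (qs : chain B0 Bn)
    (rs : chain C0 Cn) (s : loose Dn D0)
    (f0 : tight A0 B0) (fn : tight An Bn) (g0 : tight B0 C0) (gn : tight Bn Cn)
    (h0 : tight A0 C0) (hn : tight An Cn) (k0 : tight C0 D0) (kn : tight Cn Dn)
    (gk0 : tight B0 D0) (gkn : tight Bn Dn) (l0 : tight A0 D0) (ln : tight An Dn)
    (Phi : cells ps qs f0 fn) (Psi : cells qs rs g0 gn) (Xi : cells ps rs h0 hn)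
    (chi : cell rs s k0 kn)
    (e0 : l0 = h0 ;; k0) (en : ln = hn ;; kn) (d0 : gk0 = g0 ;; k0) (dn : gkn = gn ;; kn)
    c0 cn :
  composes Phi Psi Xi ->
  paste Phi (paste Psi chi d0 dn) c0 cn = paste Xi chi e0 en.
Proof. intros [Th [<- [<- <-]]]; symmetry; apply paste_assoc. Qed.

Lemma composes_nil A B C (f : tight A B) (g : tight B C) (h : tight A C) :
  h = f ;; g -> composes (cells_nil f) (cells_nil g) (cells_nil h).
Proof. intros e; exists (cells2_nil f g h e); auto. Qed.

Lemma composes_cons A0 A1 An B0 B1 Bn C0 C1 Cn
    (top : chain A0 An) (ps : chain A0 A1) (ps' : chain A1 An)
    (mid : chain B0 Bn) (qs : chain B0 B1) (qs' : chain B1 Bn)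
    (r : loose C1 C0) (rs : chain C1 Cn)
    (f0 : tight A0 B0) (f1 : tight A1 B1) (fn : tight An Bn)
    (g0 : tight B0 C0) (g1 : tight B1 C1) (gn : tight Bn Cn)
    (h0 : tight A0 C0) (h1 : tight A1 C1) (hn : tight An Cn)
    (Phi : cells ps qs f0 f1) (psi : cell qs r g0 g1)
    (Phi' : cells ps' qs' f1 fn) (Psi' : cells qs' rs g1 gn) (Xi' : cells ps' rs h1 hn)
    (et : top = ps +++ ps') (em : mid = qs +++ qs') (e0 : h0 = f0 ;; g0) (e1 : h1 = f1 ;; g1) :
  composes Phi' Psi' Xi' ->
  composes (cells_cast (eq_sym et) (eq_sym em) (cells_app Phi Phi'))
    (cells_cons em psi Psi') (cells_cons et (paste Phi psi e0 e1) Xi').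
Proof. intros [Th [<- [<- <-]]]; exists (cells2_cons et em e0 e1 Phi psi Th); auto. Qed.

Lemma cells_cast_cons A0 A1 An B0 B1 Bn (top top' : chain A0 An) (ps : chain A0 A1)
    (ps' : chain A1 An) (q : loose B1 B0) (bot : chain B1 Bn)
    (f0 : tight A0 B0) (f1 : tight A1 B1) (fn : tight An Bn)
    (et : top = ps +++ ps') (phi : cell ps q f0 f1) (Phi : cells ps' bot f1 fn)
    (e : top = top') (e' : q ::: bot = q ::: bot) et' :
  cells_cast e e' (cells_cons et phi Phi) = cells_cons (top := top') et' phi Phi.
Proof.
destruct e; rewrite cells_cast_id; f_equal; apply proof_irrelevance.
Qed.

Lemma cells_cons_irr A0 A1 An B0 B1 Bn
    (top : chain A0 An) (ps : chain A0 A1) (ps' : chain A1 An)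
    (q : loose B1 B0) (qs : chain B1 Bn)
    (f0 : tight A0 B0) (f1 : tight A1 B1) (fn : tight An Bn) e e'
    (phi : cell ps q f0 f1) (Phi : cells ps' qs f1 fn) :
  cells_cons (top := top) e phi Phi = cells_cons e' phi Phi.
Proof. f_equal; apply proof_irrelevance. Qed.

(** For lower cells with zero, one or two inputs, the cast in [composes_cons] can be removed once
    and for all. These arities suffice for units, vertical composites and binary composition. *)
Lemma composes_cons0 A0 An B0 Bn C0 C1 Cn
    (ps' : chain A0 An) (qs' : chain B0 Bn) (r : loose C1 C0) (rs : chain C1 Cn)
    (f0 : tight A0 B0) (fn : tight An Bn)
    (g0 : tight B0 C0) (g1 : tight B0 C1) (gn : tight Bn Cn)
    (h0 : tight A0 C0) (h1 : tight A0 C1) (hn : tight An Cn)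
    (psi : cell cnil r g0 g1)
    (Phi' : cells ps' qs' f0 fn) (Psi' : cells qs' rs g1 gn) (Xi' : cells ps' rs h1 hn)
    (em : qs' = cnil +++ qs') (et : ps' = cnil +++ ps')
    (e0 : h0 = f0 ;; g0) (e1 : h1 = f0 ;; g1) :
  composes Phi' Psi' Xi' ->
  composes Phi' (cells_cons em psi Psi')
    (cells_cons et (paste (cells_nil f0) psi e0 e1) Xi').
Proof.
intros H; assert (G := composes_cons (cells_nil f0) psi et em e0 e1 H).
rewrite cells_cast_id in G; exact G.
Qed.

Lemma composes_cons1 A0 A1 An B0 B1 Bn C0 C1 Cn
    (top : chain A0 An) (ps : chain A0 A1) (ps' : chain A1 An)
    (q : loose B1 B0) (qs' : chain B1 Bn)
    (r : loose C1 C0) (rs : chain C1 Cn)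
    (f0 : tight A0 B0) (f1 : tight A1 B1) (fn : tight An Bn)
    (g0 : tight B0 C0) (g1 : tight B1 C1) (gn : tight Bn Cn)
    (h0 : tight A0 C0) (h1 : tight A1 C1) (hn : tight An Cn)
    (phi : cell ps q f0 f1) (psi : cell [: q] r g0 g1)
    (Phi' : cells ps' qs' f1 fn) (Psi' : cells qs' rs g1 gn) (Xi' : cells ps' rs h1 hn)
    (et et' : top = ps +++ ps') (em : q ::: qs' = [: q] +++ qs')
    (e0 : h0 = f0 ;; g0) (e1 : h1 = f1 ;; g1) :
  composes Phi' Psi' Xi' ->
  composes (cells_cons et phi Phi') (cells_cons em psi Psi')
    (cells_cons et' (paste (cells1 phi) psi e0 e1) Xi').
Proof.
intros H; assert (G := composes_cons (cells1 phi) psi et' em e0 e1 H).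
rewrite cells_app_single in G.
refine (eq_ind _ (fun Phi => composes Phi _ _) G _ _).
apply (cells_cast_cons (bot := qs')).
Qed.

Lemma composes_cons2 A0 A1 A2 An B0 B1 B2 Bn C0 C1 Cn
    (top : chain A0 An) (top2 : chain A1 An) (ps1 : chain A0 A1) (ps2 : chain A1 A2)
    (ps' : chain A2 An)
    (q1 : loose B1 B0) (q2 : loose B2 B1) (qs' : chain B2 Bn)
    (r : loose C1 C0) (rs : chain C1 Cn)
    (f0 : tight A0 B0) (f1 : tight A1 B1) (f2 : tight A2 B2) (fn : tight An Bn)
    (g0 : tight B0 C0) (g1 : tight B2 C1) (gn : tight Bn Cn)
    (h0 : tight A0 C0) (h1 : tight A2 C1) (hn : tight An Cn)
    (phi1 : cell ps1 q1 f0 f1) (phi2 : cell ps2 q2 f1 f2) (psi : cell [: q1; q2] r g0 g1)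
    (Phi' : cells ps' qs' f2 fn) (Psi' : cells qs' rs g1 gn) (Xi' : cells ps' rs h1 hn)
    (et : top = ps1 +++ top2) (et2 : top2 = ps2 +++ ps')
    (et' : top = (ps1 +++ ps2) +++ ps') (em : q1 ::: q2 ::: qs' = [: q1; q2] +++ qs')
    (e0 : h0 = f0 ;; g0) (e1 : h1 = f2 ;; g1) :
  composes Phi' Psi' Xi' ->
  composes (cells_cons et phi1 (cells_cons et2 phi2 Phi')) (cells_cons em psi Psi')
    (cells_cons et' (paste (cells_pair phi1 phi2) psi e0 e1) Xi').
Proof.
intros H; subst top2.
assert (G := composes_cons (cells_pair phi1 phi2) psi et' em e0 e1 H).
refine (eq_ind _ (fun Phi => composes Phi _ _) G _ _).
unfold cells_pair; simpl.
etransitivity; [apply (cells_cast_cons (bot := q2 ::: qs'))|].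
f_equal; f_equal; apply proof_irrelevance.
Qed.

Lemma composes_cids_r A0 An B0 Bn (ps : chain A0 An) (qs : chain B0 Bn)
    (f0 : tight A0 B0) (fn : tight An Bn) (Phi : cells ps qs f0 fn) :
  composes Phi (cids qs) Phi.
Proof.
induction Phi as [A B f|A0 A1 An B0 B1 Bn top ps ps' q qs f0 f1 fn et phi Phi IH]; simpl.
- apply composes_nil, tf1.
- rewrite <- (paste_cid phi (tf1 _) (tf1 _)) at 2.
  refine (composes_cons1 _ _ _ _ _ _ _ IH).
Qed.

Lemma composes_cids A0 An (ps : chain A0 An) : composes (cids ps) (cids ps) (cids ps).
Proof. apply composes_cids_r. Qed.

Lemma cells1_cons A0 An B0 Bn (ps : chain A0 An) (q : loose Bn B0)
    (f0 : tight A0 B0) (fn : tight An Bn) (phi : cell ps q f0 fn) e :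
  cells_cons e phi (cells_nil fn) = cells1 phi.
Proof. unfold cells1; f_equal; apply proof_irrelevance. Qed.

End Layers.

(** * Cells into a loose-identity *)

Section Flat.

Variable V : equipment.
Local Notation chain := (chain (@loose V)).
Implicit Types A B C D E W Y Z : ob V.

(** Concatenation of variable chains is associative and right unital only propositionally, so such
    laws for cells hold up to this transport. *)
Definition ccast A0 An B0 Bn (ps ps' : chain A0 An) (q : loose Bn B0) (f : tight A0 B0)
    (g : tight An Bn) (e : ps = ps') (phi : cell ps q f g) : cell ps' q f g :=
  match e in _ = t return cell t q f g with eq_refl => phi end.

Lemma ccast_id A0 An B0 Bn (ps : chain A0 An) (q : loose Bn B0) (f : tight A0 B0)
    (g : tight An Bn) (e : ps = ps) (phi : cell ps q f g) : ccast e phi = phi.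
Proof. rewrite (proof_irrelevance _ e eq_refl); reflexivity. Qed.

Lemma paste_ccast A0 A1 An B0 B1 Bn C0 Cn (ps ps' : chain A0 An) (ts : chain A0 A1)
    (us : chain A1 An) (q : loose B1 B0)
    (qs : chain B1 Bn) (r : loose Cn C0) (f0 : tight A0 B0) (f1 : tight A1 B1)
    (fn : tight An Bn) (g0 : tight B0 C0) (gn : tight Bn Cn) (h0 : tight A0 C0)
    (hn : tight An Cn) (e : ps = ps') (phi : cell ts q f0 f1) (Phi : cells us qs f1 fn)
    (psi : cell (q ::: qs) r g0 gn) (e0 : h0 = f0 ;; g0) (en : hn = fn ;; gn) et et' :
  ccast e (paste (cells_cons et phi Phi) psi e0 en) = paste (cells_cons et' phi Phi) psi e0 en.
Proof. destruct e; simpl; f_equal; apply cells_cons_irr. Qed.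

Section Def.
Variables (A0 An B : ob V) (ps : chain A0 An) (f : tight A0 B) (g : tight An B).
(** By the universal property of the restriction B(f,g), its cells transpose to cells into the
    loose-identity with sides [f] and [g]. Most equations are checked after this transposition,
    where composition is pasting with [lmult] and the action of a tight-cell is pasting with
    [lid_map]. *)
Definition to_lid (phi : cell ps (hom f g) 1 1) : cell ps (lid B) f g :=
  paste (cells1 phi) (hom_cart f g) (t1f f) (t1f g).
Definition of_lid (phi : cell ps (lid B) f g) : cell ps (hom f g) 1 1 :=
  rfact phi (t1f f) (t1f g).
Lemma to_lid_inj (phi psi : cell ps (hom f g) 1 1) : to_lid phi = to_lid psi -> phi = psi.
Proof. apply rfact_ext. Qed.
Lemma of_lidK (phi : cell ps (lid B) f g) : to_lid (of_lid phi) = phi.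
Proof. apply rfactK. Qed.
End Def.

Definition lid_id B Z (f : tight Z B) : cell cnil (lid B) f f :=
  paste (cells_nil f) (lunit B) (tf1 f) (tf1 f).

Definition lid_comp A0 A1 A2 B (ps : chain A0 A1) (qs : chain A1 A2) (f : tight A0 B) (g : tight A1
  B)
    (h : tight A2 B) (phi : cell ps (lid B) f g) (psi : cell qs (lid B) g h) :
    cell (ps +++ qs) (lid B) f h :=
  paste (cells_pair phi psi) (lmult B) (tf1 f) (tf1 h).

Definition lid_post B C A0 An (k : tight B C) (ps : chain A0 An) (f : tight A0 B) (g : tight An B)
    (phi : cell ps (lid B) f g) (fk : tight A0 C) (gk : tight An C)
    (e : fk = f ;; k) (e' : gk = g ;; k) : cell ps (lid C) fk gk :=
  paste (cells1 phi) (lid_map k) e e'.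

Section Fl.
Variables (B Z W : ob V) (f : tight Z B) (g : tight W B).

Lemma to_lid_hcomp Y (h : tight Y B) (ps : chain Z W) (qs : chain W Y)
    (phi : cell ps (hom f g) 1 1) (psi : cell qs (hom g h) 1 1) :
  to_lid (hcomp phi psi) = lid_comp (to_lid phi) (to_lid psi).
Proof. exact (op_hcomp phi psi _ _ (t1f f) (t1f h) (t1f g) (tf1 f) (tf1 h)). Qed.

Lemma to_lid_post C (k : tight B C) (ps : chain Z W) (phi : cell ps (hom f g) 1 1)
    (fk : tight Z C) (gk : tight W C) (e : fk = f ;; k) (e' : gk = g ;; k) :
  to_lid (hom_post phi e e') = lid_post (to_lid phi) e e'.
Proof. exact (op_hom_map e e' phi _ _ (t1f fk) (t1f gk) (t1f f) (t1f g) e e'). Qed.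

Lemma to_lid_id : to_lid (hom_id f) = lid_id f.
Proof. apply rfactK. Qed.

Lemma to_lid_cid : to_lid (cid (hom f g)) = hom_cart f g.
Proof. apply paste_cid1. Qed.

Lemma to_lid_map C (k : tight B C) (fk : tight Z C) (gk : tight W C) (e : fk = f ;; k)
    (e' : gk = g ;; k) :
  to_lid (hom_map e e') = lid_post (hom_cart f g) e e'.
Proof. apply rfactK. Qed.

Lemma to_lid_restr B' Y (f' : tight Z B') (g' : tight W B') (phi : cell [: hom f g] (hom f' g') 1 1)
    (x : tight Y W) (xg : tight Y B) (xg' : tight Y B') (e : xg = x ;; g) (e' : xg' = x ;; g') :
  to_lid (hom_restr phi e e') = paste (cells1 (hom_along f e)) (to_lid phi) (t1f f') e'.
Proof. exact (op_restr phi e e' (t1f f') (t1f xg') (t1f f') (t1f g') (t1f f') e'). Qed.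

Lemma to_lid_paste (ps qs : chain Z W) (Phi : cells ps qs 1 1) (phi : cell qs (hom f g) 1 1) e0 en :
  to_lid (paste Phi phi e0 en) = paste Phi (to_lid phi) (t1f f) (t1f g).
Proof. apply paste_paste1. Qed.

Lemma to_lid_vcomp (ps : chain Z W) (p : loose W Z) (alpha : cell ps p 1 1)
    (phi : cell [: p] (hom f g) 1 1) :
  to_lid (vcomp alpha phi) = paste (cells1 alpha) (to_lid phi) (t1f f) (t1f g).
Proof. apply paste_paste1. Qed.

End Fl.

Lemma lid_comp_paste A0 A1 A2 A0' A1' A2' B (ps : chain A0 A1) (ps' : chain A1 A2)
    (qs : chain A0' A1') (qs' : chain A1' A2')
    (f0 : tight A0 A0') (f1 : tight A1 A1') (f2 : tight A2 A2')
    (f : tight A0' B) (g : tight A1' B) (h : tight A2' B)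
    (f' : tight A0 B) (g' : tight A1 B) (h' : tight A2 B)
    (Phi : cells ps qs f0 f1) (Phi' : cells ps' qs' f1 f2)
    (phi : cell qs (lid B) f g) (psi : cell qs' (lid B) g h) e0 e1 e1' e2 :
  lid_comp (paste (h0 := f') (hn := g') Phi phi e0 e1) (paste (hn := h') Phi' psi e1' e2) =
  paste (cells_app Phi Phi') (lid_comp phi psi) e0 e2.
Proof. apply paste_paste2. Qed.

Lemma lid_comp_paste1 A0 A1 A2 A0' A1' A2' B (ps : chain A0 A1) (ps' : chain A1 A2)
    (q : loose A1' A0') (q' : loose A2' A1')
    (f0 : tight A0 A0') (f1 : tight A1 A1') (f2 : tight A2 A2')
    (f : tight A0' B) (g : tight A1' B) (h : tight A2' B)
    (f' : tight A0 B) (g' : tight A1 B) (h' : tight A2 B)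
    (alpha : cell ps q f0 f1) (beta : cell ps' q' f1 f2)
    (phi : cell [: q] (lid B) f g) (psi : cell [: q'] (lid B) g h) e0 e1 e1' e2 :
  lid_comp (paste (h0 := f') (hn := g') (cells1 alpha) phi e0 e1)
     (paste (hn := h') (cells1 beta) psi e1' e2) =
  paste (cells_pair alpha beta) (lid_comp phi psi) e0 e2.
Proof. rewrite lid_comp_paste, cells_app_single; reflexivity. Qed.

Lemma lid_comp_unl A0 An B (ps : chain A0 An) (f : tight A0 B) (g : tight An B)
    (phi : cell ps (lid B) f g) : lid_comp (lid_id f) phi = phi.
Proof. apply lmultl. Qed.

Lemma lid_comp_unr A0 An B (p : loose An A0) (f : tight A0 B) (g : tight An B)
    (phi : cell [: p] (lid B) f g) : lid_comp phi (lid_id g) = phi.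
Proof. apply lmultr. Qed.

Lemma paste_pair_cid A0 A1 A2 B0 Bn (p : loose A1 A0) (q : loose A2 A1) (r : loose Bn B0)
    (f : tight A0 B0) (g : tight A2 Bn) (phi : cell [: p; q] r f g) e0 en :
  paste (cells_pair (cid p) (cid q)) phi e0 en = phi.
Proof.
etransitivity; [|exact (paste_cids phi e0 en)].
unfold cells_pair; simpl; rewrite cells1_cons; reflexivity.
Qed.

(** Inserting the loose-unit in the first slot is injective and turns both sides into [lmult B]. *)
Lemma lmultA B :
  paste (h0 := 1) (hn := 1) (cells_pair (lmult B) (cid (lid B))) (lmult B) (t1f 1) (t1f 1) =
  paste (cells_pair (cid (lid B)) (lmult B)) (lmult B) (t1f 1) (t1f 1).
Proof.
apply (lid_ext (ps := cnil) (qs := [: lid B; lid B])).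
transitivity (lmult B).
- unfold graft.
  etransitivity; [refine (paste_composes _ (t1f _) (t1f _) _ _ _ _
    (composes_cons2 (lunit B) (cid (lid B)) (lmult B) eq_refl eq_refl eq_refl eq_refl (t1f 1) (t1f
      1)
    (composes_cons1 (cid (lid B)) (cid (lid B)) eq_refl eq_refl (capp_nil _) (t1f 1) (t1f 1)
       (composes_nil (t1f 1)))))|].
  rewrite graft_lmult, paste_cid.
  exact (paste_cids (lmult B) _ _).
- symmetry; unfold graft.
  etransitivity; [refine (paste_composes _ (t1f _) (t1f _) _ _ _ _
    (composes_cons1 (lunit B) (cid (lid B)) eq_refl eq_refl eq_refl (t1f 1) (t1f 1)
    (composes_cons2 (cid (lid B)) (cid (lid B)) (lmult B) eq_refl eq_refl (capp_nil _)
       (capp_nil _) (t1f 1) (t1f 1) (composes_nil (t1f 1)))))|].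
  rewrite paste_cid, cells1_cons, paste_pair_cid.
  etransitivity; [|refine (lmultl (lmult B) (t1f 1) (t1f 1) (t1f 1) (t1f 1))].
  unfold cells_pair; do 2 f_equal.
  symmetry; exact (paste_cids (lunit B) _ _).
Qed.

(** Each side is the pasting of the three cells with one of the two ternary multiplications
    identified by [lmultA]. *)
Lemma lid_compA A0 A1 A2 A3 B (ps : chain A0 A1) (qs : chain A1 A2) (rs : chain A2 A3)
    (f : tight A0 B) (g : tight A1 B) (h : tight A2 B) (i : tight A3 B)
    (phi : cell ps (lid B) f g) (psi : cell qs (lid B) g h) (chi : cell rs (lid B) h i) :
  lid_comp (lid_comp phi psi) chi = ccast (eq_sym (cappA ps qs rs)) (lid_comp phi (lid_comp psi
    chi)).
Proof.
pose (e := eq_sym (cappA ps qs rs)); fold e.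
transitivity (paste (cells_cons (top := (ps +++ qs) +++ rs) (cappA ps qs rs) phi
   (cells_cons eq_refl psi (cells1 chi)))
   (paste (cells_pair (lmult B) (cid (lid B))) (lmult B) (t1f 1) (t1f 1)) (tf1 f) (tf1 i)).
- symmetry.
  etransitivity; [refine (paste_composes _ (tf1 f) (tf1 i) _ _ _ _
    (composes_cons2 phi psi (lmult B) (cappA _ _ _) eq_refl eq_refl eq_refl (tf1 f) (tf1 h)
    (composes_cons1 chi (cid (lid B)) (capp_nil _) (capp_nil _) (capp_nil _) (tf1 h) (tf1 i)
       (composes_nil (tf1 i)))))|].
  rewrite paste_cid; reflexivity.
- rewrite lmultA; unfold lid_comp at 1, e.
  transitivity (ccast (eq_sym (cappA ps qs rs)) (paste (cells_cons eq_refl phi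
   (cells_cons eq_refl psi (cells1 chi)))
   (paste (cells_pair (cid (lid B)) (lmult B)) (lmult B) (t1f 1) (t1f 1)) (tf1 f) (tf1 i))).
  + symmetry; apply paste_ccast.
  + f_equal.
    etransitivity; [refine (paste_composes _ (tf1 f) (tf1 i) _ _ _ _
    (composes_cons1 phi (cid (lid B)) eq_refl eq_refl eq_refl (tf1 f) (tf1 g)
    (composes_cons2 psi chi (lmult B) eq_refl (capp_nil _) (capp_nil _) (capp_nil _) (tf1 g) (tf1 i)
       (composes_nil (tf1 i)))))|].
    rewrite paste_cid; reflexivity.
Qed.

Lemma lid_post_un A B C (f : tight A B) (k : tight B C) (fk : tight A C) (e e' : fk = f ;; k) :
  lid_post (lid_id f) e e' = lid_id fk.
Proof. exact (lid_map_unit e e' e e' (tf1 f) (tf1 f) (tf1 fk) (tf1 fk)). Qed.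

Lemma lid_post_paste A0 An A0' An' B C (ps : chain A0 An) (qs : chain A0' An')
    (f0 : tight A0 A0') (f1 : tight An An') (f : tight A0' B) (g : tight An' B)
    (f' : tight A0 B) (g' : tight An B) (k : tight B C)
    (Phi : cells ps qs f0 f1) (phi : cell qs (lid B) f g) e0 e1
    (fk : tight A0 C) (gk : tight An C) (ef : fk = f' ;; k) (eg : gk = g' ;; k)
    (fk' : tight A0' C) (gk' : tight An' C) (ef' : fk' = f ;; k) (eg' : gk' = g ;; k) d0 d1 :
  lid_post (paste Phi phi e0 e1) ef eg = paste Phi (lid_post phi ef' eg') d0 d1.
Proof. apply paste_paste1. Qed.

Lemma lid_map_comp B C D (k : tight B C) (k' : tight C D) e e' :
  paste (h0 := k ;; k') (hn := k ;; k') (cells1 (lid_map k)) (lid_map k') e e' = lid_map (k ;; k').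
Proof.
apply (lid_ext (ps := cnil) (qs := cnil)).
unfold graft; simpl.
assert (H : forall B' B'' (h : tight B' B'') e e',
  paste (h0 := h) (hn := h) (cells_cons eq_refl (lunit B') (cells_nil 1)) (lid_map h) e e' = lid_id
    h).
{ intros B' B'' h d d'.
  rewrite <- (paste_cids (lunit B') (t1f 1) (t1f 1)); unfold cids.
  rewrite cells1_cons.
  exact (lid_map_unit (a := 1) d d' d d _ _ (tf1 h) (tf1 h)). }
rewrite H.
rewrite <- (paste_paste1 _ _ _ (t1f k) (t1f k) eq_refl eq_refl), H.
apply lid_post_un.
Qed.

Lemma lid_post_pst A0 An B C D (ps : chain A0 An) (k : tight B C) (k' : tight C D)
    (f : tight A0 B) (g : tight An B) (phi : cell ps (lid B) f g)
    (fk : tight A0 C) (gk : tight An C) (ef : fk = f ;; k) (eg : gk = g ;; k)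
    (fk' : tight A0 D) (gk' : tight An D) (ef' : fk' = fk ;; k') (eg' : gk' = gk ;; k')
    kk (ek : kk = k ;; k') (d : fk' = f ;; kk) (d' : gk' = g ;; kk) :
  lid_post (lid_post phi ef eg) ef' eg' = lid_post phi d d'.
Proof.
subst kk; unfold lid_post.
rewrite (paste_paste1 _ _ _ _ _ _ _ eq_refl eq_refl d d'), lid_map_comp; reflexivity.
Qed.

End Flat.

(* The chains of [hcomp phi psi] and of [lid_comp phi psi] are concatenations, which have to be
   reduced before rewriting in a goal about concrete chains. *)
Ltac rw H := let K := fresh in pose proof (K := H); cbn [capp] in K; rewrite K; clear K.

Ltac rw_to_lid_hcomp := match goal with
  |- context [to_lid (hcomp ?phi ?psi)] => rw (to_lid_hcomp phi psi)
end.

(** * Loose-cells represented by a tight-cell *)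

Section Absolute.

Variable V : equipment.
Local Notation chain := (chain (@loose V)).
Implicit Types A B C D E W Y Z : ob V.

(** The loose-unit followed by [lid_map g] is the unit [lid_id g] of composition. So composing with
    [lid_map g] is the canonical way to let [phi] absorb a loose-identity on its right. *)
Lemma graft_lid_map_r B Z D (f : tight Z B) (g : tight D B) p (phi : cell [: p] (lid B) f g) :
  graft [: p] (lunit D) cnil (lid_comp phi (lid_map g)) = phi.
Proof.
transitivity (lid_comp phi (lid_id g)); [|apply lid_comp_unr].
unfold graft, lid_comp; simpl; rewrite cells1_cons.
etransitivity; [refine (paste_composes _ (tf1 f) (tf1 g) _ _ _ _
  (composes_cons1 (cid p) phi _ eq_refl eq_refl (t1f f) (t1f g)
  (composes_cons1 (lunit D) (lid_map g) (capp_nil cnil) (capp_nil _) (capp_nil _) (t1f g) (t1f g)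
    (composes_nil (t1f g)))))|].
rewrite paste_cid1, <- (paste_cids (lunit D) (t1f 1) (t1f 1)).
unfold cids.
rewrite (lid_map_unit (a := 1) (t1f g) (t1f g) (t1f g) (t1f g) _ _ (tf1 g) (tf1 g)).
unfold cells_pair, cells1; do 2 f_equal; apply proof_irrelevance.
Qed.

Lemma graft_lid_map_l B Z D (f : tight Z B) (g : tight D B) p (phi : cell [: p] (lid B) f g) :
  graft cnil (lunit Z) [: p] (lid_comp (lid_map f) phi) = phi.
Proof.
transitivity (lid_comp (lid_id f) phi); [|apply lid_comp_unl].
unfold graft, lid_comp; simpl.
etransitivity; [refine (paste_composes _ (tf1 f) (tf1 g) _ _ _ _
  (composes_cons1 (lunit Z) (lid_map f) eq_refl eq_refl eq_refl (t1f f) (t1f f)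
  (composes_cons1 (cid p) phi eq_refl (capp_nil _) (capp_nil _) (t1f f) (t1f g)
    (composes_nil (t1f g)))))|].
rewrite paste_cid1, <- (paste_cids (lunit Z) (t1f 1) (t1f 1)).
unfold cids.
rewrite (lid_map_unit (a := 1) (t1f f) (t1f f) (t1f f) (t1f f) _ _ (tf1 f) (tf1 f)).
reflexivity.
Qed.

(* If the unit sigma and the counit eps exhibit a as D(l,1), then inserting sigma on the left of
   a, b and absorbing a into b by eps is trivial: absorbing a loose-identity placed between a and b
   into b is the same as absorbing it into a. *)
Section Zigzag.

Variables (A D C : ob V) (l : tight A D) (a : loose D A) (b : loose C D).
Variables (sigma : cell cnil a 1 l) (eps : cell [: a] (lid D) l 1).
Variables (rho : cell [: a; lid D] a 1 1) (mul : cell [: lid D; b] b 1 1).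
Hypothesis rhoK : graft [: a] (lunit D) cnil rho = cid a.
Hypothesis mulK : graft cnil (lunit D) [: b] mul = cid b.
Hypothesis sigma_eps : paste (cells_pair sigma eps) rho (t1f 1) (t1f 1) = cid a.

Lemma zigzag An B0 Bn (qs : chain C An) (s : loose Bn B0) (f : tight A B0) (g : tight An Bn)
    (phi : cell (a ::: b ::: qs) s f g) e0 en :
  paste (cells_cons (top := a ::: b ::: qs) (ps := cnil) eq_refl sigma
    (cells_cons (ps := [: a; b]) eq_refl
      (paste (cells_pair eps (cid b)) mul (tf1 l) (tf1 1)) (cids qs))) phi e0 en = phi.
Proof.
(* One pasting absorbs the middle loose-identity into [b], the other into [a]; with the loose-unit
   inserted there, both become [phi]. *)
assert (H1 : paste (cells_cons (ps := [: a]) (ps' := lid D ::: b ::: qs) eq_refl (cid a)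
    (cells_cons (ps := [: lid D; b]) eq_refl mul (cids qs))) phi (t1f f) (t1f g) =
  paste (cells_cons (ps := [: a; lid D]) (ps' := b ::: qs) eq_refl rho
    (cells_cons (ps := [: b]) eq_refl (cid b) (cids qs))) phi (t1f f) (t1f g)).
{ apply (lid_ext (ps := [: a]) (qs := b ::: qs)).
  transitivity phi.
  - unfold graft; simpl.
    etransitivity; [refine (paste_composes _ (t1f f) (t1f g) _ _ _ _
      (composes_cons1 (cid a) (cid a) _ eq_refl eq_refl (t1f 1) (t1f 1)
      (composes_cons2 (lunit D) (cid b) mul eq_refl eq_refl eq_refl eq_refl (t1f 1) (t1f 1)
      (composes_cids _))))|].
    rewrite paste_cid.
    replace (paste (cells_pair (lunit D) (cid b)) mul (t1f 1) (t1f 1)) with (cid b).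
    + exact (paste_cids phi _ _).
    + etransitivity; [exact (eq_sym mulK)|]; unfold graft, cells_pair; simpl; rewrite cells1_cons.
      apply paste_irr.
  - symmetry; unfold graft; simpl.
    etransitivity; [refine (paste_composes _ (t1f f) (t1f g) _ _ _ _
      (composes_cons2 (cid a) (lunit D) rho _ eq_refl eq_refl eq_refl (t1f 1) (t1f 1)
      (composes_cons1 (cid b) (cid b) eq_refl eq_refl eq_refl (t1f 1) (t1f 1)
      (composes_cids _))))|].
    rewrite paste_cid.
    replace (paste (cells_pair (cid a) (lunit D)) rho (t1f 1) (t1f 1)) with (cid a).
    + exact (paste_cids phi _ _).
    + etransitivity; [exact (eq_sym rhoK)|]; unfold graft, cells_pair; simpl; rewrite cells1_cons.
      etransitivity; [apply paste_irr|]; f_equal; apply cells_cons_irr. }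
transitivity (paste (cells_cons (top := a ::: b ::: qs) (ps := cnil) eq_refl sigma
    (cells_cons (ps := [: a]) (ps' := b ::: qs) eq_refl eps (cids (b ::: qs))))
  (paste (cells_cons (ps := [: a; lid D]) (ps' := b ::: qs) eq_refl rho
    (cells_cons (ps := [: b]) eq_refl (cid b) (cids qs))) phi (t1f f) (t1f g)) e0 en).
- rewrite <- H1; symmetry.
  etransitivity; [refine (paste_composes _ e0 en _ _ _ _
      (composes_cons1 sigma (cid a) eq_refl eq_refl eq_refl (t1f 1) (tf1 l)
      (composes_cons2 eps (cid b) mul eq_refl eq_refl eq_refl eq_refl (tf1 l) (tf1 1)
      (composes_cids _))))|].
  rewrite paste_cid; reflexivity.
- etransitivity; [refine (paste_composes _ e0 en _ _ _ _
      (composes_cons2 sigma eps rho eq_refl eq_refl eq_refl eq_refl (t1f 1) (t1f 1)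
      (composes_cons1 (cid b) (cid b) eq_refl eq_refl eq_refl (t1f 1) (t1f 1)
      (composes_cids _))))|].
  rewrite sigma_eps, paste_cid.
  exact (paste_cids phi _ _).
Qed.

End Zigzag.

End Absolute.

(** * Splittings of absolute cocones induced by the adjunction *)

Section Absolute.

Variable V : equipment.
Local Notation chain := (chain (@loose V)).
Implicit Types A B C D E W Y Z : ob V.

(** Since B(xf,g) is the restriction of B(f,g) along [x], the tight-cell [x] can be moved from the
    bottom to the left side. *)
Definition shift B Z Z' W (ps : chain Z' W) (x : tight Z' Z) (f : tight Z B) (g : tight W B)
    (xf : tight Z' B) (e : xf = x ;; f) (phi : cell ps (hom xf g) 1 1) : cell ps (hom f g) x 1 :=
  rfact (to_lid phi) e (t1f g).

Lemma paste_cells_nil A B0 B1 (q : loose B1 B0) (f : tight A B0) (g : tight A B1)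
    (phi : cell cnil q f g) e0 en :
  paste (cells_nil 1) phi e0 en = phi.
Proof. exact (paste_cids phi e0 en). Qed.

Section Split.

Variables (A E D : ob V) (j : tight A E) (r : tight D E) (l : left_adjoint j r).

(** The transposed unit of the adjunction. With the counit [to_lid (flat l)] it exhibits E(j,r) as
    D(l,1). *)
Definition adj_sigma : cell cnil (hom j r) 1 l :=
  rfact (to_lid (adj_eta l)) (t1f j) (eq_refl (l ;; r)).

Lemma adj_sigmaK :
  paste (cells1 adj_sigma) (hom_cart j r) (t1f j) (eq_refl (l ;; r)) = to_lid (adj_eta l).
Proof. apply rfactK. Qed.

Variables (C : ob V) (c : tight D C).

Definition adj_whisker : cell [: hom j r; hom c 1] (hom (l ;; c) 1) 1 1 :=
  hcomp (hom_post (flat l) (eq_refl (l ;; c)) (t1f c)) (cid (hom c 1)).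

Definition lid_act : cell [: lid D; hom c 1] (hom c 1) 1 1 :=
  of_lid (lid_comp (lid_map c) (hom_cart c 1)).

Lemma graft_lid_act : graft cnil (lunit D) [: hom c 1] lid_act = cid (hom c 1).
Proof.
apply to_lid_inj; unfold graft; rewrite to_lid_paste; unfold lid_act; rewrite of_lidK.
etransitivity; [|symmetry; apply to_lid_cid].
etransitivity; [|apply graft_lid_map_l]; apply paste_irr.
Qed.

(** This rewrites the canonical cell into C(lc,1) as the counit followed by the action of the
    loose-identity, the form required by [zigzag]. *)
Lemma shift_adj_whisker :
  shift (eq_refl (l ;; c)) adj_whisker =
  paste (cells_pair (to_lid (flat l)) (cid (hom c 1))) lid_act (tf1 l) (tf1 1).
Proof.
symmetry; apply (rfact_ext (e0 := eq_refl (l ;; c)) (en := t1f 1)).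
etransitivity; [apply (op_vcomp _ _ _ _ _ _ (eq_refl (l ;; c)) (t1f 1) (eq_refl (l ;; c)) (t1f
  1))|].
etransitivity; [|symmetry; apply rfactK].
etransitivity; [|exact (eq_sym (to_lid_hcomp
  (hom_post (flat l) (eq_refl (l ;; c)) (t1f c)) (cid (hom c 1))))].
rewrite to_lid_post, to_lid_cid.
rewrite <- (paste_cid1 (hom_cart c 1) (t1f c) (t1f 1)) at 2.
symmetry; exact (lid_comp_paste1 (to_lid (flat l)) (cid (hom c 1)) (lid_map c) (hom_cart c 1)
  (eq_refl (l ;; c)) (t1f c) (t1f c) (t1f 1)).
Qed.

Lemma adj_zigzag An B0 Bn (qs : chain C An) (s : loose Bn B0) (f : tight A B0) (g : tight An Bn)
    (phi : cell (hom j r ::: hom c 1 ::: qs) s f g) e0 en :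
  paste (cells_cons (top := hom j r ::: hom c 1 ::: qs) (ps := cnil) eq_refl adj_sigma
    (cells_cons (ps := [: hom j r; hom c 1]) eq_refl
      (shift (eq_refl (l ;; c)) adj_whisker) (cids qs))) phi e0 en = phi.
Proof.
rewrite shift_adj_whisker.
apply zigzag with (rho := of_lid (lid_comp (hom_cart j r) (lid_map r))).
- apply to_lid_inj; unfold graft; rewrite to_lid_paste, of_lidK.
  etransitivity; [|symmetry; apply to_lid_cid].
  etransitivity; [|apply graft_lid_map_r]; apply paste_irr.
- apply graft_lid_act.
- apply to_lid_inj; rewrite to_lid_paste, of_lidK.
  rewrite <- (lid_comp_paste1 _ _ _ _ _ (eq_refl (l ;; r)) (eq_refl (l ;; r)) _).
  rewrite adj_sigmaK.
  (* In this form the triangle law required by [zigzag] is the unit law of the algebra carried by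
     [r]. *)
  change (lid_comp (to_lid (adj_eta l)) (lid_post (to_lid (flat l)) (eq_refl (l ;; r)) (t1f r)) =
    to_lid (cid (hom j r))).
  rewrite <- to_lid_post, <- to_lid_hcomp, <- (vcomp_hcomp (adj_eta l)).
  f_equal; exact (adj_act_unit l).
Qed.

Variables (e : tight C E) (lam : cell [: hom c 1] (hom r e) 1 1).

Let theta : cell [: hom j r; hom c 1] (hom j e) 1 1 := hcomp (cid (hom j r)) lam.

(* tau is the part over C(c,1) of an inverse E(j,e) => D(l,1), C(c,1) => E(j,r), C(c,1) of theta. *)
Definition splits (tau : cell [: hom j e] (hom c 1) l 1) : Prop :=
  paste (cells_pair adj_sigma tau) theta (t1f 1) (t1f 1) = cid (hom j e).

(** After transposing [tau] to a cell from E(j,e) to C(lc,1), this says that [theta] followed by it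
    is [adj_whisker]. Through [adj_zigzag] it supplies the other inverse law. *)
Definition extends_whisker (tau : cell [: hom j e] (hom c 1) l 1) : Prop :=
  paste (cells1 theta) tau (t1f l) (t1f 1) = shift (eq_refl (l ;; c)) adj_whisker.

(** Factorization through [theta] is pasting with [adj_sigma] and [tau]. Existence reduces to
    [adj_zigzag] by [extends_whisker], and uniqueness is [splits]. *)
Lemma absolute_of_split (tau : cell [: hom j e] (hom c 1) l 1) :
  splits tau -> extends_whisker tau -> absolute j lam.
Proof.
intros H1 H2 An B0 Bn qs s g0 gn phi.
exists (paste (cells_cons (top := hom j e ::: qs) (ps := cnil) eq_refl adj_sigma
   (cells_cons (ps := [: hom j e]) eq_refl tau (cids qs))) phi (t1f g0) (t1f gn)); split.
- unfold graft; simpl.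
  etransitivity; [refine (paste_composes _ (t1f g0) (t1f gn) _ _ _ _
    (composes_cons0 adj_sigma eq_refl eq_refl (t1f 1) (t1f _)
    (composes_cons1 theta tau eq_refl eq_refl eq_refl (t1f l) (t1f 1)
    (composes_cids _))))|].
  rewrite paste_cells_nil, H2; apply adj_zigzag.
- intros psi <-; unfold graft; simpl.
  etransitivity; [refine (paste_composes _ (t1f g0) (t1f gn) _ _ _ _
    (composes_cons2 adj_sigma tau theta eq_refl eq_refl eq_refl eq_refl (t1f 1) (t1f 1)
    (composes_cids _)))|].
  rewrite H1; exact (paste_cids psi _ _).
Qed.

Lemma split_of_absolute :
  absolute j lam -> exists tau, splits tau /\ extends_whisker tau.
Proof.
intros H.
destruct (H _ _ _ cnil _ _ _ (shift (eq_refl (l ;; c)) adj_whisker)) as [tau [Ht _]].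
exists tau.
assert (H2 : extends_whisker tau).
{ unfold extends_whisker; rewrite <- Ht; unfold graft; simpl.
  rewrite cells1_cons; apply paste_irr. }
split; [|exact H2].
(* Both sides of [splits] are factorizations of [theta] through itself, so uniqueness identifies
   them. *)
destruct (H _ _ _ cnil _ _ _ theta) as [u [_ Hu]].
transitivity u; [symmetry|]; apply Hu.
- unfold graft; simpl; rewrite cells1_cons.
  etransitivity; [refine (paste_composes _ (t1f 1) (t1f 1) _ _ _ _
    (composes_cons0 adj_sigma eq_refl eq_refl (t1f 1) (t1f _)
    (composes_cons1 theta tau (capp_nil _) (capp_nil _) (capp_nil _) (t1f l) (t1f 1)
    (composes_cids _))))|].
  rewrite paste_cells_nil, H2.
  etransitivity; [|apply (@adj_zigzag _ _ _ cnil _ _ _ theta (t1f 1) (t1f 1))].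
  simpl; f_equal; f_equal; apply cells_cons_irr.
- unfold graft; simpl; rewrite cells1_cons; exact (paste_cid theta _ _).
Qed.

Lemma split_cancel (tau : cell [: hom j e] (hom c 1) l 1) An B0 Bn (qs : chain C An)
    (s : loose Bn B0) (f : tight A B0) (g : tight An Bn) (phi psi : cell (hom j e ::: qs) s f g) :
  splits tau -> graft cnil theta qs phi = graft cnil theta qs psi -> phi = psi.
Proof.
intros H1.
assert (H : forall phi : cell (hom j e ::: qs) s f g,
  paste (cells_cons (top := hom j e ::: qs) (ps := cnil) eq_refl adj_sigma
   (cells_cons (ps := [: hom j e]) eq_refl tau (cids qs))) (graft cnil theta qs phi)
   (t1f f) (t1f g) = phi).
{ clear phi psi; intros phi; unfold graft; simpl.
  etransitivity; [refine (paste_composes _ (t1f f) (t1f g) _ _ _ _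
    (composes_cons2 adj_sigma tau theta eq_refl eq_refl eq_refl eq_refl (t1f 1) (t1f 1)
    (composes_cids _)))|].
  rewrite H1; exact (paste_cids phi _ _). }
intros G; rewrite <- (H phi), G; apply H.
Qed.

(** A section of [theta] allows cancellation also behind a loose-cell [p] on the left, a position
    that the definition of absoluteness does not cover. *)
Lemma split_cancel2 (tau : cell [: hom j e] (hom c 1) l 1) A0 B0 Bn (p : loose A A0)
    (s : loose Bn B0) (f : tight A0 B0) (g : tight C Bn) (phi psi : cell [: p; hom j e] s f g) :
  splits tau ->
  paste (cells_pair (cid p) theta) phi (t1f f) (t1f g) =
  paste (cells_pair (cid p) theta) psi (t1f f) (t1f g) -> phi = psi.
Proof.
intros H1.
assert (H : forall phi : cell [: p; hom j e] s f g,
  paste (cells_cons (top := [: p; hom j e]) (ps := [: p]) eq_refl (cid p)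
   (cells_cons (ps := cnil) eq_refl adj_sigma
   (cells1 tau))) (paste (cells_pair (cid p) theta) phi (t1f f) (t1f g))
   (t1f f) (t1f g) = phi).
{ clear phi psi; intros phi; simpl.
  etransitivity; [refine (paste_composes _ (t1f f) (t1f g) _ _ _ _
    (composes_cons1 (cid p) (cid p) eq_refl eq_refl eq_refl (t1f 1) (t1f 1)
    (composes_cons2 adj_sigma tau theta eq_refl _ (capp_nil _) (capp_nil _) (t1f 1) (t1f 1)
    (composes_nil (t1f 1)))))|].
  rewrite H1, paste_cid; exact (paste_pair_cid phi _ _). }
intros G; rewrite <- (H phi), G; apply H.
Qed.

End Split.

End Absolute.

(** * Colimits and density *)

Section Colimits.

Variable V : equipment.
Local Notation chain := (chain (@loose V)).
Implicit Types A B C D E W X Y Z : ob V.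

Lemma paste_eq A0 An B0 Bn C0 Cn (ps : chain A0 An) (qs : chain B0 Bn)
    (r : loose Cn C0) (f0 : tight A0 B0) (fn : tight An Bn)
    (g0 : tight B0 C0) (gn : tight Bn Cn) (h0 : tight A0 C0) (hn : tight An Cn)
    (Phi Phi' : cells ps qs f0 fn) (psi psi' : cell qs r g0 gn) (e0 : h0 = f0 ;; g0)
    (en : hn = fn ;; gn) :
  Phi = Phi' -> psi = psi' -> paste Phi psi e0 en = paste Phi' psi' e0 en.
Proof. congruence. Qed.

Lemma hcompA B Z0 Z1 Z2 Z3 (f : tight Z0 B) (g : tight Z1 B) (h : tight Z2 B) (i : tight Z3 B)
    (ps : chain Z0 Z1) (qs : chain Z1 Z2) (rs : chain Z2 Z3) (phi : cell ps (hom f g) 1 1)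
    (psi : cell qs (hom g h) 1 1) (chi : cell rs (hom h i) 1 1) (e : ps +++ qs +++ rs = (ps +++ qs)
      +++ rs) :
  hcomp (hcomp phi psi) chi = ccast e (hcomp phi (hcomp psi chi)).
Proof.
apply to_lid_inj.
assert (H : forall ps' qs' (e : ps' = qs') (alpha : cell ps' (hom f i) 1 1),
  to_lid (ccast e alpha) = ccast e (to_lid alpha)) by (intros ps' qs' []; reflexivity).
rewrite H, !to_lid_hcomp, lid_compA; f_equal; apply proof_irrelevance.
Qed.

Lemma hcomp_paste B Z0 Z1 Z2 (f : tight Z0 B) (g : tight Z1 B) (h : tight Z2 B)
    (ps qs : chain Z0 Z1) (ps' qs' : chain Z1 Z2) (Phi : cells ps qs 1 1) (Phi' : cells ps' qs' 1 1)
    (phi : cell qs (hom f g) 1 1) (psi : cell qs' (hom g h) 1 1) e0 e1 e2 e3 c0 c1 :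
  hcomp (paste Phi phi e0 e1) (paste Phi' psi e2 e3) =
  paste (cells_app Phi Phi') (hcomp phi psi) c0 c1.
Proof.
unfold hcomp at 2; apply paste_paste2.
Qed.

Lemma hcomp_graft_l B Z0 Z1 Z2 (f : tight Z0 B) (g : tight Z1 B) (h : tight Z2 B)
    (ps : chain Z0 Z1) (q : loose Z1 Z0) (qs : chain Z1 Z2) (alpha : cell ps q 1 1)
    (phi : cell [: q] (hom f g) 1 1) (psi : cell qs (hom g h) 1 1) :
  hcomp (vcomp alpha phi) psi = graft cnil alpha qs (hcomp phi psi).
Proof.
unfold graft; simpl; rewrite <- cells_app_single.
etransitivity; [|refine (hcomp_paste (cells1 alpha) (cids qs) phi psi (t1f _) (t1f _) (t1f _) (t1f
  _) _ _)].
rewrite paste_cids; reflexivity.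
Qed.

Lemma graft_hcomp_cid B Z0 Z1 Z2 (f : tight Z0 B) (g : tight Z1 B) (h : tight Z2 B)
    (ps : chain Z0 Z1) (qs : chain Z1 Z2) (phi : cell ps (hom f g) 1 1)
    (psi : cell qs (hom g h) 1 1) :
  graft cnil phi qs (hcomp (cid (hom f g)) psi) = hcomp phi psi.
Proof. rewrite <- hcomp_graft_l, vcomp_cid; reflexivity. Qed.

Lemma lid_comp_unr_cast A0 An B (ps : chain A0 An) (f : tight A0 B) (g : tight An B)
    (phi : cell ps (lid B) f g) : lid_comp phi (lid_id g) = ccast (capp_nil ps) phi.
Proof.
rewrite <- (paste_cid phi (tf1 f) (tf1 g)) at 1.
unfold lid_id; rewrite (lid_comp_paste _ _ _ _ (tf1 f) (tf1 g) (tf1 g) (tf1 g)).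
change (lid_comp (cid (lid B)) (lunit B)) with
  (paste (h0 := 1) (hn := 1) (cells_pair (cid (lid B)) (lunit B)) (lmult B) (tf1 1) (tf1 1)).
rewrite (paste_irr _ _ _ (t1f 1) _ (t1f 1)), lmultr_lid, cells_app_single.
etransitivity; [|refine (f_equal _ (paste_cid phi (tf1 f) (tf1 g)))].
symmetry; apply paste_ccast.
Qed.

Lemma hcomp_idr B Z W (f : tight Z B) (g : tight W B) (ps : chain Z W)
    (phi : cell ps (hom f g) 1 1) (e : ps = ps +++ cnil) :
  hcomp phi (hom_id g) = ccast e phi.
Proof.
apply to_lid_inj; rewrite to_lid_hcomp, to_lid_id, lid_comp_unr_cast.
assert (H : forall ps' qs' (e : ps' = qs') (alpha : cell ps' (hom f g) 1 1),
  to_lid (ccast e alpha) = ccast e (to_lid alpha)) by (intros ps' qs' []; reflexivity).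
rewrite H; f_equal; apply proof_irrelevance.
Qed.

(** * Units of the companion and of the conjoint of a tight-cell *)

Section Companion.

Variables (W E : ob V) (u : tight W E).

Definition comp_unit : cell cnil (hom 1 u) u 1 := rfact (lid_id u) (tf1 u) (t1f u).

Lemma comp_unitK : paste (cells1 comp_unit) (hom_cart 1 u) (tf1 u) (t1f u) = lid_id u.
Proof. apply rfactK. Qed.

Definition conj_unit : cell cnil (hom u 1) 1 u := rfact (lid_id u) (t1f u) (tf1 u).

Lemma conj_unitK : paste (cells1 conj_unit) (hom_cart u 1) (t1f u) (tf1 u) = lid_id u.
Proof. apply rfactK. Qed.

(** E(j,u) behaves as the composite of E(j,1) and E(1,u): splitting it by the companion unit and
    composing again changes nothing. *)
Lemma companion A (j : tight A E) :
  paste (cells_pair (hom_along j (tf1 u)) comp_unit) (hcomp (cid (hom j 1)) (cid (hom 1 u)))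
    (t1f 1) (t1f 1) = cid (hom j u).
Proof.
apply to_lid_inj.
etransitivity; [apply to_lid_paste|].
rw_to_lid_hcomp; rewrite !to_lid_cid.
rewrite <- (lid_comp_paste1 _ _ _ _ (t1f _) (tf1 _) (tf1 _) (t1f _)), op_along, comp_unitK.
etransitivity; [apply lid_comp_unr|symmetry; apply to_lid_cid].
Qed.

Definition add_conj B (qs : chain B W) : cells qs (qs +++ [: hom u 1]) 1 u :=
  cells_cast (eq_sym (capp_nil qs)) eq_refl (cells_app (cids qs) (cells1 conj_unit)).

Lemma add_conj_cons A B (p : loose B A) (qs : chain B W) :
  add_conj (p ::: qs) = cells_cons (top := p ::: qs) (ps := [: p]) eq_refl (cid p) (add_conj qs).
Proof.
assert (H : forall qs' (Phi : cells qs' (qs +++ [: hom u 1]) 1 u) (e : qs' = qs)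
  (e' : p ::: qs' = p ::: qs) (e'' : p ::: qs' = [: p] +++ qs'),
  cells_cast e' (eq_refl (x := p ::: qs +++ [: hom u 1])) (cells_cons (ps := [: p]) (ps' := qs')
    e'' (cid p) Phi) =
  cells_cons (top := p ::: qs) (ps := [: p]) (ps' := qs) eq_refl (cid p) (cells_cast e eq_refl
    Phi)).
{ intros qs' Phi e e' e''; destruct e.
  rewrite (cells_cast_id e' eq_refl); apply cells_cons_irr. }
apply H.
Qed.

(** The conjoint unit followed by the cartesian cell of E(u,1) is a unit for composition. Hence
    [phi] is recovered from its composite with that cell. *)
Lemma paste_add_conj B (qs : chain B W) (f : tight B E) (phi : cell qs (lid E) f u) e0 en :
  paste (add_conj qs) (lid_comp phi (hom_cart u 1)) e0 en = phi.
Proof.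
transitivity (ccast (eq_sym (capp_nil qs)) (lid_comp phi (lid_id u))).
- assert (K := lid_comp_paste (cids qs) (cells1 conj_unit) phi (hom_cart u 1) (t1f f) (t1f u) (t1f
  u) (tf1 u)).
  rewrite paste_cids, conj_unitK in K; rewrite K; unfold add_conj.
  generalize (cells_app (cids qs) (cells1 conj_unit)).
  generalize (eq_sym (capp_nil qs)); rewrite <- (capp_nil qs).
  intros e Phi; rewrite ccast_id, cells_cast_id; apply paste_irr.
- rewrite lid_comp_unr_cast; generalize (capp_nil qs); generalize (qs +++ cnil).
  intros c e; subst c; reflexivity.
Qed.

End Companion.

(* The universal property is extended from the target 1 to a target g by appending Z(g,1) to the
   chain. *)
Lemma colimit_hom X Y Z W (p : loose X Y) (f : tight Y Z) (c : tight X Z)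
    (lam : cell [: p] (hom f c) 1 1) (g : tight W Z) (qs : chain X W)
    (psi : cell (p ::: qs) (hom f g) 1 1) :
  is_colimit lam -> exists! phi : cell qs (hom c g) 1 1, hcomp lam phi = psi.
Proof.
intros H.
destruct (H (qs +++ [: hom g 1]) (hcomp psi (cid (hom g 1)))) as [phi [H1 H2]].
exists (of_lid (paste (add_conj g qs) (to_lid phi) (t1f c) (tf1 g))); split.
- apply to_lid_inj; etransitivity; [apply to_lid_hcomp|]; rewrite of_lidK.
  rewrite <- (paste_cid1 (to_lid lam) (t1f _) (t1f _)).
  etransitivity; [refine (lid_comp_paste (cells1 (cid p)) (add_conj g qs) (to_lid lam) (to_lid phi)
    _ _ _ _)|].
  rewrite cells_app_single.
  etransitivity; [eapply paste_eq; [exact (eq_sym (add_conj_cons g p qs))|]|].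
  { etransitivity; [exact (eq_sym (to_lid_hcomp lam phi))|]; rewrite H1.
    etransitivity; [exact (to_lid_hcomp psi (cid (hom g 1)))|]; rewrite to_lid_cid; reflexivity. }
  apply (paste_add_conj (to_lid psi)).
- intros phi' H3.
  apply to_lid_inj; rewrite of_lidK.
  rewrite (H2 (hcomp phi' (cid (hom g 1)))).
  + rewrite to_lid_hcomp, to_lid_cid; apply paste_add_conj.
  + rewrite <- H3; symmetry.
    etransitivity; [apply (hcompA (ps := [: p]) (qs := qs) (rs := [: hom g 1]) _ _ _
      eq_refl)|reflexivity].
Qed.

(** Density applies to chains that start with E(1,u). The cell [kappa] merges E(j,1) and E(1,u) into
    E(j,u), and the companion unit removes E(1,u) from the cell obtained. *)
Lemma dense_colimit A E W (j : tight A E) (u : tight W E) :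
  dense j -> is_colimit (cid (hom j u)).
Proof.
intros H qs psi.
pose (kappa := hcomp (cid (hom j 1)) (cid (hom 1 u)) : cell [: hom j 1; hom 1 u] (hom j u) 1 1).
destruct (H (hom 1 u ::: qs) (graft cnil kappa qs psi)) as [phi [H1 H2]].
pose (Phi := cells_cons (top := qs) (ps := cnil) eq_refl (comp_unit u) (cids qs)).
exists (of_lid (paste Phi (to_lid phi) (tf1 u) (t1f 1))); split.
- apply to_lid_inj; etransitivity; [apply to_lid_hcomp|]; rewrite of_lidK, to_lid_cid.
  rewrite <- (op_along (tf1 u) (t1f j) (tf1 u)).
  etransitivity; [refine (lid_comp_paste (cells1 (hom_along j (tf1 u))) Phi (hom_cart j 1) (to_lid
    phi) _ _ _ _)|].
  rewrite cells_app_single.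
  etransitivity; [eapply paste_eq; [reflexivity|]|].
  { rewrite <- to_lid_cid; etransitivity; [exact (eq_sym (to_lid_hcomp (cid (hom j 1)) phi))|].
    rewrite H1; unfold graft; simpl; apply to_lid_paste. }
  etransitivity; [refine (paste_composes _ (t1f j) (t1f 1) _ _ _ _
    (composes_cons2 (hom_along j (tf1 u)) (comp_unit u) kappa eq_refl eq_refl eq_refl eq_refl
      (t1f 1) (t1f 1) (composes_cids _)))|].
  unfold kappa; rewrite companion; exact (paste_cids (to_lid psi) _ _).
- intros phi' H3.
  apply to_lid_inj; rewrite of_lidK.
  rewrite (H2 (hcomp (cid (hom 1 u)) phi')).
  + rw_to_lid_hcomp; rewrite to_lid_cid.
    assert (K := lid_comp_paste (cells1 (comp_unit u)) (cids qs) (hom_cart 1 u) (to_lid phi')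
      (tf1 u) (t1f u) (t1f u) (t1f 1)).
    rewrite paste_cids, comp_unitK, lid_comp_unl, cells_app_single in K; symmetry; exact K.
  + rewrite <- H3; symmetry.
    etransitivity; [exact (graft_hcomp_cid kappa phi')|].
    etransitivity; [apply (hcompA (ps := [: hom j 1]) (qs := [: hom 1 u]) (rs := qs) _ _ _
      eq_refl)|reflexivity].
Qed.

(** A cocone is first composed with E(j,f) and factored by absoluteness through E(j,c); density at
    [c] then strips E(j,c) from the factor. *)
Lemma colimit_of_absolute A E (j : tight A E) X Y (p : loose X Y) (f : tight Y E) (c : tight X E)
    (lam : cell [: p] (hom f c) 1 1) :
  dense j -> absolute j lam -> is_colimit lam.
Proof.
intros Hj H qs psi.
destruct (H _ _ _ qs _ _ _ (hcomp (cid (hom j f)) psi)) as [chi [H1 H2]].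
destruct (dense_colimit (u := c) Hj chi) as [phi [H3 H4]].
assert (K : forall phi : cell qs (hom c 1) 1 1,
  graft cnil (hcomp (cid (hom j f)) lam) qs (hcomp (cid (hom j c)) phi) =
  hcomp (cid (hom j f)) (hcomp lam phi)).
{ clear; intros phi.
  etransitivity; [exact (graft_hcomp_cid (hcomp (cid (hom j f)) lam) phi)|].
  etransitivity; [apply (hcompA (ps := [: hom j f]) (qs := [: p]) (rs := qs) _ _ _
    eq_refl)|reflexivity]. }
exists phi; split.
(* Density at [f] enters through uniqueness: cells agree once their composites with E(j,f) agree. *)
- destruct (dense_colimit (u := f) Hj (hcomp (cid (hom j f)) psi)) as [psi' [_ H5]].
  rewrite <- (H5 psi) by reflexivity; symmetry; apply H5.
  rewrite <- H1, <- H3; symmetry; apply K.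
- intros phi' H5; apply H4, eq_sym, H2.
  rewrite <- H5; apply K.
Qed.

Definition iso2 B Z (f g : tight Z B) (a : cell cnil (hom f g) 1 1) : Prop :=
  exists b : cell cnil (hom g f) 1 1, hcomp a b = hom_id f /\ hcomp b a = hom_id g.

Lemma colimit_hcomp_iso X Y Z (p : loose X Y) (f : tight Y Z) (c c' : tight X Z)
    (lam : cell [: p] (hom f c) 1 1) (a : cell cnil (hom c c') 1 1) :
  is_colimit lam -> iso2 a -> is_colimit (hcomp lam a : cell [: p] (hom f c') 1 1).
Proof.
intros H [b [ab ba]] qs psi.
assert (K : forall phi : cell qs (hom c' 1) 1 1,
  hcomp (hcomp lam a : cell [: p] (hom f c') 1 1) phi = hcomp lam (hcomp a phi)).
{ intros phi; apply (hcompA (ps := [: p]) (qs := cnil) (rs := qs) _ _ _ eq_refl). }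
assert (L : forall (c c' : tight X Z) (a : cell cnil (hom c c') 1 1) (b : cell cnil (hom c' c) 1 1)
  (phi : cell qs (hom c 1) 1 1), hcomp a b = hom_id c -> hcomp a (hcomp b phi) = phi).
{ clear; intros c c' a b phi ab; rewrite <- (hcomp_idl phi) at 2; rewrite <- ab.
  symmetry; apply (hcompA (ps := cnil) (qs := cnil) (rs := qs) _ _ _ eq_refl). }
destruct (H qs psi) as [phi [H1 H2]].
exists (hcomp b phi); split.
- rewrite K, L; assumption.
- intros phi' H3; rewrite K in H3; rewrite (H2 _ H3); apply L; assumption.
Qed.

Lemma colimit_unique X Y Z (p : loose X Y) (f : tight Y Z) (c c' : tight X Z)
    (lam : cell [: p] (hom f c) 1 1) (lam' : cell [: p] (hom f c') 1 1) :
  is_colimit lam -> is_colimit lam' -> exists a, iso2 a /\ hcomp lam a = lam'.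
Proof.
assert (K : forall (c c' c'' : tight X Z) (lam : cell [: p] (hom f c) 1 1)
   (lam' : cell [: p] (hom f c') 1 1) (lam'' : cell [: p] (hom f c'') 1 1) a b,
   hcomp lam a = lam' -> hcomp lam' b = lam'' -> hcomp lam (hcomp a b) = lam'').
{ intros d d' d'' k k' k'' a b <- <-; symmetry.
  apply (hcompA (ps := [: p]) (qs := cnil) (rs := cnil) _ _ _ eq_refl). }
assert (L : forall (c c' : tight X Z) (lam : cell [: p] (hom f c) 1 1)
   (lam' : cell [: p] (hom f c') 1 1) a b, is_colimit lam ->
   hcomp lam a = lam' -> hcomp lam' b = lam -> hcomp a b = hom_id c).
{ intros d d' k k' a b Hk H1 H2.
  destruct (colimit_hom k Hk) as [i [_ Hi]].
  transitivity i; [symmetry|]; apply Hi.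
  - exact (K _ _ _ _ _ _ _ _ H1 H2).
  - apply (hcomp_idr _ eq_refl). }
intros H H'.
destruct (colimit_hom lam' H) as [a [Ha _]], (colimit_hom lam H') as [b [Hb _]].
exists a; split; [exists b; split|]; [eapply L|eapply L|]; eassumption.
Qed.

End Colimits.

(** * Whiskering and equivalences *)

Section Whiskering.

Variable V : equipment.
Local Notation chain := (chain (@loose V)).
Implicit Types A B C D E W X Y Z : ob V.

(** Composition with a 2-cell on the right that keeps the top chain [ps]; [hcomp phi a] has top
    [ps +++ cnil], which is not convertible to [ps] for variable [ps]. *)
Definition rcomp B Z W (ps : chain Z W) (f : tight Z B) (g h : tight W B)
    (phi : cell ps (hom f g) 1 1) (a : cell cnil (hom g h) 1 1) : cell ps (hom f h) 1 1 :=
  vcomp phi (hcomp (cid (hom f g)) a : cell [: hom f g] (hom f h) 1 1).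

Lemma rcomp_cast B Z W (ps : chain Z W) (f : tight Z B) (g h : tight W B)
    (phi : cell ps (hom f g) 1 1) (a : cell cnil (hom g h) 1 1) (e : ps +++ cnil = ps) :
  rcomp phi a = ccast e (hcomp phi a).
Proof.
assert (H := hcomp_paste (cells1 phi) (cells_nil 1) (cid (hom f g)) a
  (t1f _) (t1f _) (t1f _) (t1f _) (t1f _) (t1f _)).
rewrite cells_app_single in H.
assert (H1 : paste (cells_nil 1) a (t1f 1) (t1f 1) = a) by apply paste_cells_nil.
assert (H2 : paste (cells1 phi) (cid (hom f g)) (t1f 1) (t1f 1) = phi) by apply paste_cid.
rewrite H1, H2 in H; rewrite H; symmetry; apply paste_ccast.
Qed.

Lemma rcomp1 B Z W (p : loose W Z) (f : tight Z B) (g h : tight W B)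
    (phi : cell [: p] (hom f g) 1 1) (a : cell cnil (hom g h) 1 1) :
  rcomp phi a = hcomp phi a.
Proof. exact (rcomp_cast phi a eq_refl). Qed.

Lemma rcomp0 B Z (f g h : tight Z B)
    (phi : cell cnil (hom f g) 1 1) (a : cell cnil (hom g h) 1 1) :
  rcomp phi a = hcomp phi a.
Proof. exact (rcomp_cast phi a eq_refl). Qed.

Lemma vcomp_rcomp B Z W (ps : chain Z W) (p : loose W Z) (f : tight Z B) (g h : tight W B)
    (alpha : cell ps p 1 1) (phi : cell [: p] (hom f g) 1 1) (a : cell cnil (hom g h) 1 1) :
  vcomp alpha (rcomp phi a) = rcomp (vcomp alpha phi) a.
Proof. symmetry; apply vcompA. Qed.

Lemma hcomp_ccast B Z W Y (ps ps' : chain Z W) (qs : chain W Y) (f : tight Z B) (g : tight W B)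
    (h : tight Y B) (phi : cell ps (hom f g) 1 1) (psi : cell qs (hom g h) 1 1) (e : ps = ps') e' :
  hcomp (ccast e phi) psi = ccast e' (hcomp phi psi).
Proof. destruct e; symmetry; apply ccast_id. Qed.

Lemma hcomp_ccast_r B Z W Y (ps : chain Z W) (qs qs' : chain W Y) (f : tight Z B) (g : tight W B)
    (h : tight Y B) (phi : cell ps (hom f g) 1 1) (psi : cell qs (hom g h) 1 1) (e : qs = qs') e' :
  hcomp phi (ccast e psi) = ccast e' (hcomp phi psi).
Proof. destruct e; symmetry; apply ccast_id. Qed.

Lemma ccast_ccast A0 An B0 Bn (ps ps' ps'' : chain A0 An) (q : loose Bn B0) (f : tight A0 B0)
    (g : tight An Bn) (e : ps = ps') (e' : ps' = ps'') e'' (phi : cell ps q f g) :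
  ccast e' (ccast e phi) = ccast e'' phi.
Proof. destruct e'; destruct e; symmetry; apply ccast_id. Qed.

Lemma rcomp_rcomp B Z W (ps : chain Z W) (f : tight Z B) (g h i : tight W B)
    (phi : cell ps (hom f g) 1 1) (a : cell cnil (hom g h) 1 1) (b : cell cnil (hom h i) 1 1) :
  rcomp (rcomp phi a) b = rcomp phi (hcomp a b).
Proof.
pose (e := eq_sym (capp_nil ps)).
rewrite !(rcomp_cast _ _ e).
rewrite (hcomp_ccast _ _ _ (f_equal (fun c => c +++ cnil) e)).
rewrite (hcompA _ _ _ (eq_sym (cappA ps cnil cnil))).
exact (f_equal (ccast e) (ccast_ccast _ _ eq_refl _)).
Qed.

Lemma rcomp_id B Z W (ps : chain Z W) (f : tight Z B) (g : tight W B)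
    (phi : cell ps (hom f g) 1 1) :
  rcomp phi (hom_id g) = phi.
Proof.
rewrite (rcomp_cast _ _ (eq_sym (capp_nil ps))), (hcomp_idr phi (capp_nil ps)).
exact (ccast_ccast _ _ eq_refl _).
Qed.

Lemma hcomp_rcomp B Z W Y (ps : chain Z W) (qs : chain W Y) (f : tight Z B) (g : tight W B)
    (h i : tight Y B) (phi : cell ps (hom f g) 1 1) (psi : cell qs (hom g h) 1 1)
    (a : cell cnil (hom h i) 1 1) :
  hcomp phi (rcomp psi a) = rcomp (hcomp phi psi) a.
Proof.
rewrite (rcomp_cast _ _ (eq_sym (capp_nil qs))), (rcomp_cast _ _ (eq_sym (capp_nil (ps +++ qs)))).
rewrite (hcompA _ _ _ (eq_sym (cappA ps qs cnil))).
rewrite (hcomp_ccast_r _ _ _ (f_equal (fun c => ps +++ c) (eq_sym (capp_nil qs)))).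
symmetry; apply ccast_ccast.
Qed.

Lemma hom_post_rcomp B C Z W (k : tight B C) (ps : chain Z W) (f : tight Z B) (g h : tight W B)
    (phi : cell ps (hom f g) 1 1) (a : cell cnil (hom g h) 1 1)
    (fk : tight Z C) (gk hk : tight W C) (ef : fk = f ;; k) (eg : gk = g ;; k) (eh : hk = h ;; k) :
  hom_post (rcomp phi a) ef eh = rcomp (hom_post phi ef eg) (hom_post a eg eh).
Proof.
rewrite !(rcomp_cast _ _ (eq_sym (capp_nil ps))), <- (hom_post_comp _ _ ef eg eh).
generalize (eq_sym (capp_nil ps)) (hcomp phi a); generalize (ps +++ cnil).
intros ps' e alpha; destruct e; reflexivity.
Qed.

Lemma rcomp_iso_inj B Z W (ps : chain Z W) (f : tight Z B) (g h : tight W B)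
    (phi psi : cell ps (hom f g) 1 1) (a : cell cnil (hom g h) 1 1) :
  iso2 a -> rcomp phi a = rcomp psi a -> phi = psi.
Proof.
intros [b [ab _]] H.
rewrite <- (rcomp_id phi), <- ab, <- rcomp_rcomp, H, rcomp_rcomp, ab; apply rcomp_id.
Qed.

Lemma hcomp_iso_inj B Z W (ps : chain Z W) (f h : tight Z B) (g : tight W B)
    (phi psi : cell ps (hom f g) 1 1) (a : cell cnil (hom h f) 1 1) :
  iso2 a -> hcomp a phi = hcomp a psi -> phi = psi.
Proof.
intros [b [_ ba]] H.
rewrite <- (hcomp_idl phi), <- (hcomp_idl psi), <- ba.
etransitivity; [apply (hcompA (ps := cnil) (qs := cnil) (rs := ps) _ _ _ eq_refl)|].
etransitivity; [|symmetry; apply (hcompA (ps := cnil) (qs := cnil) (rs := ps) _ _ _ eq_refl)].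
simpl; rewrite H; reflexivity.
Qed.

Lemma iso2_sym B Z (f g : tight Z B) (a : cell cnil (hom f g) 1 1) :
  iso2 a -> exists b, iso2 b /\ hcomp a b = hom_id f /\ hcomp b a = hom_id g.
Proof. intros [b [H1 H2]]; exists b; repeat split; trivial; exists a; auto. Qed.

Definition whisker B Z Y (x : tight Y Z) (f g : tight Z B) (xf xg : tight Y B)
    (ef : xf = x ;; f) (eg : xg = x ;; g) (a : cell cnil (hom f g) 1 1) :
    cell cnil (hom xf xg) 1 1 :=
  of_lid (paste (cells_nil x) (to_lid a) ef eg).

Lemma whisker_hcomp B Z Y (x : tight Y Z) (f g h : tight Z B) (xf xg xh : tight Y B)
    (ef : xf = x ;; f) (eg : xg = x ;; g) (eh : xh = x ;; h)
    (a : cell cnil (hom f g) 1 1) (b : cell cnil (hom g h) 1 1) :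
  whisker ef eh (hcomp a b) = hcomp (whisker ef eg a) (whisker eg eh b).
Proof.
apply to_lid_inj; rw (to_lid_hcomp (whisker ef eg a) (whisker eg eh b)).
unfold whisker; rewrite !of_lidK, lid_comp_paste.
eapply paste_eq; [reflexivity|exact (to_lid_hcomp a b)].
Qed.

Lemma whisker_id B Z Y (x : tight Y Z) (f : tight Z B) (xf : tight Y B) (ef ef' : xf = x ;; f) :
  whisker ef ef' (hom_id f) = hom_id xf.
Proof.
apply to_lid_inj; unfold whisker; rewrite of_lidK, !to_lid_id.
apply paste_composes, composes_nil; exact ef.
Qed.

Lemma whisker_iso B Z Y (x : tight Y Z) (f g : tight Z B) (xf xg : tight Y B)
    (ef : xf = x ;; f) (eg : xg = x ;; g) (a : cell cnil (hom f g) 1 1) :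
  iso2 a -> iso2 (whisker ef eg a).
Proof.
intros [b [ab ba]]; exists (whisker eg ef b).
rewrite <- !whisker_hcomp, ab, ba; split; apply whisker_id.
Qed.

Lemma hom_post_iso B C Z (k : tight B C) (f g : tight Z B) (fk gk : tight Z C)
    (ef : fk = f ;; k) (eg : gk = g ;; k) (a : cell cnil (hom f g) 1 1) :
  iso2 a -> iso2 (hom_post a ef eg).
Proof.
intros [b [ab ba]]; exists (hom_post b eg ef); split.
- etransitivity; [exact (eq_sym (hom_post_comp a b ef eg ef))|].
  transitivity (hom_post (hom_id f) ef ef); [rewrite <- ab; reflexivity|apply hom_post_id].
- etransitivity; [exact (eq_sym (hom_post_comp b a eg ef eg))|].
  transitivity (hom_post (hom_id g) eg eg); [rewrite <- ba; reflexivity|apply hom_post_id].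
Qed.

Lemma hom_post_post B C D Z W (k : tight B C) (k' : tight C D) (ps : chain Z W)
    (f : tight Z B) (g : tight W B) (phi : cell ps (hom f g) 1 1)
    (fk : tight Z C) (gk : tight W C) (ef : fk = f ;; k) (eg : gk = g ;; k)
    (fk' : tight Z D) (gk' : tight W D) (ef' : fk' = fk ;; k') (eg' : gk' = gk ;; k')
    kk (ek : kk = k ;; k') (d : fk' = f ;; kk) (d' : gk' = g ;; kk) :
  hom_post (hom_post phi ef eg) ef' eg' = hom_post phi d d'.
Proof. apply to_lid_inj; rewrite !to_lid_post; apply lid_post_pst, ek. Qed.

(** The single input is a loose-identity; inserting its unit reduces both sides to [a]. This is the
    generic case of the interchange law [whisker_nat]. *)
Lemma lid_map_nat D B (f g : tight D B) (a : cell cnil (lid B) f g) :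
  lid_comp (lid_map f) a = lid_comp a (lid_map g).
Proof.
apply (lid_ext (ps := cnil) (qs := cnil)).
unfold graft; simpl.
assert (H : forall (f : tight D B), paste (cells1 (lunit D)) (lid_map f) (t1f f) (t1f f) = lid_id
  f).
{ clear; intros f; rewrite <- (paste_cids (lunit D) (t1f 1) (t1f 1)); unfold cids.
  exact (lid_map_unit (a := 1) (t1f f) (t1f f) (t1f f) (t1f f) _ _ (tf1 f) (tf1 f)). }
transitivity a; [|symmetry].
- assert (K := lid_comp_paste (cells1 (lunit D)) (cells_nil 1) (lid_map f) a (t1f f) (t1f f) (t1f
  f) (t1f g)).
  rewrite cells_app_single, H, lid_comp_unl, paste_cells_nil in K.
  etransitivity; [|exact (eq_sym K)]; apply paste_irr.
- assert (K := lid_comp_paste (cells_nil 1) (cells1 (lunit D)) a (lid_map g) (t1f f) (t1f g) (t1f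
  g) (t1f g)).
  rewrite H, lid_comp_unr_cast, paste_cells_nil, ccast_id in K.
  etransitivity; [|exact (eq_sym K)]; simpl; rewrite cells1_cons; apply paste_irr.
Qed.

Lemma whisker_nat B Z Y Y' (f g : tight Z B) (a : cell cnil (hom f g) 1 1)
    (x : tight Y Z) (y : tight Y' Z) (qs : chain Y Y') (delta : cell qs (hom x y) 1 1)
    (xf xg : tight Y B) (yf yg : tight Y' B) (exf : xf = x ;; f) (exg : xg = x ;; g)
    (eyf : yf = y ;; f) (eyg : yg = y ;; g) :
  hcomp (whisker exf exg a) (hom_post delta exg eyg) =
  rcomp (hom_post delta exf eyf) (whisker eyf eyg a).
Proof.
transitivity (vcomp delta (vcomp (hom_map exf eyf)
  (hcomp (cid (hom xf yf)) (whisker eyf eyg a) : cell [: hom xf yf] (hom xf yg) 1 1)));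
  [|symmetry; apply vcompA].
apply to_lid_inj; cbn [capp]; rw (to_lid_hcomp (whisker exf exg a) (hom_post delta exg eyg)).
rewrite to_lid_post; unfold whisker at 1; rewrite of_lidK.
rewrite to_lid_vcomp.
transitivity (paste (cells1 (to_lid delta)) (lid_comp (to_lid a) (lid_map g)) exf eyg).
- exact (lid_comp_paste (cells_nil x) (cells1 (to_lid delta)) (to_lid a) (lid_map g) exf exg exg
  eyg).
- rewrite <- lid_map_nat.
  transitivity (paste (cells1 delta) (paste (cells1 (hom_cart x y)) (lid_comp (lid_map f) (to_lid
    a))
    exf eyg) (t1f xf) (t1f yg)); [apply paste_paste1|].
  eapply paste_eq; [reflexivity|].
  etransitivity; [|symmetry; apply to_lid_vcomp].
  rw (to_lid_hcomp (cid (hom xf yf)) (whisker eyf eyg a)); rewrite to_lid_cid.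
  unfold whisker; rewrite of_lidK.
  assert (K := lid_comp_paste (cells1 (hom_map exf eyf)) (cells_nil 1) (hom_cart xf yf)
    (paste (cells_nil y) (to_lid a) eyf eyg) (t1f _) (t1f _) (t1f _) (t1f _)).
  rewrite cells_app_single in K.
  assert (K' := lid_comp_paste (cells1 (hom_cart x y)) (cells_nil y) (lid_map f) (to_lid a) exf eyf
    eyf eyg).
  rewrite cells_app_single in K'.
  etransitivity; [|etransitivity; [exact K|]].
  + etransitivity; [|symmetry; etransitivity; [|exact K']].
    * eapply paste_eq; [|reflexivity]; apply cells_cons_irr.
    * f_equal; [exact (to_lid_map exf eyf)|exact (paste_cells_nil _ _ _)].
  + eapply paste_eq; [|reflexivity]; apply cells1_cons.
Qed.

(** Applying [k'] after [k] is, by naturality of [a], conjugation by invertible 2-cells, which is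
    injective. *)
Lemma hom_post_faithful B C Y Y' (k : tight B C) (k' : tight C B)
    (a : cell cnil (hom 1 (k ;; k')) 1 1) (x : tight Y B) (y : tight Y' B) (qs : chain Y Y')
    (phi psi : cell qs (hom x y) 1 1) (xk : tight Y C) (yk : tight Y' C)
    (ex : xk = x ;; k) (ey : yk = y ;; k) :
  iso2 a -> hom_post phi ex ey = hom_post psi ex ey -> phi = psi.
Proof.
intros Ha H.
assert (dx : xk ;; k' = x ;; (k ;; k')) by (rewrite ex; apply tcompA).
assert (dy : yk ;; k' = y ;; (k ;; k')) by (rewrite ey; apply tcompA).
apply (rcomp_iso_inj (whisker_iso (tf1 y) dy Ha)).
rewrite <- (hom_post1 phi (tf1 x) (tf1 y)), <- (hom_post1 psi (tf1 x) (tf1 y)).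
rewrite <- !(whisker_nat _ _ _ dx).
rewrite <- !(@hom_post_post _ _ _ _ _ k k' _ _ _ _ xk yk ex ey _ _ eq_refl eq_refl _ eq_refl), H.
reflexivity.
Qed.

Lemma hom_post_full B C Y Y' (k : tight B C) (k' : tight C B)
    (a : cell cnil (hom 1 (k ;; k')) 1 1) (b : cell cnil (hom 1 (k' ;; k)) 1 1)
    (x : tight Y B) (y : tight Y' B) (qs : chain Y Y')
    (xk : tight Y C) (yk : tight Y' C)
    (ex : xk = x ;; k) (ey : yk = y ;; k) (phi : cell qs (hom xk yk) 1 1) :
  iso2 a -> iso2 b -> exists! delta : cell qs (hom x y) 1 1, hom_post delta ex ey = phi.
Proof.
intros Ha Hb.
assert (dx : xk ;; k' = x ;; (k ;; k')) by (rewrite ex; apply tcompA).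
assert (dy : yk ;; k' = y ;; (k ;; k')) by (rewrite ey; apply tcompA).
destruct (iso2_sym (whisker_iso (tf1 y) dy Ha)) as [c [_ [Hc1 Hc2]]].
(* The preimage is the image of [phi] under [k'], conjugated by [a]. Since [k'] is faithful through
   [b], it suffices to compare images under [k'], which agree by naturality of [a]. *)
exists (rcomp (hcomp (whisker (tf1 x) dx a) (hom_post phi eq_refl eq_refl)) c); split.
- apply (hom_post_faithful (a := b) (ex := eq_refl (xk ;; k')) (ey := eq_refl (yk ;; k')) Hb).
  apply (hcomp_iso_inj (whisker_iso (tf1 x) dx Ha)).
  rewrite (@hom_post_post _ _ _ _ _ k k' _ _ _ _ xk yk ex ey _ _ eq_refl eq_refl _ eq_refl dx dy).
  etransitivity; [refine (@whisker_nat _ _ _ _ _ _ a _ _ _ _ _ _ _ _ (tf1 x) dx (tf1 y) dy)|].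
  rewrite hom_post1, rcomp_rcomp, Hc2; apply rcomp_id.
- intros psi H; apply (hom_post_faithful (a := a) (ex := ex) (ey := ey) Ha).
  rewrite H.
  apply (hom_post_faithful (a := b) (ex := eq_refl (xk ;; k')) (ey := eq_refl (yk ;; k')) Hb).
  apply (hcomp_iso_inj (whisker_iso (tf1 x) dx Ha)).
  rewrite (@hom_post_post _ _ _ _ _ k k' _ _ _ _ xk yk ex ey _ _ eq_refl eq_refl _ eq_refl dx dy).
  etransitivity; [refine (@whisker_nat _ _ _ _ _ _ a _ _ _ _ _ _ _ _ (tf1 x) dx (tf1 y) dy)|].
  rewrite hom_post1, rcomp_rcomp, Hc2; apply rcomp_id.
Qed.

End Whiskering.

(** * Restrictions of algebras *)

Section Algebras.

Variable V : equipment.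
Local Notation chain := (chain (@loose V)).
Implicit Types A B C D E W X Y Z : ob V.

Lemma restr_nat B B' Z D Y Y' (f : tight Z B) (g : tight D B) (f' : tight Z B')
    (g' : tight D B') (Phi : cell [: hom f g] (hom f' g') 1 1)
    (x : tight Y D) (y : tight Y' D) (xg : tight Y B) (yg : tight Y' B)
    (xg' : tight Y B') (yg' : tight Y' B')
    (ex : xg = x ;; g) (ey : yg = y ;; g) (ex' : xg' = x ;; g') (ey' : yg' = y ;; g')
    (ps : chain Z Y) (qs : chain Y Y') (alpha : cell ps (hom f xg) 1 1)
    (beta : cell qs (hom x y) 1 1) :
  hcomp (vcomp alpha (hom_restr Phi ex ex')) (hom_post beta ex' ey') =
  vcomp (hcomp alpha (hom_post beta ex ey)) (hom_restr Phi ey ey').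
Proof.
unfold hom_post; rewrite hcomp_vcomp, (hom_restr_nat Phi ex ey ex' ey').
etransitivity; [symmetry; apply paste_paste1 with (d0 := t1f 1) (dn := t1f 1)
  (a0 := t1f 1) (an := t1f 1)|].
apply (f_equal (fun a => vcomp a (hom_restr Phi ey ey'))).
etransitivity; [symmetry; apply hcomp_vcomp|rewrite !vcomp_cid; reflexivity].
Qed.

Lemma along_along B Z W Y Y' (f : tight Z B) (g : tight W B) (x : tight Y W) (y : tight Y' Y)
    (xg : tight Y B) (yxg : tight Y' B) (e : xg = x ;; g) (d : yxg = y ;; xg)
    (e' : yxg = y ;; x ;; g) :
  paste (cells1 (hom_along f d)) (hom_along f e) (t1f 1) (eq_refl (y ;; x)) = hom_along f e'.
Proof.
apply (rfact_ext (e0 := t1f f) (en := e')).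
etransitivity; [apply (op_vcomp _ _ _ _ _ _ (t1f f) e' (t1f f) d)|].
etransitivity; [apply op_along|symmetry; apply op_along].
Qed.

Lemma hom_restr_restr B B' Z W Y Y' (f : tight Z B) (g : tight W B) (f' : tight Z B')
    (g' : tight W B') (phi : cell [: hom f g] (hom f' g') 1 1) (x : tight Y W) (y : tight Y' Y)
    (xg : tight Y B) (xg' : tight Y B') (e : xg = x ;; g) (e' : xg' = x ;; g')
    (yxg : tight Y' B) (yxg' : tight Y' B') (d : yxg = y ;; xg) (d' : yxg' = y ;; xg')
    (c : yxg = y ;; x ;; g) (c' : yxg' = y ;; x ;; g') :
  hom_restr (hom_restr phi e e') d d' = hom_restr phi c c'.
Proof.
apply to_lid_inj; rewrite !to_lid_restr.
rewrite <- (along_along f e d c).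
symmetry; apply paste_paste1.
Qed.

Lemma hom_restr_tid B B' Z W (f : tight Z B) (g : tight W B) (f' : tight Z B')
    (g' : tight W B') (phi : cell [: hom f g] (hom f' g') 1 1) (e : g = 1 ;; g) (e' : g' = 1 ;; g')
      :
  hom_restr phi e e' = phi.
Proof.
apply to_lid_inj; rewrite to_lid_restr.
etransitivity; [|apply (paste_cid1 (to_lid phi) (t1f f') e')].
eapply paste_eq; [|reflexivity]; f_equal.
apply (rfact_ext (e0 := t1f f) (en := e)).
etransitivity; [apply op_along|symmetry; apply paste_cid1].
Qed.

Lemma restr_precomp B Z W Y (h f : tight Z B) (g : tight W B) (alpha : cell cnil (hom h f) 1 1)
    (x : tight Y W) (xg : tight Y B) (e e' : xg = x ;; g) :
  hom_restr (hcomp alpha (cid (hom f g)) : cell [: hom f g] (hom h g) 1 1) e e' =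
  hcomp alpha (cid (hom f xg)).
Proof.
apply to_lid_inj; rewrite to_lid_restr.
etransitivity; [eapply paste_eq; [reflexivity|exact (to_lid_hcomp alpha (cid (hom f g)))]|].
symmetry; etransitivity; [exact (to_lid_hcomp alpha (cid (hom f xg)))|].
rewrite !to_lid_cid.
assert (K := lid_comp_paste (cells_nil 1) (cells1 (hom_along f e)) (to_lid alpha) (hom_cart f g)
  (t1f h) (t1f f) (t1f f) e').
rewrite paste_cells_nil, op_along in K; exact K.
Qed.

Lemma paste_hcomp_along B Z0 Z1 W Y (f : tight Z0 B) (g : tight Z1 B) (h : tight W B)
    (f' : tight Z0 B) (p : loose Z1 Z0) B1 (g1 : tight Z1 B1) (h1 : tight W B1)
    (phi : cell [: p] (hom f g) 1 1) (psi : cell [: hom g1 h1] (hom g h) 1 1) (x : tight Y W)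
    (xh : tight Y B) (xh1 : tight Y B1) (e : xh = x ;; h) (e1 : xh1 = x ;; h1) :
  paste (cells1 (hcomp phi (hom_restr psi e1 e) : cell [: p; hom g1 xh1] (hom f xh) 1 1))
    (hom_along f e) (t1f 1) (t1f x) =
  paste (cells_pair (cid p) (hom_along g1 e1)) (hcomp phi psi) (t1f 1) (tf1 x).
Proof.
apply (rfact_ext (e0 := t1f f) (en := e)).
etransitivity; [apply (op_vcomp _ _ _ _ _ _ (t1f f) e (t1f f) (t1f xh))|].
change (to_lid (hcomp phi (hom_restr psi e1 e) : cell [: p; hom g1 xh1] (hom f xh) 1 1) =
  paste (cells1 (paste (cells_pair (cid p) (hom_along g1 e1))
    (hcomp phi psi : cell [: p; hom g1 h1] (hom f h) 1 1) (t1f 1) (tf1 x))) (cart (lid B) f h)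
     (t1f f) e).
etransitivity; [exact (to_lid_hcomp phi (hom_restr psi e1 e))|].
rewrite to_lid_restr, <- (paste_cid1 (to_lid phi) (t1f f) (t1f g)), lid_comp_paste1.
symmetry; etransitivity; [apply paste_paste1 with (d0 := t1f f) (dn := t1f h)|].
eapply paste_eq; [reflexivity|exact (to_lid_hcomp phi psi)].
Unshelve. all: assumption.
Qed.

Lemma along_inj B Z W Y (f : tight Z B) (g : tight W B) (x : tight Y W) (xg : tight Y B)
    (e : xg = x ;; g) (ps : chain Z Y) (phi psi : cell ps (hom f xg) 1 1) :
  paste (cells1 phi) (hom_along f e) (t1f 1) (t1f x) =
  paste (cells1 psi) (hom_along f e) (t1f 1) (t1f x) -> phi = psi.
Proof.
intros H; apply to_lid_inj.
assert (K : forall phi : cell ps (hom f xg) 1 1, to_lid phi =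
  paste (cells1 (paste (cells1 phi) (hom_along f e) (t1f 1) (t1f x))) (hom_cart f g) (t1f f) e).
{ clear; intros phi; symmetry.
  apply (op_vcomp _ _ _ _ _ _ (t1f f) e (t1f f) (t1f xg)). }
rewrite (K phi), (K psi), H; reflexivity.
Qed.

Lemma restr_along B B' Z W Y (f : tight Z B) (g : tight W B) (f' : tight Z B')
    (g' : tight W B') (phi : cell [: hom f g] (hom f' g') 1 1) (x : tight Y W)
    (xg : tight Y B) (xg' : tight Y B') (e : xg = x ;; g) (e' : xg' = x ;; g') :
  paste (cells1 (hom_restr phi e e')) (hom_along f' e') (t1f 1) (t1f x) =
  paste (cells1 (hom_along f e)) phi (t1f 1) (tf1 x).
Proof.
apply (rfact_ext (e0 := t1f f') (en := e')).
etransitivity; [apply (op_vcomp _ _ _ _ _ _ (t1f f') e' (t1f f') (t1f xg'))|].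
etransitivity; [exact (to_lid_restr phi e e')|].
symmetry; apply paste_paste1.
Qed.

Section Restriction.

Variables (A E D : ob V) (j : tight A E) (T : rel_monad j) (a : algebra T D).
Variables (Y : ob V) (x : tight Y D) (xa : tight Y E) (e : xa = x ;; a).

Lemma restr_alg_unit :
  vcomp (hom_restr (act a) e e) (hcomp (eta T) (cid (hom T xa))) = cid (hom j xa).
Proof.
rewrite <- (restr_precomp (eta T) e e).
etransitivity; [apply (hom_restr_vcomp (act a) (hcomp (eta T) (cid (hom T a))) e e e)|].
rewrite (alg_unit a); apply hom_restr_cid.
Qed.

(** Pasting with the cartesian [hom_along] is injective and moves the restriction to the top of both
    sides, where the law of [a] applies. *)
Lemma restr_alg_assoc :
  hcomp (ext T) (hom_restr (act a) e e) =
  vcomp (hcomp (cid (hom j T)) (hom_restr (act a) e e)) (hom_restr (act a) e e).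
Proof.
apply (along_inj (e := e)).
etransitivity; [exact (paste_hcomp_along T (ext T) (act a) e e)|].
rewrite alg_assoc.
symmetry; etransitivity; [apply (paste_paste1 _ _ _ _ _ _ _ (t1f 1) (t1f x) (t1f 1) (t1f x))|].
rewrite restr_along.
etransitivity; [symmetry; apply paste_paste1 with (h0 := tid _) (hn := x) (a0 := t1f 1) (an := t1f
  x)|].
etransitivity; [|apply paste_paste1 with (h0 := tid _) (hn := x) (a0 := t1f 1) (an := tf1 x)].
eapply paste_eq; [|reflexivity].
f_equal; exact (paste_hcomp_along j (cid (hom j T)) (act a) e e).
Unshelve. all: try apply t1f; try apply tf1.
Qed.

(** The carrier [xa] is equal to [x ;; a] only through [e], so that it may be a tight-cell such as
    [r], with [x] the identity. *)
Definition restr_algebra : algebra T Y :=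
  @Algebra _ _ _ j T Y xa (hom_restr (act a) e e) restr_alg_unit restr_alg_assoc.

End Restriction.

End Algebras.

(** * Graded morphisms of restricted algebras and their liftings *)

Section Graded.

Variable V : equipment.
Local Notation chain := (chain (@loose V)).
Implicit Types A B C D E W X Y Z : ob V.

Lemma hom_restr_map B C Z W Y (k : tight B C) (f : tight Z B) (g : tight W B)
    (fk : tight Z C) (gk : tight W C) (e : fk = f ;; k) (e' : gk = g ;; k)
    (x : tight Y W) (xg : tight Y B) (xgk : tight Y C) (d : xg = x ;; g) (d' : xgk = x ;; gk)
    (c : xgk = xg ;; k) :
  hom_restr (hom_map e e') d d' = hom_map e c.
Proof.
apply to_lid_inj; rewrite to_lid_restr, !to_lid_map.
etransitivity; [symmetry; apply (lid_post_paste (cells1 (hom_along f d)) (hom_cart f g) (t1f f) d e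
  c)|].
unfold lid_post; rewrite op_along; reflexivity.
Qed.

Lemma hom_restr_post B B' C Z W Y (k : tight B' C) (f : tight Z B) (g : tight W B)
    (f' : tight Z B') (g' : tight W B') (phi : cell [: hom f g] (hom f' g') 1 1)
    (fk : tight Z C) (gk : tight W C) (e : fk = f' ;; k) (e' : gk = g' ;; k)
    (x : tight Y W) (xg : tight Y B) (xg' : tight Y B') (xgk : tight Y C) (d : xg = x ;; g)
    (d' : xg' = x ;; g') (d'' : xgk = x ;; gk) (c : xgk = xg' ;; k) :
  hom_restr (hom_post phi e e') d d'' = hom_post (hom_restr phi d d') e c.
Proof.
unfold hom_post; rewrite <- (hom_restr_vcomp phi (hom_map e e') d d' d'').
rewrite (hom_restr_map e e' d' d'' c); reflexivity.
Qed.

Lemma hom_restr_rcomp B B' Z W Y (f : tight Z B) (g : tight W B)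
    (f' : tight Z B') (g' h : tight W B') (phi : cell [: hom f g] (hom f' g') 1 1)
    (a : cell cnil (hom g' h) 1 1)
    (x : tight Y W) (xg : tight Y B) (xg' xh : tight Y B') (d : xg = x ;; g)
    (d' : xg' = x ;; g') (d'' : xh = x ;; h) :
  hom_restr (rcomp phi a) d d'' = rcomp (hom_restr phi d d') (whisker d' d'' a).
Proof.
unfold rcomp at 1.
rewrite <- (hom_restr_vcomp phi _ d d' d''); unfold rcomp; f_equal.
apply to_lid_inj; rewrite to_lid_restr.
etransitivity; [eapply paste_eq; [reflexivity|exact (to_lid_hcomp (cid (hom f' g')) a)]|].
symmetry; etransitivity; [exact (to_lid_hcomp (cid (hom f' xg')) (whisker d' d'' a))|].
rewrite !to_lid_cid; unfold whisker; rewrite of_lidK.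
assert (K := lid_comp_paste (cells1 (hom_along f' d')) (cells_nil x) (hom_cart f' g') (to_lid a)
  (t1f f') d' d' d'').
rewrite op_along, cells_app_single in K; etransitivity; [exact K|].
eapply paste_eq; [|reflexivity]; apply cells1_cons.
Qed.

Section Full.

Variables (A E : ob V) (j : tight A E) (T : rel_monad j).

Lemma graded_post D (a : algebra T D) Y Y' (x : tight Y D) (y : tight Y' D)
    (xa : tight Y E) (ya : tight Y' E) (ex : xa = x ;; a) (ey : ya = y ;; a)
    (qs : chain Y Y') (delta : cell qs (hom x y) 1 1) :
  graded_morphism (a := restr_algebra ex) (a' := restr_algebra ey) (hom_post delta ex ey).
Proof.
unfold graded_morphism; simpl.
etransitivity; [|exact (restr_nat (act a) ex ey ex ey (cid (hom j xa)) delta)].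
rewrite cid_vcomp; reflexivity.
Qed.

(** This is the second clause of an algebra object, stated for arbitrary tight-cells into [D] in
    place of mediating ones. In this form it can be transferred along a fully faithful
    tight-cell. *)
Definition full_on_graded D (a : algebra T D) : Prop :=
  forall Y Y' (x : tight Y D) (y : tight Y' D)
    (xa : tight Y E) (ya : tight Y' E) (ex : xa = x ;; a) (ey : ya = y ;; a)
    (qs : chain Y Y') (eps : cell qs (hom xa ya) 1 1),
    graded_morphism (a := restr_algebra ex) (a' := restr_algebra ey) eps ->
    exists! delta : cell qs (hom x y) 1 1, hom_post delta ex ey = eps.

Lemma full_inj D (a : algebra T D) Y Y' (x : tight Y D) (y : tight Y' D)
    (xa : tight Y E) (ya : tight Y' E) (ex : xa = x ;; a) (ey : ya = y ;; a)
    (qs : chain Y Y') (phi psi : cell qs (hom x y) 1 1) :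
  full_on_graded a -> hom_post phi ex ey = hom_post psi ex ey -> phi = psi.
Proof.
intros H G; destruct (H _ _ _ _ _ _ _ _ _ _ (graded_post ex ey phi)) as [d [_ Hd]].
transitivity d; [symmetry|]; apply Hd; auto.
Qed.

Lemma full_iso D (a : algebra T D) Y (x y : tight Y D)
    (xa ya : tight Y E) (ex : xa = x ;; a) (ey : ya = y ;; a)
    (phi : cell cnil (hom xa ya) 1 1) (psi : cell cnil (hom ya xa) 1 1) :
  full_on_graded a ->
  graded_morphism (a := restr_algebra ex) (a' := restr_algebra ey) phi ->
  graded_morphism (a := restr_algebra ey) (a' := restr_algebra ex) psi ->
  hcomp phi psi = hom_id xa -> hcomp psi phi = hom_id ya -> tight_iso x y.
Proof.
intros H Hp Hq pq qp.
destruct (H _ _ _ _ _ _ _ _ _ _ Hp) as [d [Hd _]].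
destruct (H _ _ _ _ _ _ _ _ _ _ Hq) as [d' [Hd' _]].
exists d, d'; split.
- apply (full_inj (ex := ex) (ey := ex) H).
  rewrite hom_post_id.
  etransitivity; [exact (hom_post_comp d d' ex ey ex)|]; rewrite Hd, Hd'; exact pq.
- apply (full_inj (ex := ey) (ey := ey) H).
  rewrite hom_post_id.
  etransitivity; [exact (hom_post_comp d' d ey ex ey)|]; rewrite Hd, Hd'; exact qp.
Qed.

(** [psi] then [phi], acting on E(j,a'), is inserted before the action of [a']. Gradedness carries
    [phi] past that action, where it cancels against [psi]. *)
Lemma graded_inverse D (a a' : algebra T D) (phi : cell cnil (hom a a') 1 1)
    (psi : cell cnil (hom a' a) 1 1) :
  hcomp phi psi = hom_id a -> hcomp psi phi = hom_id a' ->
  graded_morphism phi -> graded_morphism psi.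
Proof.
unfold graded_morphism; simpl; intros pq qp H.
transitivity (rcomp (act a') psi).
{ symmetry; apply rcomp1. }
assert (H' : rcomp (act a) phi = vcomp (rcomp (cid (hom j a)) phi) (act a')).
{ rewrite !rcomp1; exact H. }
transitivity (vcomp (rcomp (cid (hom j a')) psi) (act a)); [|rewrite rcomp1; reflexivity].
assert (K : vcomp (rcomp (cid (hom j a')) psi) (rcomp (cid (hom j a)) phi) = cid _).
{ rewrite vcomp_rcomp, vcomp_cid, rcomp_rcomp, qp; apply rcomp_id. }
etransitivity; [exact (eq_sym (cid_vcomp (rcomp (act a') psi)))|].
etransitivity; [exact (f_equal (fun z => vcomp z (rcomp (act a') psi)) (eq_sym K))|].
rewrite vcompA, vcomp_rcomp, <- H', rcomp_rcomp, pq.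
rewrite rcomp_id; reflexivity.
Qed.

(** Restrictions compose, so a graded morphism for [a] is one for [b]; it lifts first through [b]
    and then through the fully faithful [k]. *)
Lemma full_pull D D' (a : algebra T D) (b : algebra T D') (k : tight D D') (e : alg a = k ;; b) :
  hom_restr (act b) e e = act a ->
  (forall Y Y' (x : tight Y D) (y : tight Y' D) xk yk (ex : xk = x ;; k) (ey : yk = y ;; k)
     (qs : chain Y Y') (phi : cell qs (hom xk yk) 1 1),
     exists! delta : cell qs (hom x y) 1 1, hom_post delta ex ey = phi) ->
  full_on_graded b -> full_on_graded a.
Proof.
intros Ha Hk Hb Y Y' x y xa ya ex ey qs eps Heps.
assert (dx : xa = x ;; k ;; b) by (rewrite ex, tcompA, e; reflexivity).
assert (dy : ya = y ;; k ;; b) by (rewrite ey, tcompA, e; reflexivity).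
assert (G : graded_morphism (a := restr_algebra dx) (a' := restr_algebra dy) eps).
{ revert Heps; unfold graded_morphism; simpl; rewrite <- Ha.
  rewrite (hom_restr_restr (act b) e e ex ex dx dx), (hom_restr_restr (act b) e e ey ey dy dy).
  trivial. }
destruct (Hb _ _ _ _ _ _ _ _ _ _ G) as [d [H1 H2]].
destruct (Hk _ _ _ _ _ _ (eq_refl (x ;; k)) (eq_refl (y ;; k)) _ d) as [d' [H3 H4]].
assert (K : forall delta : cell qs (hom x y) 1 1, hom_post (hom_post delta (eq_refl (x ;; k))
  (eq_refl (y ;; k)))
  dx dy = hom_post delta ex ey).
{ intros delta; exact (hom_post_post delta _ _ dx dy e ex ey). }
exists d'; split.
- rewrite <- K, H3; exact H1.
- intros d'' H5; apply H4, eq_sym, H2; rewrite K; exact H5.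
Qed.

Lemma ualg_full (O : algebra_object T) : full_on_graded (ualg O).
Proof.
intros Y Y' x y xa ya ex ey qs eps H.
(* By uniqueness, [x] and [y] are themselves the mediating tight-cells of the algebras restricted
   along them. *)
assert (Hx := @med_uniq _ _ _ _ _ O Y (restr_algebra ex) x ex eq_refl).
assert (Hy := @med_uniq _ _ _ _ _ O Y' (restr_algebra ey) y ey eq_refl).
assert (G := @med_graded _ _ _ _ _ O _ _ (restr_algebra ex) (restr_algebra ey) _ _ H).
revert G; generalize (med_alg O (restr_algebra ex)) (med_alg O (restr_algebra ey)).
rewrite <- Hx, <- Hy; simpl; intros dx dy.
rewrite (proof_irrelevance _ dx ex), (proof_irrelevance _ dy ey); trivial.
Qed.

End Full.

(* [r1] stands for [tid D ;; r], which is equal but not convertible to [r]. *)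
Definition creates A E D (j : tight A E) (r r1 : tight D E) (e1 : r1 = 1 ;; r) : Prop :=
  forall C (c : tight D C) (e : tight C E) (lam : cell [: hom c 1] (hom r1 e) 1 1),
    is_colimit lam -> absolute j lam ->
    (forall (w : tight C D) (lam' : cell [: hom c 1] (hom 1 w) 1 1),
      is_colimit (hom_post lam' e1 (eq_refl (w ;; r))) <-> is_colimit lam') /\
    (exists (w : tight C D) (lam' : cell [: hom c 1] (hom 1 w) 1 1), is_colimit lam').

Lemma creates_absolute_extensionsE A E D (j : tight A E) (r : tight D E) :
  creates_absolute_extensions j r <-> creates j (t1f r).
Proof.
assert (H : forall r1 r2 (e1 : r1 = 1 ;; r) (e2 : r2 = 1 ;; r), creates j e1 -> creates j e2).
{ intros r1 r2 e1 e2; subst r1 r2; trivial. }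
split; [apply (H _ _ eq_refl)|apply H].
Qed.

End Graded.

(** * Creation implies monadicity *)

Section Monadic.

Variable V : equipment.
Local Notation chain := (chain (@loose V)).
Implicit Types A B C D E W X Y Z : ob V.

Variables (A E D : ob V) (j : tight A E) (r : tight D E) (l : left_adjoint j r).

Section Lift.

Variables (C : ob V) (c : tight D C) (e : tight C E) (ec : r = c ;; e).
Variables (el : l ;; r = l ;; c ;; e) (delta : cell [: hom j e] (hom (l ;; c) 1) 1 1).

Let lam : cell [: hom c 1] (hom r e) 1 1 := hom_post (cid (hom c 1)) ec (t1f e).
Let tau : cell [: hom j e] (hom c 1) l 1 := shift (eq_refl (l ;; c)) delta.

Lemma shiftK : paste (cells1 tau) (hom_cart c 1) (eq_refl (l ;; c)) (t1f 1) = to_lid delta.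
Proof. apply rfactK. Qed.

(** [lam] is the cell from C(c,1) to E(ce,e) induced by [e], and [tau] is [delta] transposed.
    Reading [delta] followed by [e] as an action on [e], the hypothesis is the unit law. This is
    applied with [c] the identity and with [c] the comparison. *)
Lemma splits_of_lift :
  hcomp (adj_eta l) (hom_post delta el (t1f e)) = cid (hom j e) -> splits lam tau.
Proof.
intros H; apply to_lid_inj.
etransitivity; [apply to_lid_paste|].
etransitivity; [eapply paste_eq; [reflexivity|exact (to_lid_hcomp (cid (hom j r)) lam)]|].
rewrite to_lid_cid.
etransitivity; [|exact (f_equal _ H)].
etransitivity; [|symmetry; exact (to_lid_hcomp (adj_eta l) (hom_post delta el (t1f e)))].
rewrite <- (lid_comp_paste1 _ _ _ _ (t1f j) (eq_refl (l ;; r)) (eq_refl (l ;; r)) (t1f e)).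
rewrite adj_sigmaK; f_equal.
unfold lam; rewrite !to_lid_post, to_lid_cid, <- shiftK.
symmetry; apply lid_post_paste.
Qed.

Lemma extends_of_lift :
  vcomp (hcomp (cid (hom j r)) lam : cell [: hom j r; hom c 1] (hom j e) 1 1) delta =
  adj_whisker l c -> extends_whisker lam tau.
Proof.
intros H; apply (rfact_ext (e0 := eq_refl (l ;; c)) (en := t1f 1)).
etransitivity; [apply (op_vcomp _ _ _ _ _ _ (eq_refl (l ;; c)) (t1f 1) (t1f (l ;; c)) (t1f 1))|].
etransitivity; [|symmetry; apply rfactK].
rewrite <- H; symmetry; apply to_lid_vcomp.
Qed.

End Lift.

(** Here the lifted action is [flat] itself: its unit law is [adj_act_unit], and its compatibility
    with the cocone is naturality. *)
Lemma tid_extension_absolute :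
  absolute j (hom_post (cid (hom (tid D) 1)) (t1f r) (t1f r)).
Proof.
assert (el : l ;; r = l ;; 1 ;; r) by (rewrite tcompf1; reflexivity).
apply (absolute_of_split (l := l)
  (tau := shift (eq_refl (l ;; 1)) (hom_post (flat l) (eq_refl (l ;; 1)) (t1f 1)))).
- apply (splits_of_lift (t1f r) (el := el)).
  rewrite (hom_post_post (k := 1) (k' := r) (flat l) (eq_refl (l ;; 1)) (t1f 1) el (t1f r) (t1f r)
    (eq_refl (l ;; r)) (t1f r)).
  etransitivity; [|exact (adj_act_unit l)].
  symmetry; exact (vcomp_hcomp (adj_eta l) (adj_act l)).
- apply extends_of_lift.
  unfold hom_post at 2; rewrite <- vcompA.
  change (hom_post (vcomp (hcomp (cid (hom j r)) (hom_post (cid (hom (tid D) 1)) (t1f r) (t1f r)))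
     (flat l)) (eq_refl (l ;; 1)) (t1f 1) = adj_whisker l (tid D)).
  assert (K := restr_nat (flat l) (t1f r) (t1f r) (tf1 1) (tf1 1) (cid (hom j r)) (cid (hom (tid D)
    1))).
  rewrite cid_vcomp, !hom_restr_tid, hom_post1 in K; rewrite <- K.
  etransitivity; [exact (hom_post_comp (flat l) (cid (hom (tid D) 1)) (eq_refl (l ;; 1)) (t1f 1)
    (t1f 1))|].
  rewrite (hom_post1 (cid (hom (tid D) 1))); reflexivity.
Qed.

End Monadic.

(** * Conservativity of the right adjoint and invertibility of the comparison *)

Section Converse.

Variable V : equipment.
Local Notation chain := (chain (@loose V)).
Implicit Types A B C D E W X Y Z : ob V.

Lemma split_cancel1 A E D (j : tight A E) (r : tight D E) (l : left_adjoint j r)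
    C (c : tight D C) (e : tight C E) (lam : cell [: hom c 1] (hom r e) 1 1)
    (tau : cell [: hom j e] (hom c 1) l 1) (q : loose C A) (phi psi : cell [: hom j e] q 1 1) :
  splits lam tau ->
  vcomp (hcomp (cid (hom j r)) lam : cell [: hom j r; hom c 1] (hom j e) 1 1) phi =
  vcomp (hcomp (cid (hom j r)) lam : cell [: hom j r; hom c 1] (hom j e) 1 1) psi -> phi = psi.
Proof.
intros H G; apply (split_cancel (qs := cnil) H).
assert (K : forall phi : cell [: hom j e] q 1 1, graft cnil (hcomp (cid (hom j r)) lam) cnil phi =
  vcomp (hcomp (cid (hom j r)) lam) phi).
{ clear; intros phi; unfold graft, vcomp; simpl; rewrite cells1_cons; apply paste_irr. }
exact (eq_trans (K phi) (eq_trans G (eq_sym (K psi)))).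
Qed.

Section Conservative.

Variables (A E D : ob V) (j : tight A E) (r : tight D E) (l : left_adjoint j r).
Hypotheses (Hj : dense j) (Hc : creates j (t1f r)).

(** The identity cocone and its composite with [a] both become colimits under [r], so by creation
    both are colimits of the identity. The comparison between them is [a], hence invertible. *)
Lemma conservative (w : tight D D) (a : cell cnil (hom 1 w) 1 1) :
  iso2 (hom_post a (t1f r) (eq_refl (w ;; r))) -> iso2 a.
Proof.
intros Ha.
pose (lam := hom_post (cid (hom (tid D) 1)) (t1f r) (t1f r)).
assert (Habs : absolute j lam) by exact (tid_extension_absolute l).
assert (Hcol : is_colimit lam) by exact (colimit_of_absolute Hj Habs).
destruct (Hc Hcol Habs) as [H _].
assert (H1 : is_colimit (cid (hom (tid D) 1))).
{ apply H; revert Hcol; unfold lam.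
  (* The target must be [1 ;; r], which equals [r] only propositionally; generalizing it allows the
     substitution. *)
  assert (K : forall r1 (e : r1 = 1 ;; r), is_colimit (hom_post (cid (hom (tid D) 1)) (t1f r) e) ->
    is_colimit (hom_post (cid (hom (tid D) 1)) (t1f r) (eq_refl (1 ;; r)))).
  { intros r1 e; subst r1; trivial. }
  apply K. }
assert (H2 : is_colimit (rcomp (cid (hom (tid D) 1)) a)).
{ apply H; rewrite (hom_post_rcomp _ _ (t1f r) (t1f r) eq_refl).
  rewrite rcomp1; exact (colimit_hcomp_iso Hcol Ha). }
destruct (colimit_unique H1 H2) as [b [Hb Hab]].
rewrite rcomp1 in Hab.
destruct (colimit_hom (hcomp (cid (hom (tid D) 1)) a : cell [: hom (tid D) 1] (hom 1 w) 1 1) H1)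
  as [d [_ Hd]].
replace a with b; [exact Hb|].
transitivity d; [symmetry|]; apply Hd; [exact Hab|reflexivity].
Qed.

Variables (O : algebra_object (adj_monad l)).

Let k : tight D (Alg O) := comparison O.
Let u : tight (Alg O) E := ualg O.
Let er : r = k ;; u := med_alg O (adj_algebra l).

Lemma comp_carrier : l ;; r = l ;; k ;; u.
Proof. rewrite tcompA; exact (f_equal _ er). Qed.

Let el := comp_carrier.

Lemma act_comparison : hom_restr (act (ualg O)) er er = adj_act l.
Proof. exact (med_act O (adj_algebra l)). Qed.

Lemma act_left_adjoint : hom_restr (act (ualg O)) el el = adj_ext l.
Proof.
rewrite <- (hom_restr_restr (act (ualg O)) er er (eq_refl (l ;; r)) (eq_refl (l ;; r)) el el).
rewrite act_comparison; apply hom_restr_post.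
Qed.

(** Associativity of the action of u_T says that the action is a graded morphism, from the algebra
    carried by [l ;; k ;; u] to u_T itself; such morphisms lift through u_T. *)
Lemma comparison_lift :
  exists delta : cell [: hom j u] (hom (l ;; k) 1) 1 1, hom_post delta el (t1f u) = act (ualg O).
Proof.
destruct (@ualg_full _ _ _ _ _ O _ _ (l ;; k) 1 _ _ el (t1f u) _ (act (ualg O))) as [d [Hd _]].
- unfold graded_morphism; simpl.
  transitivity (hcomp (adj_ext l) (act (ualg O)));
    [exact (f_equal (fun z => hcomp z (act (ualg O))) act_left_adjoint)|].
  rewrite hom_restr_tid; exact (alg_assoc (ualg O)).
- exists d; exact Hd.
Qed.

Let lam : cell [: hom k 1] (hom r u) 1 1 := hom_post (cid (hom k 1)) er (t1f u).

Lemma comparison_act :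
  vcomp (hcomp (cid (hom j r)) lam : cell [: hom j r; hom k 1] (hom j u) 1 1) (act (ualg O)) =
  hcomp (adj_act l) lam.
Proof.
assert (K := restr_nat (act (ualg O)) er (t1f u) er (t1f u) (cid (hom j r)) (cid (hom k 1))).
rewrite cid_vcomp, act_comparison, hom_restr_tid in K; symmetry; exact K.
Qed.

(** The lifted action splits the cocone by the unit law of u_T. Its compatibility with the cocone is
    checked after applying u_T, which is faithful on 2-cells, and there it is [comparison_act]. *)
Lemma comparison_extension : (exists tau : cell [: hom j u] (hom k 1) l 1, splits lam tau) /\
  absolute j lam.
Proof.
destruct comparison_lift as [delta Hd].
assert (H1 : splits lam (shift (eq_refl (l ;; k)) delta)).
{ apply (splits_of_lift er (el := el)); rewrite Hd.
  etransitivity; [|exact (alg_unit (ualg O))].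
  symmetry; exact (vcomp_hcomp (adj_eta l) (act (ualg O))). }
split; [eexists; exact H1|].
apply (absolute_of_split H1), extends_of_lift.
apply (full_inj (ex := el) (ey := t1f u) (@ualg_full _ _ _ _ _ O)).
etransitivity; [exact (vcompA _ delta (hom_map el (t1f u)))|].
change (vcomp (hcomp (cid (hom j r)) lam : cell [: hom j r; hom k 1] (hom j u) 1 1)
  (hom_post delta el (t1f u)) = hom_post (adj_whisker l k) el (t1f u)).
etransitivity; [exact (f_equal (vcomp _) Hd)|].
etransitivity; [exact comparison_act|].
symmetry; etransitivity; [exact (hom_post_comp
  (hom_post (flat l) (eq_refl (l ;; k)) (t1f k)) (cid (hom k 1)) el er (t1f u))|].
rewrite (hom_post_post (flat l) (eq_refl (l ;; k)) (t1f k) el er er (eq_refl (l ;; r)) (t1f r)).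
reflexivity.
Qed.

Lemma comparison_equivalence : equivalence k.
Proof.
destruct comparison_extension as [[tau Htau] Habs].
assert (Hcol := colimit_of_absolute Hj Habs).
destruct (Hc Hcol Habs) as [H1 [w [lw Hw]]].
assert (Hw' := proj2 (H1 w lw) Hw).
(* Both u_T and [w ;; r] are extensions of [r] along [k], which yields the isomorphism [th]. *)
destruct (colimit_unique Hcol Hw') as [th [Hth Elam]].
destruct (iso2_sym Hth) as [th' [Hth' [E1 E2]]].
rewrite <- rcomp1 in Elam.
exists w; split.
(* [a] is the unit of the extension [w]: the cocone [lw] restricted along [k] and evaluated at the
   identity of [k]. Its image under [r] is [th] whiskered by [k]. *)
- pose (a := vcomp (hom_id k) (hom_restr lw (tf1 k) (eq_refl (k ;; w)))).
  assert (Ha : iso2 a).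
  { apply conservative.
    assert (dk : k ;; w ;; r = k ;; (w ;; r)) by apply tcompA.
    replace (hom_post a (t1f r) (eq_refl (k ;; w ;; r))) with (whisker er dk th).
    { apply whisker_iso; exact Hth. }
    unfold a, hom_post; rewrite vcompA.
    change (whisker er dk th = vcomp (hom_id k)
      (hom_post (hom_restr lw (tf1 k) (eq_refl (k ;; w))) (t1f r) (eq_refl (k ;; w ;; r)))).
    rewrite <- (hom_restr_post lw (t1f r) (eq_refl (w ;; r)) (tf1 k) _ dk).
    rewrite <- Elam, (hom_restr_rcomp lam th (tf1 k) er dk), vcomp_rcomp.
    unfold lam; rewrite (hom_restr_post (cid (hom k 1)) er (t1f u) (tf1 k) (tf1 k) er er).
    rewrite hom_restr_cid.
    unfold hom_post; rewrite cid_vcomp.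
    change (whisker er dk th = rcomp (hom_post (hom_id k) er er) (whisker er dk th)).
    rewrite hom_post_id, rcomp0, hcomp_idl; reflexivity. }
  destruct Ha as [b Hb]; exists a, b; exact Hb.
- assert (ew : w ;; r = w ;; k ;; u) by (rewrite tcompA; exact (f_equal _ er)).
  assert (Hact : hom_restr (act (ualg O)) ew ew = hom_restr (adj_act l) (eq_refl (w ;; r)) (eq_refl
    (w ;; r))).
  { rewrite <- act_comparison; symmetry; apply hom_restr_restr. }
  assert (G : graded_morphism (a := restr_algebra (a := ualg O) (t1f u))
    (a' := restr_algebra (a := ualg O) ew) th).
  { unfold graded_morphism; simpl; rewrite hom_restr_tid.
    etransitivity; [|exact (f_equal (vcomp _) (eq_sym Hact))].
    (* After precomposition with the splittable cell into E(j,u), [lam] followed by [th] is the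
       image of [lw] under [r], so the claim is naturality of the action of [r]. *)
    apply (split_cancel1 Htau).
    rewrite <- !rcomp1.
    etransitivity; [apply vcomp_rcomp|].
    etransitivity; [exact (f_equal (fun z => rcomp z th) comparison_act)|].
    transitivity (hcomp (adj_act l) (rcomp lam th)); [exact (eq_sym (hcomp_rcomp (adj_act l) lam
      th))|].
    rewrite Elam.
    assert (K := restr_nat (adj_act l) (t1f r) (eq_refl (w ;; r)) (t1f r) (eq_refl (w ;; r))
      (cid (hom j r)) lw).
    rewrite cid_vcomp, hom_restr_tid in K.
    etransitivity; [exact K|].
    rewrite <- vcompA; f_equal.
    rewrite vcomp_rcomp, vcomp_cid, <- Elam; exact (hcomp_rcomp (cid (hom j r)) lam th). }
  assert (G' := graded_inverse (a := restr_algebra (a := ualg O) (t1f u))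
    (a' := restr_algebra (a := ualg O) ew) E1 E2 G).
  exact (full_iso (@ualg_full _ _ _ _ _ O) G' G E2 E1).
Qed.

End Conservative.

End Converse.

(** * Monadicity implies creation *)

Section Forward.

Variable V : equipment.
Local Notation chain := (chain (@loose V)).
Implicit Types A B C D E W X Y Z : ob V.

Lemma graft_vcomp A An B0 Bn X (ps : chain A X) (q q' : loose X A) (qs : chain X An) (s : loose Bn
  B0)
    (f : tight A B0) (g : tight An Bn) (alpha : cell ps q 1 1) (beta : cell [: q] q' 1 1)
    (phi : cell (q' ::: qs) s f g) :
  graft cnil (vcomp alpha beta) qs phi = graft cnil alpha qs (graft cnil beta qs phi).
Proof.
unfold graft; simpl; symmetry; apply paste_composes.
refine (composes_cons1 _ _ _ _ _ _ _ _); apply composes_cids.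
Qed.

Lemma graft_cid A An B0 Bn X (q : loose X A) (qs : chain X An) (s : loose Bn B0)
    (f : tight A B0) (g : tight An Bn) (phi : cell (q ::: qs) s f g) :
  graft cnil (cid q) qs phi = phi.
Proof. exact (paste_cids phi _ _). Qed.

Lemma vcomp_graft A An X (ps : chain A X) (q : loose X A) (qs : chain X An) (s s' : loose An A)
    (alpha : cell ps q 1 1) (phi : cell (q ::: qs) s 1 1) (psi : cell [: s] s' 1 1) :
  vcomp (graft cnil alpha qs phi) psi = graft cnil alpha qs (vcomp phi psi).
Proof. apply paste_paste1. Qed.

Variables (A E D : ob V) (j : tight A E) (r : tight D E) (l : left_adjoint j r).

(** * The algebra structure on an absolute extension *)

Section ExtensionAlgebra.

Variables (C : ob V) (c : tight D C) (e : tight C E) (lam : cell [: hom c 1] (hom r e) 1 1).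
Variable tau : cell [: hom j e] (hom c 1) l 1.
Hypotheses (Hs : splits lam tau) (Hx : extends_whisker lam tau).

Let theta : cell [: hom j r; hom c 1] (hom j e) 1 1 := hcomp (cid (hom j r)) lam.

Definition ext_act : cell [: hom j e] (hom (l ;; r) e) 1 1 :=
  of_lid (paste (cells1 tau) (to_lid lam) (eq_refl (l ;; r)) (t1f e)).

(** This determines the action on [e], since [theta] can be cancelled: it is the action of [r]
    transported along the cocone. *)
Lemma ext_act_whisker : vcomp theta ext_act = hcomp (adj_act l) lam.
Proof.
apply to_lid_inj; rewrite to_lid_vcomp; unfold ext_act; rewrite of_lidK.
etransitivity; [symmetry; apply paste_paste1 with (a0 := t1f l) (an := t1f 1)
  (e0 := eq_refl (l ;; r)) (en := t1f e)|].
etransitivity; [exact (f_equal (fun z => paste (cells1 z) (to_lid lam) (eq_refl (l ;; r)) (t1f e))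
  Hx)|].
rewrite shift_adj_whisker.
etransitivity; [apply (paste_paste1 _ (lid_act c) (to_lid lam) _ _ _ _ (t1f r) (t1f e)
  (eq_refl (l ;; r)) (t1f e))|].
etransitivity; [|symmetry; exact (to_lid_hcomp (adj_act l) lam)].
unfold adj_act; rewrite to_lid_post.
rewrite <- (paste_cid1 (to_lid lam) (t1f r) (t1f e)) at 2.
symmetry; etransitivity; [exact (lid_comp_paste1 (to_lid (flat l)) (cid (hom c 1)) (lid_map r)
  (to_lid lam)
  (eq_refl (l ;; r)) (t1f r) (t1f r) (t1f e))|].
eapply paste_eq; [reflexivity|].
(* What remains is that [lam] respects the action of the loose-identity of [D]; inserting the
   loose-unit reduces both sides to [lam]. *)
apply (lid_ext (ps := cnil) (qs := [: hom c 1])).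
rewrite graft_lid_map_l.
symmetry; unfold graft.
etransitivity; [symmetry; apply paste_paste1 with (a0 := t1f 1) (an := t1f 1)
  (e0 := t1f r) (en := t1f e)|].
etransitivity; [|apply (paste_cid1 (to_lid lam) (t1f r) (t1f e))].
rewrite <- (graft_lid_act c); unfold graft.
do 2 f_equal; apply paste_irr.
Qed.

Lemma ext_act_unit :
  vcomp ext_act (hcomp (adj_eta l) (cid (hom (l ;; r) e))) = cid (hom j e).
Proof.
rewrite (vcomp_hcomp (adj_eta l) ext_act).
apply to_lid_inj.
etransitivity; [exact (to_lid_hcomp (adj_eta l) ext_act)|].
unfold ext_act; rewrite of_lidK, <- adj_sigmaK.
etransitivity; [exact (lid_comp_paste1 (adj_sigma l) tau (hom_cart j r) (to_lid lam)
  (t1f j) (eq_refl (l ;; r)) (eq_refl (l ;; r)) (t1f e))|].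
etransitivity; [|exact (f_equal _ Hs)].
symmetry; etransitivity; [apply to_lid_paste|].
eapply paste_eq; [reflexivity|].
etransitivity; [exact (to_lid_hcomp (cid (hom j r)) lam)|]; rewrite to_lid_cid; reflexivity.
Qed.

Lemma ext_act_assoc :
  hcomp (adj_ext l) ext_act = vcomp (hcomp (cid (hom j (l ;; r))) ext_act) ext_act.
Proof.
pose (p := hom j (l ;; r)).
assert (K : forall (f : tight A E) (phi : cell [: p] (hom f (l ;; r)) 1 1),
  paste (cells_pair (cid p) theta) (hcomp phi ext_act) (t1f 1) (t1f 1) =
  hcomp (hcomp phi (adj_act l) : cell [: p; hom j r] (hom f r) 1 1) lam).
{ intros f phi; etransitivity; [symmetry; apply hcomp_vcomp|].
  rewrite cid_vcomp, ext_act_whisker; symmetry.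
  apply (hcompA (ps := [: p]) (qs := [: hom j r]) (rs := [: hom c 1]) _ _ _ eq_refl). }
(* Cancelling [theta] behind E(j,t) turns the law for [e] into the associativity law for [r],
   composed with [lam]. *)
apply (split_cancel2 Hs).
etransitivity; [apply (K _ (adj_ext l))|].
symmetry; etransitivity; [symmetry; apply paste_paste1 with (a0 := t1f 1) (an := t1f 1)
  (e0 := t1f 1) (en := t1f 1)|].
etransitivity; [exact (f_equal (fun z => vcomp z ext_act) (K _ (cid p)))|].
etransitivity; [exact (f_equal (fun z => vcomp z ext_act)
  (eq_sym (graft_hcomp_cid (hcomp (cid p) (adj_act l)) lam)))|].
pose (m := hcomp (cid p) (adj_act l) : cell [: p; hom j r] (hom j r) 1 1).
etransitivity; [exact (vcomp_graft (qs := [: hom c 1]) m theta ext_act)|].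
etransitivity; [exact (f_equal (graft cnil m [: hom c 1]) ext_act_whisker)|].
etransitivity; [exact (eq_sym (hcomp_graft_l m (adj_act l) lam))|].
exact (f_equal (fun z => hcomp z lam) (eq_sym (adj_act_assoc l))).
Qed.

Definition ext_algebra : algebra (adj_monad l) C :=
  @Algebra _ _ _ j (adj_monad l) C e ext_act ext_act_unit ext_act_assoc.

End ExtensionAlgebra.

(** * Creation from liftings of algebras and of graded morphisms *)

Section Creation.

Hypothesis Hfull : full_on_graded (adj_algebra l).
Hypothesis Hlift : forall C (a : algebra (adj_monad l) C), exists (x : tight C D)
  (i : cell cnil (hom a (x ;; r)) 1 1), iso2 i /\
  graded_morphism (a := a) (a' := restr_algebra (a := adj_algebra l) (eq_refl (x ;; r))) i.

Lemma creates_of_full : creates j (t1f r).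
Proof.
intros C c e lam Hcol Habs.
destruct (split_of_absolute l Habs) as [tau [Hs Hx]].
pose (theta := hcomp (cid (hom j r)) lam : cell [: hom j r; hom c 1] (hom j e) 1 1).
(* To reflect colimits, the image of [psi] under [r] is factored in [E]; the factor is shown to be
   graded and is then lifted to [D]. *)
assert (Reflect : forall (w : tight C D) (lam' : cell [: hom c 1] (hom 1 w) 1 1),
  is_colimit (hom_post lam' (t1f r) (eq_refl (w ;; r))) -> is_colimit lam').
{ intros w lam' H qs psi.
  pose (rw := w ;; r).
  pose (lr := hom_post lam' (t1f r) (eq_refl (w ;; r)) : cell [: hom c 1] (hom r rw) 1 1).
  destruct (colimit_unique Hcol H) as [k [Hk Ek]].
  rewrite <- rcomp1 in Ek; change (rcomp lam k = lr) in Ek.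
  destruct (iso2_sym Hk) as [k' [_ [E1 E2]]].
  pose (theta' := hcomp (cid (hom j r)) lr : cell [: hom j r; hom c 1] (hom j rw) 1 1).
  (* [theta'] is [theta] followed by the isomorphism that [k] induces from E(j,e) to E(j,rw), so it
     can be cancelled as well. *)
  assert (Cancel : forall (s : loose D A) (phi phi' : cell (hom j rw ::: qs) s 1 1),
    graft cnil theta' qs phi = graft cnil theta' qs phi' -> phi = phi').
  { assert (T : theta' = vcomp theta (rcomp (cid (hom j e)) k)).
    { rewrite vcomp_rcomp, vcomp_cid; unfold theta'; rewrite <- Ek.
      exact (hcomp_rcomp (cid (hom j r)) lam k). }
    intros s phi phi'; rewrite T; intros G.
    assert (G' := split_cancel Hs (eq_trans (eq_sym (graft_vcomp _ _ phi))
      (eq_trans G (graft_vcomp _ _ phi')))).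
    assert (I : vcomp (rcomp (cid (hom j rw)) k') (rcomp (cid (hom j e)) k) = cid (hom j rw)).
    { rewrite vcomp_rcomp, vcomp_cid, rcomp_rcomp.
      etransitivity; [exact (f_equal (rcomp (cid (hom j rw))) E2)|apply rcomp_id]. }
    assert (L : forall phi : cell (hom j rw ::: qs) s 1 1,
      phi = graft cnil (rcomp (cid (hom j rw)) k') qs (graft cnil (rcomp (cid (hom j e)) k) qs
        phi)).
    { intros xi; etransitivity; [exact (eq_sym (graft_cid xi))|].
      etransitivity; [exact (f_equal (fun z => graft cnil z qs xi) (eq_sym I))|].
      exact (graft_vcomp (ps := [: hom j rw]) _ _ xi). }
    exact (eq_trans (L phi) (eq_trans (f_equal
      (graft cnil (rcomp (cid (hom j rw)) k' : cell [: hom j rw] (hom j e) 1 1) qs) G') (eq_sym (L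
        phi')))). }
  destruct (colimit_hom (hom_post psi (t1f r) (t1f r)) H) as [phi [H1 H2]].
  assert (G : graded_morphism (a := restr_algebra (a := adj_algebra l) (eq_refl (w ;; r)))
     (a' := restr_algebra (a := adj_algebra l) (t1f r)) phi).
  { unfold graded_morphism; simpl; rewrite hom_restr_tid.
    (* Both sides become the action of [r] composed with the image of [psi]: the cocone and [psi]
       come from [D], so their images commute with the action. *)
    apply Cancel.
    etransitivity; [exact (eq_sym (hcomp_graft_l theta'
      (hom_restr (adj_act l) (eq_refl (w ;; r)) (eq_refl (w ;; r))) phi))|].
    assert (K := restr_nat (adj_act l) (t1f r) (eq_refl (w ;; r)) (t1f r) (eq_refl (w ;; r))
      (cid (hom j r)) lam').
    rewrite cid_vcomp, hom_restr_tid in K.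
    etransitivity; [exact (f_equal (fun z => hcomp z phi) (eq_sym K))|].
    etransitivity; [apply (hcompA (ps := [: hom j r]) (qs := [: hom c 1]) (rs := qs) _ _ _
      eq_refl)|].
    etransitivity; [exact (f_equal (hcomp (adj_act l)) H1)|].
    assert (K' := restr_nat (adj_act l) (t1f r) (t1f r) (t1f r) (t1f r)
      (cid (hom j r)) psi).
    rewrite cid_vcomp, hom_restr_tid in K'.
    etransitivity; [exact K'|].
    symmetry; etransitivity; [exact (eq_sym (vcomp_graft (qs := qs) theta'
      (hcomp (cid (hom j rw)) phi) (adj_act l)))|].
    etransitivity; [exact (f_equal (fun z => vcomp z (adj_act l)) (graft_hcomp_cid theta' phi))|].
    f_equal.
    etransitivity; [apply (hcompA (ps := [: hom j r]) (qs := [: hom c 1]) (rs := qs) _ _ _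
      eq_refl)|].
    exact (f_equal (hcomp (cid (hom j r))) H1). }
  destruct (Hfull G) as [d [Hd _]].
  exists d; split.
  - apply (full_inj (a := adj_algebra l) (ex := t1f r) (ey := t1f r) Hfull).
    etransitivity; [exact (hom_post_comp lam' d (t1f r) (eq_refl (w ;; r)) (t1f r))|].
    etransitivity; [exact (f_equal (hcomp _) Hd)|exact H1].
  - intros d' <-.
    apply (full_inj (a := adj_algebra l) (ex := eq_refl (w ;; r)) (ey := t1f r) Hfull).
    etransitivity; [exact Hd|]; apply H2.
    symmetry; exact (hom_post_comp lam' d' (t1f r) (eq_refl (w ;; r)) (t1f r)). }
(* The algebra on [e] lifts to some [x] up to an isomorphism [i]. By [ext_act_whisker] the cocone
   [lam] followed by [i] is graded, hence is the image of a cocone in [D]. *)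
assert (Lift : exists (x : tight C D) (i : cell cnil (hom e (x ;; r)) 1 1)
  (lam' : cell [: hom c 1] (hom 1 x) 1 1), iso2 i /\ hom_post lam' (t1f r) (eq_refl (x ;; r)) =
    rcomp lam i).
{ destruct (Hlift (ext_algebra Hs Hx)) as [x [i [Hi Gi]]].
  unfold graded_morphism in Gi; simpl in Gi.
  assert (G : graded_morphism (a := restr_algebra (a := adj_algebra l) (t1f r))
    (a' := restr_algebra (a := adj_algebra l) (eq_refl (x ;; r))) (rcomp lam i)).
  { unfold graded_morphism; simpl; rewrite hom_restr_tid.
    etransitivity; [exact (hcomp_rcomp (adj_act l) lam i)|].
    etransitivity; [exact (f_equal (fun z => rcomp z i) (eq_sym (ext_act_whisker Hx)))|].
    etransitivity; [symmetry; apply vcomp_rcomp|].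
    rewrite rcomp1.
    etransitivity; [exact (f_equal (vcomp theta) Gi)|].
    etransitivity; [symmetry; apply vcompA|].
    rewrite <- rcomp1.
    apply (f_equal (fun z => vcomp z (hom_restr (adj_act l) (eq_refl (x ;; r)) (eq_refl (x ;;
      r))))).
    rewrite vcomp_rcomp, vcomp_cid; symmetry; exact (hcomp_rcomp (cid (hom j r)) lam i). }
  destruct (Hfull G) as [d [Hd _]]; exists x, i, d; auto. }
destruct Lift as [x [i [lam0 [Hi E0]]]].
assert (H0 : is_colimit (hom_post lam0 (t1f r) (eq_refl (x ;; r)))).
{ rewrite E0, rcomp1; exact (colimit_hcomp_iso Hcol Hi). }
split.
- intros w lam'; split; [apply Reflect|intros H].
  (* Preservation: every colimit cocone differs from [lam0] by an isomorphism, which [r] preserves,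
     and the image of [lam0] is a colimit. *)
  destruct (colimit_unique (Reflect _ _ H0) H) as [k [Hk <-]].
  refine (eq_ind_r (fun z => is_colimit z) _
    (hom_post_comp lam0 k (t1f r) (eq_refl (x ;; r)) (eq_refl (w ;; r)))).
  apply (colimit_hcomp_iso H0), hom_post_iso, Hk.
- exists x, lam0; apply Reflect, H0.
Qed.

End Creation.

Lemma comparison_creates (O : algebra_object (adj_monad l)) :
  equivalence (comparison O) -> creates j (t1f r).
Proof.
intros [k' [[a [a' Ha]] [b' [b [Hb1 Hb2]]]]].
assert (Ia : iso2 a) by (exists a'; exact Ha).
assert (Ib : iso2 b) by (exists b'; split; assumption).
pose (er := med_alg O (adj_algebra l) : r = comparison O ;; ualg O).
apply creates_of_full.
- apply (full_pull (a := adj_algebra l) (b := ualg O) (k := comparison O) (e := er)).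
  + exact (med_act O (adj_algebra l)).
  + intros Y Y' x y xk yk ex ey qs phi; exact (hom_post_full ex ey phi Ia Ib).
  + apply ualg_full.
- intros C e.
  pose (m := med O e).
  assert (em : m ;; k' ;; r = m ;; (k' ;; comparison O) ;; ualg O).
  { rewrite !tcompA; do 2 f_equal; exact er. }
  (* The lifting is the mediating tight-cell followed by the inverse equivalence; the isomorphism is
     the image under u_T of [b] whiskered by [m], hence graded. *)
  exists (m ;; k'), (hom_post (whisker (tf1 m) (eq_refl (m ;; (k' ;; comparison O))) b)
    (med_alg O e) em); split.
  + apply hom_post_iso, whisker_iso, Ib.
  + assert (G := graded_post (a := ualg O) (med_alg O e) em
      (whisker (tf1 m) (eq_refl (m ;; (k' ;; comparison O))) b)).
    unfold graded_morphism in G |- *; simpl in G |- *.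
    assert (em' : m ;; k' ;; r = m ;; k' ;; comparison O ;; ualg O).
    { rewrite em, <- (tcompA m); reflexivity. }
    assert (Hact : hom_restr (act (ualg O)) em em =
      hom_restr (adj_act l) (eq_refl (m ;; k' ;; r)) (eq_refl (m ;; k' ;; r))).
    { rewrite <- (act_comparison O).
      symmetry; etransitivity; [apply (hom_restr_restr (act (ualg O)) _ _ _ _ em' em')|].
      (* The two restrictions are along [m ;; (k' ;; comparison O)] and its other bracketing; they
         agree after rewriting by associativity. *)
      clear; revert em em'; rewrite <- (tcompA m); intros em em'.
      rewrite (proof_irrelevance _ em em'); reflexivity. }
    etransitivity; [exact (f_equal (fun z => hcomp z _) (eq_sym (med_act O e)))|].
    etransitivity; [exact G|exact (f_equal (vcomp _) Hact)].
Qed.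

End Forward.

Theorem theorem4 (X : equipment) (A E D : ob X) (j : tight A E) (r : tight D E)
    (hj : dense j) :
  non_strictly_monadic j r <->
  exists l : left_adjoint j r,
    inhabited (algebra_object (adj_monad l)) /\ creates_absolute_extensions j r.
Proof.
split.
- intros [l [O H]]; exists l; split; [constructor; exact O|].
  apply creates_absolute_extensionsE, (comparison_creates H).
- intros [l [[O] H]]; exists l, O.
  apply (comparison_equivalence hj); apply creates_absolute_extensionsE, H.
Qed.
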